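(* Let $\mathcal{M}$ be a family of axisymmetric metrics with nonnegative scalar curvature which is uniformly asymptotically flat outside of radius $R_0$. Let $\rho_0>0$ and suppose $\mathcal{M}$ is also radially monotone at $\rho_0$. Additionally, assume that $A=B=0$ in the coordinate representations of the metrics in $\mathcal{M}$. Let $\epsilon>0$, $\sigma>0$, and $\rho_1>\max\{\rho_0,R_0\}$ be given. Then there exists a constant $\delta>0$ such that if $g\in\mathcal{M}$, $m(g)\le\delta$, and $x$ and $y$ are any points such that the Euclidean line segment connecting them lies in $\Omega^{\rho_1}_{\rho_0}(\sigma)\times\{\phi_0\}$ for some $\phi_0$, then $$d_g(x,y)\le d(x,y)+\epsilon,$$ where $d_g$ is the Riemannian distance of $g$ and $d$ is the Euclidean distance in the cylindrical coordinates.
   Context: Axisymmetric metrics: smooth, asymptotically flat Riemannian metrics $g$ given in global cylindrical coordinates $(\rho,z,\phi)$ on $\mathbb{R}^3$ by $g=e^{2\alpha-2u}(d\rho^2+dz^2)+\rho^2e^{-2u}(d\phi+B\,d\rho+A\,dz)^2$, where $\alpha,u,A,B$ depend only on $(\rho,z)$. The Killing field is $\eta=\partial/\partial\phi$. The ADM mass is $m(g)=\lim_{R\to\infty}\frac{1}{16\pi}\int_{S_R}(g_{ij,j}-g_{jj,i})\nu^i$; as a standing fact, $m(g)=\frac1{16\pi}\int_{\mathbb{R}^3}\Big[e^{-2(u-\alpha)}\big(R_g+\tfrac{\rho^2e^{-4\alpha+2u}}{2}(\partial_zB-\partial_\rho A)^2\big)+2|\nabla u|^2\Big]\rho\,d\rho\,dz\,d\phi$,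 with $R_g$ the scalar curvature and $|\nabla u|$ Euclidean. Uniformly asymptotically flat outside of radius $R_0$: there is a constant $C$ such that for every $g\in\mathcal{M}$ and all $r=\sqrt{\rho^2+z^2}\ge R_0$, $|\partial^I u|,|\partial^I\alpha|,|\partial^I A|,|\partial^I B|\le C/r^{1+|I|}$ for multi-indices $|I|\le 2$. Radially monotone at $\rho_0$: for each $g\in\mathcal{M}$, $\frac{\partial}{\partial\rho}\Big(\frac1\rho\frac{|\eta|_g}{|\nabla\rho|_g}\Big)\le0$ on $\{\rho=\rho_0\}$; equivalently $\partial_\rho(\alpha-2u)(\rho_0,z)\le 0$ for all $z$. Region: $\Omega^{\rho_1}_{\rho_0}(\sigma)=\{(\rho,z):\rho_0+\sigma\le\rho\le\rho_1,\ |z|\le\rho_1/2\}$. *)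

(* Defs.v *)
From Stdlib Require Import Reals Lra List.
From Coquelicot Require Import Coquelicot.
Open Scope R_scope.

(** * Tensor calculus in a chart of dimension three *)

Definition pt : Type := (R * R * R)%type.

Inductive idx : Set := i1 | i2 | i3.

Definition idx_eqb (i j : idx) : bool :=
  match i, j with
  | i1, i1 | i2, i2 | i3, i3 => true
  | _, _ => false
  end.

Definition delta (i j : idx) : R := if idx_eqb i j then 1 else 0.

Definition sum3 (f : idx -> R) : R := f i1 + f i2 + f i3.

Definition coord (i : idx) (p : pt) : R :=
  match i with i1 => fst (fst p) | i2 => snd (fst p) | i3 => snd p end.

Definition upd (i : idx) (p : pt) (t : R) : pt :=
  match i with
  | i1 => (t, snd (fst p), snd p)
  | i2 => (fst (fst p), t, snd p)
  | i3 => (fst (fst p), snd (fst p), t)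
  end.

Definition pd (i : idx) (f : pt -> R) (p : pt) : R :=
  Derive (fun t => f (upd i p t)) (coord i p).

Definition pds (l : list idx) (f : pt -> R) : pt -> R := fold_right pd f l.

(* C^infinity on all of R^3: every iterated partial derivative is continuous
   and again has partial derivatives (needed since [Derive] is total). *)
Definition smooth (f : pt -> R) : Prop :=
  forall (l : list idx) (p : pt),
    continuous (pds l f) p /\
    forall i, ex_derive (fun t => pds l f (upd i p t)) (coord i p).

(* A field of 3 x 3 matrices: components of a (0,2)-tensor in a chart. *)
Definition tensor2 : Type := idx -> idx -> pt -> R.

Definition next (i : idx) : idx :=
  match i with i1 => i2 | i2 => i3 | i3 => i1 end.

(* The cyclic choice of rows and columns absorbs the sign (-1)^(i+j). *)
Definition cofactor (g : tensor2) (i j : idx) (p : pt) : R :=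
  g (next i) (next j) p * g (next (next i)) (next (next j)) p
  - g (next i) (next (next j)) p * g (next (next i)) (next j) p.

Definition det (g : tensor2) (p : pt) : R :=
  sum3 (fun j => g i1 j p * cofactor g i1 j p).

Definition ginv (g : tensor2) (i j : idx) (p : pt) : R :=
  cofactor g j i p / det g p.

Lemma ginv_right (g : tensor2) (p : pt) (i j : idx) :
  det g p <> 0 -> sum3 (fun k => g i k p * ginv g k j p) = delta i j.
Proof.
  intros H; unfold ginv, delta, sum3.
  destruct i, j; simpl; unfold det, sum3, cofactor in *; simpl in *; field; exact H.
Qed.

Lemma ginv_left (g : tensor2) (p : pt) (i j : idx) :
  det g p <> 0 -> sum3 (fun k => ginv g i k p * g k j p) = delta i j.
Proof.
  intros H; unfold ginv, delta, sum3.
  destruct i, j; simpl; unfold det, sum3, cofactor in *; simpl in *; field; exact H.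
Qed.

(* [christoffel g k i j] is Gamma^k_ij. *)
Definition christoffel (g : tensor2) (k i j : idx) (p : pt) : R :=
  / 2 * sum3 (fun l => ginv g k l p *
          (pd i (g j l) p + pd j (g i l) p - pd l (g i j) p)).

(* Sign convention: round spheres have positive Ricci curvature. *)
Definition ricci (g : tensor2) (i j : idx) (p : pt) : R :=
  sum3 (fun k =>
    pd k (christoffel g k i j) p - pd j (christoffel g k i k) p
    + sum3 (fun l => christoffel g k k l p * christoffel g l i j p
                     - christoffel g k j l p * christoffel g l i k p)).

Definition scalar_curvature (g : tensor2) (p : pt) : R :=
  sum3 (fun i => sum3 (fun j => ginv g i j p * ricci g i j p)).

(** * Riemannian metrics on R^3 in Cartesian coordinates *)

Definition enorm (p : pt) : R :=
  sqrt (coord i1 p ^ 2 + coord i2 p ^ 2 + coord i3 p ^ 2).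

Definition edist (x y : pt) : R :=
  sqrt (sum3 (fun i => (coord i x - coord i y) ^ 2)).

Definition quad (g : tensor2) (p : pt) (v : idx -> R) : R :=
  sum3 (fun i => sum3 (fun j => g i j p * v i * v j)).

Definition riemannian (g : tensor2) : Prop :=
  (forall i j, smooth (g i j)) /\
  (forall i j p, g i j p = g j i p) /\
  (forall p v, (exists i, v i <> 0) -> 0 < quad g p v).

(* The usual decay (order tau > 1/2) making the ADM mass a geometric
   invariant.  Integrability of the scalar curvature is not required here. *)
Definition asymptotically_flat (g : tensor2) : Prop :=
  exists tau C r0 : R, / 2 < tau /\ 0 < r0 /\
    forall (i j : idx) (l : list idx) (p : pt),
      (length l <= 2)%nat -> r0 <= enorm p ->
      Rabs (pds l (fun q => g i j q - delta i j) p)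
        <= C / Rpower (enorm p) (tau + INR (length l)).

Definition sphere_pt (r theta phi : R) : pt :=
  (r * sin theta * cos phi, r * sin theta * sin phi, r * cos theta).

(* (1/16 pi) int_{S_r} (g_ij,j - g_jj,i) nu^i, with the Euclidean normal nu
   and area element r^2 sin(theta) dtheta dphi. *)
Definition adm_flux (g : tensor2) (r : R) : R :=
  / (16 * PI) *
  RInt (fun phi =>
    RInt (fun theta =>
      let p := sphere_pt r theta phi in
      sum3 (fun i => sum3 (fun j => pd j (g i j) p - pd i (g j j) p)
                     * (coord i p / r))
      * (r ^ 2 * sin theta)) 0 PI) 0 (2 * PI).

Definition is_adm_mass (g : tensor2) (m : R) : Prop :=
  is_lim (adm_flux g) p_infty m.

(* Every C^1 curve on [0,1] is the restriction of a C^1 curve on R. *)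
Definition C1_curve (c : R -> pt) : Prop :=
  forall i t, ex_derive (fun s => coord i (c s)) t /\
              continuous (Derive (fun s => coord i (c s))) t.

Definition arc_length (g : tensor2) (c : R -> pt) : R :=
  RInt (fun t => sqrt (quad g (c t) (fun i => Derive (fun s => coord i (c s)) t)))
       0 1.

(* [path_length g x y L]: some piecewise C^1 curve from x to y, given as a
   finite concatenation of C^1 arcs, has g-length L. *)
Inductive path_length (g : tensor2) : pt -> pt -> R -> Prop :=
| path_nil (x : pt) : path_length g x x 0
| path_cons (c : R -> pt) (y : pt) (L : R) :
    C1_curve c -> path_length g (c 1) y L ->
    path_length g (c 0) y (arc_length g c + L).

Definition riem_dist (g : tensor2) (x y : pt) : Rbar :=
  Glb_Rbar (path_length g x y).

(** * Axisymmetric metrics *)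

Definition cyl_pt (rho z phi : R) : pt := (rho * cos phi, rho * sin phi, z).

(* Components, in the chart (rho, z, phi), of
   e^(2 al - 2 u) (drho^2 + dz^2) + rho^2 e^(-2 u) (dphi + B drho + A dz)^2. *)
Definition cyl_metric (u al A B : R -> R -> R) : tensor2 :=
  fun i j p =>
    let rho := coord i1 p in
    let z := coord i2 p in
    let omega k := match k with i1 => B rho z | i2 => A rho z | i3 => 1 end in
    let flat := match i, j with i1, i1 | i2, i2 => 1 | _, _ => 0 end in
    exp (2 * al rho z - 2 * u rho z) * flat
    + rho ^ 2 * exp (- 2 * u rho z) * (omega i * omega j).

(* g has Cartesian components, the result has (rho, z, phi) components:
   i, j index the chart (rho, z, phi), while k, l index (x, y, z). *)
Definition pullback_cyl (g : tensor2) : tensor2 :=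
  fun i j p =>
    let chart q := cyl_pt (coord i1 q) (coord i2 q) (coord i3 q) in
    sum3 (fun k => sum3 (fun l =>
      g k l (chart p) * pd i (fun q => coord k (chart q)) p
                      * pd j (fun q => coord l (chart q)) p)).

(* The metric is a smooth tensor on all of R^3, so [ax_g] carries the
   regularity across the axis.  The coefficients only matter for rho > 0. *)
Record axisym_metric : Type := {
  ax_g : tensor2;
  ax_u : R -> R -> R;
  ax_al : R -> R -> R;
  ax_A : R -> R -> R;
  ax_B : R -> R -> R;
  ax_riemannian : riemannian ax_g;
  ax_flat : asymptotically_flat ax_g;
  ax_repr : forall (rho z phi : R) (i j : idx), 0 < rho ->
    pullback_cyl ax_g i j (rho, z, phi)
    = cyl_metric ax_u ax_al ax_A ax_B i j (rho, z, phi)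
}.

Definition ax_cyl (G : axisym_metric) : tensor2 :=
  cyl_metric (ax_u G) (ax_al G) (ax_A G) (ax_B G).

(* Computed in the chart (rho, z, phi); values on the axis are limits of
   these, since the metric is smooth there. *)
Definition nonneg_scalar_curvature (G : axisym_metric) : Prop :=
  forall rho z phi, 0 < rho -> 0 <= scalar_curvature (ax_cyl G) (rho, z, phi).

Definition partial2 (a b : nat) (f : R -> R -> R) (rho z : R) : R :=
  Derive_n (fun r => Derive_n (fun s => f r s) b z) a rho.

Definition decays (R0 C : R) (f : R -> R -> R) : Prop :=
  forall (a b : nat) (rho z : R), (a + b <= 2)%nat -> 0 < rho ->
    R0 <= sqrt (rho ^ 2 + z ^ 2) ->
    Rabs (partial2 a b f rho z) <= C / sqrt (rho ^ 2 + z ^ 2) ^ (1 + (a + b)).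

Definition uniformly_AF (M : axisym_metric -> Prop) (R0 : R) : Prop :=
  exists C : R, forall G, M G ->
    decays R0 C (ax_u G) /\ decays R0 C (ax_al G) /\
    decays R0 C (ax_A G) /\ decays R0 C (ax_B G).

(* eta = d/dphi, and |grad rho|_g^2 = g^{rho rho}. *)
Definition norm_eta (G : axisym_metric) (p : pt) : R := sqrt (ax_cyl G i3 i3 p).

Definition norm_grad_rho (G : axisym_metric) (p : pt) : R :=
  sqrt (ginv (ax_cyl G) i1 i1 p).

Definition radially_monotone (M : axisym_metric -> Prop) (rho0 : R) : Prop :=
  forall G, M G -> forall z phi : R,
    pd i1 (fun p => / coord i1 p * (norm_eta G p / norm_grad_rho G p))
       (rho0, z, phi) <= 0.

Definition Omega (rho0 rho1 sigma rho z : R) : Prop :=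
  rho0 + sigma <= rho <= rho1 /\ Rabs z <= rho1 / 2.

Definition segment (x y : pt) (t : R) : pt :=
  ((1 - t) * coord i1 x + t * coord i1 y,
   (1 - t) * coord i2 x + t * coord i2 y,
   (1 - t) * coord i3 x + t * coord i3 y).

(* Main.v *)
Require Import Defs.
From Stdlib Require Import Reals Lra Lia List FunctionalExtensionality Classical Nsatz.
From Coquelicot Require Import Coquelicot.
Open Scope R_scope.
Set Bullet Behavior "Strict Subproofs".

(** Write w = alpha - 2 u, so that the metric on a half-plane of constant phi is
    e^(2 (u + w)) (drho^2 + dz^2). The ADM flux through the sphere of radius r agrees up
    to O(1/r) with a function of r which vanishes at r = 0 and whose derivative is the
    integral of e^(2 alpha - 2 u) R_g + 2 |grad u|^2 over that sphere; hence
    the mass controls the Dirichlet energy of u. Moreover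
      d^2 w / drho^2 + d^2 w / dz^2 <= 2 u_rho / rho
    since R_g >= 0. Integrating the divergence of (atan (w - c) - 2) grad w over
    rho >= rho0, where w_rho <= 0 on the inner boundary has the favourable sign,
    bounds the integral of |grad w|^2 / (1 + (w - c)^2) by a small constant,
    uniformly in the number c.

    By averaging, most lines in a given direction carry little energy, and on such a line
    u and w are almost constant: choose c to be the value of w at one of its points.
    A long such line reaches the asymptotic region, so u and w are almost 0 on it; this
    gives a line parallel to the segment xy and of almost the same length. The
    energy bounds are scale invariant, so each endpoint can be joined to that line through
    good horizontal and vertical lines at the scales r, r/2, r/4, ...; u + w grows
    at most linearly and slowly in the number of scales, while the Euclidean lengths decay
    geometrically. *)

(** * Functions of two variables *)

(** Two obstacles shape the argument. First, in the plane a small Dirichlet energy does not bound a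
    function pointwise: logarithmic spikes remain possible, in particular at the endpoints of the
    segment, so the aim is distances and not the metric itself. What survives is that a strip of
    width s and length l contains a line of energy at most E / s, on which the squared oscillation
    is of order l E / s, a quantity that sees only the ratio l / s. If halving the scale raises u +
    w by at most 1/4 < log 2, the lengths of the legs still form a convergent series.

    Second, curvature bounds the Laplacian of w from one side only, so the energy of w itself is out
    of reach. A bounded increasing multiplier gives an energy whose weight degenerates where w is
    far from c. As w has no a priori bound, no single c would do.

    The constants are fixed in this order: tolerance on the outer edges, size of the rectangle,
    admissible energy, size of a larger rectangle, Young parameter, mass. *)

Ltac ringR := match goal with |- ?l = ?r => change (l = r :> R) end; ring.

Section Continuity.
Context {U : UniformSpace}.
Implicit Types f g : U -> R.

Lemma cont_plus f g x :
  continuous f x -> continuous g x -> continuous (fun t => f t + g t) x.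
Proof. intros; apply (continuous_plus (V := R_NormedModule)); assumption. Qed.

Lemma cont_opp f x : continuous f x -> continuous (fun t => - f t) x.
Proof. intros; apply (continuous_opp (V := R_NormedModule)); assumption. Qed.

Lemma cont_minus f g x :
  continuous f x -> continuous g x -> continuous (fun t => f t - g t) x.
Proof. intros; apply (continuous_minus (V := R_NormedModule)); assumption. Qed.

Lemma cont_mult f g x :
  continuous f x -> continuous g x -> continuous (fun t => f t * g t) x.
Proof. intros; apply (continuous_mult (K := R_AbsRing)); assumption. Qed.

Lemma cont_inv f x : continuous f x -> f x <> 0 -> continuous (fun t => / f t) x.
Proof. intros; apply (continuous_comp f Rinv); [ assumption | apply continuous_Rinv; assumption ]. Qed.

Lemma cont_div f g x :
  continuous f x -> continuous g x -> g x <> 0 -> continuous (fun t => f t / g t) x.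
Proof. intros; apply cont_mult; [ | apply cont_inv ]; assumption. Qed.

Lemma cont_pow f n x : continuous f x -> continuous (fun t => f t ^ n) x.
Proof.
  intros H; induction n as [|n IH]; simpl.
  - apply continuous_const.
  - apply cont_mult; assumption.
Qed.

Lemma cont_comp (h : R -> R) f x :
  (forall y, continuous h y) -> continuous f x -> continuous (fun t => h (f t)) x.
Proof. intros Hh Hf; apply (continuous_comp f h); auto. Qed.

Definition cont2 (f : R -> R -> R) : Prop :=
  forall x y, continuous (fun p : R * R => f (fst p) (snd p)) (x, y).

Lemma cont_comp2 (h : R -> R -> R) f g x :
  cont2 h -> continuous f x -> continuous g x -> continuous (fun t => h (f t) (g t)) x.
Proof. intros Hh Hf Hg; apply continuous_comp_2; auto; apply Hh. Qed.
End Continuity.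

Lemma cont_exp x : continuous exp x.
Proof. apply continuous_exp. Qed.
Lemma cont_sin x : continuous sin x.
Proof. apply continuous_sin. Qed.
Lemma cont_cos x : continuous cos x.
Proof. apply continuous_cos. Qed.
Lemma cont_atan x : continuous atan x.
Proof. apply continuous_atan. Qed.
Lemma cont_sqrt x : continuous sqrt x.
Proof. apply continuous_sqrt. Qed.
Lemma cont_fst {U V : UniformSpace} (p : U * V) : continuous fst p.
Proof. destruct p; apply continuous_fst. Qed.
Lemma cont_snd {U V : UniformSpace} (p : U * V) : continuous snd p.
Proof. destruct p; apply continuous_snd. Qed.

Ltac cont :=
  lazymatch goal with
  | |- cont2 _ => (assumption || (intros ? ?; cbv beta; cont))
  | |- forall _, _ => intros; cont
  | |- continuous (fun _ => ?c) _ => apply continuous_const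
  | |- continuous (fun x => x) _ => apply continuous_id
  | |- continuous fst _ => apply cont_fst
  | |- continuous snd _ => apply cont_snd
  | |- continuous (fun x => fst x) _ => apply cont_fst
  | |- continuous (fun x => snd x) _ => apply cont_snd
  | |- continuous (fun x => _ + _) _ => apply cont_plus; cont
  | |- continuous (fun x => _ - _) _ => apply cont_minus; cont
  | |- continuous (fun x => _ * _) _ => apply cont_mult; cont
  | |- continuous (fun x => - _) _ => apply cont_opp; cont
  | |- continuous (fun x => _ / _) _ => apply cont_div; cont
  | |- continuous (fun x => / _) _ => apply cont_inv; cont
  | |- continuous (fun x => _ ^ _) _ => apply cont_pow; cont
  | |- continuous (fun x => exp _) _ => apply (cont_comp exp); [ exact cont_exp | cont ]
  | |- continuous (fun x => sin _) _ => apply (cont_comp sin); [ exact cont_sin | cont ]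
  | |- continuous (fun x => cos _) _ => apply (cont_comp cos); [ exact cont_cos | cont ]
  | |- continuous (fun x => atan _) _ => apply (cont_comp atan); [ exact cont_atan | cont ]
  | |- continuous (fun x => sqrt _) _ => apply (cont_comp sqrt); [ exact cont_sqrt | cont ]
  | |- continuous (Rminus ?a) ?x => change (continuous (fun t => a - t) x); cont
  | |- continuous (Rplus ?a) ?x => change (continuous (fun t => a + t) x); cont
  | |- continuous (Rmult ?a) ?x => change (continuous (fun t => a * t) x); cont
  | |- continuous sin _ => apply cont_sin
  | |- continuous cos _ => apply cont_cos
  | |- continuous exp _ => apply cont_exp
  | |- continuous (fun x => ?h (@?f x) (@?g x)) _ =>
      first [ apply (cont_comp2 h f g); [ assumption | cont | cont ] | try solve [ auto ] ]
  | |- continuous (?h ?a) _ =>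
      first [ assumption | apply (cont_comp2 h (fun _ => a) (fun t => t)); [ assumption | cont | cont ] | try solve [ auto ] ]
  | |- continuous (fun x => ?h (@?f x)) _ =>
      first [ apply (cont_comp h f); [ assumption | cont ] | try solve [ auto ] ]
  | |- _ => cbn [fst snd]; try solve [ auto ]
  end.

Definition D1 (f : R -> R -> R) (x y : R) : R := Derive (fun t => f t y) x.
Definition D2 (f : R -> R -> R) (x y : R) : R := Derive (fun t => f x t) y.

(** Functions of class C^n on the plane. Existence of the partial derivatives is demanded separately
    from the regularity of [D1 f] and [D2 f], because [Derive] is total. *)
Fixpoint Ck (n : nat) (f : R -> R -> R) : Prop :=
  cont2 f /\
  match n with
  | O => True
  | S m => (forall x y, ex_derive (fun t => f t y) x) /\
           (forall x y, ex_derive (fun t => f x t) y) /\ Ck m (D1 f) /\ Ck m (D2 f)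
  end.

Lemma Ck_cont2 n f : Ck n f -> cont2 f.
Proof. destruct n; simpl; tauto. Qed.

Lemma Ck_D1 n f : Ck (S n) f -> Ck n (D1 f).
Proof. simpl; tauto. Qed.

Lemma Ck_D2 n f : Ck (S n) f -> Ck n (D2 f).
Proof. simpl; tauto. Qed.

Lemma Ck_is_derive1 n f x y : Ck (S n) f -> is_derive (fun t => f t y) x (D1 f x y).
Proof. intros (_ & H & _); apply Derive_correct, H. Qed.

Lemma Ck_is_derive2 n f x y : Ck (S n) f -> is_derive (fun t => f x t) y (D2 f x y).
Proof. intros (_ & _ & H & _); apply Derive_correct, H. Qed.

Lemma Ck_pred n f : Ck (S n) f -> Ck n f.
Proof.
  revert f; induction n as [|n IH]; intros f (H0 & H1 & H2 & H3 & H4).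
  - simpl; auto.
  - simpl; repeat split; auto; apply IH; assumption.
Qed.

Lemma Ck_intro n f f1 f2 :
  cont2 f -> (forall x y, is_derive (fun t => f t y) x (f1 x y)) ->
  (forall x y, is_derive (fun t => f x t) y (f2 x y)) ->
  Ck n f1 -> Ck n f2 -> Ck (S n) f.
Proof.
  intros H0 H1 H2 C1 C2.
  assert (E1 : D1 f = f1) by (extensionality x; extensionality y; apply is_derive_unique, H1).
  assert (E2 : D2 f = f2) by (extensionality x; extensionality y; apply is_derive_unique, H2).
  simpl; rewrite E1, E2; repeat split; auto; intros; eexists; eauto.
Qed.

Lemma Ck_swap n f : Ck n f -> Ck n (fun x y => f y x).
Proof.
  revert f; induction n as [|n IH]; intros f H; simpl in *.
  - split; auto. destruct H as [H _]; cont.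
  - destruct H as (H0 & H1 & H2 & H3 & H4); split; [ cont |].
    split; [ exact (fun x y => H2 y x) | split; [ exact (fun x y => H1 y x) | split ] ].
    + apply (IH _ H4).
    + apply (IH _ H3).
Qed.

Lemma Ck_const n c : Ck n (fun _ _ => c).
Proof.
  revert c; induction n as [|n IH]; intros c.
  - split; auto; cont.
  - apply Ck_intro with (fun _ _ => 0) (fun _ _ => 0); auto; [ cont | | ];
      intros; apply (is_derive_const (V := R_NormedModule)).
Qed.

Lemma Ck_plus n f g : Ck n f -> Ck n g -> Ck n (fun x y => f x y + g x y).
Proof.
  revert f g; induction n as [|n IH]; intros f g Hf Hg.
  - destruct Hf as [Hf _], Hg as [Hg _]; split; auto; cont.
  - pose proof (Ck_cont2 _ _ Hf); pose proof (Ck_cont2 _ _ Hg).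
    apply Ck_intro with (fun x y => D1 f x y + D1 g x y) (fun x y => D2 f x y + D2 g x y).
    + cont.
    + intros; apply (is_derive_plus (V := R_NormedModule)); eapply Ck_is_derive1; eauto.
    + intros; apply (is_derive_plus (V := R_NormedModule)); eapply Ck_is_derive2; eauto.
    + apply IH; apply Ck_D1; assumption.
    + apply IH; apply Ck_D2; assumption.
Qed.

Lemma Ck_mult n f g : Ck n f -> Ck n g -> Ck n (fun x y => f x y * g x y).
Proof.
  revert f g; induction n as [|n IH]; intros f g Hf Hg.
  - destruct Hf as [Hf _], Hg as [Hg _]; split; auto; cont.
  - pose proof (Ck_cont2 _ _ Hf); pose proof (Ck_cont2 _ _ Hg).
    apply Ck_intro with (fun x y => D1 f x y * g x y + f x y * D1 g x y)
                        (fun x y => D2 f x y * g x y + f x y * D2 g x y).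
    + cont.
    + intros; apply (is_derive_mult (K := R_AbsRing) (fun t => f t y) (fun t => g t y));
        [ eapply Ck_is_derive1; eauto .. | exact Rmult_comm ].
    + intros; apply (is_derive_mult (K := R_AbsRing) (fun t => f x t) (fun t => g x t));
        [ eapply Ck_is_derive2; eauto .. | exact Rmult_comm ].
    + apply Ck_plus; apply IH; auto using Ck_D1, Ck_pred.
    + apply Ck_plus; apply IH; auto using Ck_D2, Ck_pred.
Qed.

Lemma Ck_inv n f : (forall x y, 0 < f x y) -> Ck n f -> Ck n (fun x y => / f x y).
Proof.
  intros Hp; revert f Hp; induction n as [|n IH]; intros f Hp Hf.
  - destruct Hf as [Hf _]; split; auto; cont. apply Rgt_not_eq, Hp.
  - pose proof (Ck_cont2 _ _ Hf).
    apply Ck_intro with (fun x y => -1 * D1 f x y * (/ f x y * / f x y))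
                        (fun x y => -1 * D2 f x y * (/ f x y * / f x y)).
    + cont. apply Rgt_not_eq, Hp.
    + intros; specialize (Hp x y).
      replace (-1 * D1 f x y * (/ f x y * / f x y)) with (- D1 f x y / f x y ^ 2) by (field; lra).
      apply (is_derive_inv (fun t => f t y)); [ eapply Ck_is_derive1; eauto | lra ].
    + intros; specialize (Hp x y).
      replace (-1 * D2 f x y * (/ f x y * / f x y)) with (- D2 f x y / f x y ^ 2) by (field; lra).
      apply (is_derive_inv (fun t => f x t)); [ eapply Ck_is_derive2; eauto | lra ].
    + repeat apply Ck_mult; auto using Ck_const, Ck_D1, Ck_pred.
    + repeat apply Ck_mult; auto using Ck_const, Ck_D2, Ck_pred.
Qed.

Lemma Ck_ln n f : (forall x y, 0 < f x y) -> Ck (S n) f -> Ck (S n) (fun x y => ln (f x y)).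
Proof.
  intros Hp Hf.
  apply Ck_intro with (fun x y => D1 f x y * / f x y) (fun x y => D2 f x y * / f x y).
  - intros x y. apply (continuous_comp (fun p => f (fst p) (snd p)) ln).
    + apply (Ck_cont2 _ _ Hf).
    + apply (ex_derive_continuous (V := R_NormedModule)); eexists; apply is_derive_ln, Hp.
  - intros; apply (is_derive_comp ln (fun t => f t y)); [ apply is_derive_ln, Hp | eapply Ck_is_derive1; eauto ].
  - intros; apply (is_derive_comp ln (fun t => f x t)); [ apply is_derive_ln, Hp | eapply Ck_is_derive2; eauto ].
  - apply Ck_mult; [ apply Ck_D1; auto | apply Ck_inv; auto using Ck_pred ].
  - apply Ck_mult; [ apply Ck_D2; auto | apply Ck_inv; auto using Ck_pred ].
Qed.

Lemma cont2_continuity_2d f x y : cont2 f -> continuity_2d_pt f x y.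
Proof. intros H; apply continuity_2d_pt_filterlim, H. Qed.

Lemma D12_D21 f x y : Ck 2 f -> D1 (D2 f) x y = D2 (D1 f) x y.
Proof.
  intros (H0 & H1 & H2 & (_ & _ & H3 & _ & H5) & (_ & H4 & _ & H6 & _)).
  apply Schwarz.
  - exists (mkposreal 1 Rlt_0_1); intros u v _ _.
    exact (conj (H1 u v) (conj (H2 u v) (conj (H4 u v) (H3 u v)))).
  - exact (cont2_continuity_2d (D1 (D2 f)) x y (Ck_cont2 0 _ H6)).
  - exact (cont2_continuity_2d (D2 (D1 f)) x y (Ck_cont2 0 _ H5)).
Qed.

Lemma is_derive_comp2 f g h t dg dh :
  Ck 1 f -> is_derive g t dg -> is_derive h t dh ->
  is_derive (fun s => f (g s) (h s)) t (D1 f (g t) (h t) * dg + D2 f (g t) (h t) * dh).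
Proof.
  intros Hf Hg Hh.
  apply is_derive_Reals, derivable_pt_lim_comp_2d; try (apply is_derive_Reals; assumption).
  apply filterdiff_differentiable_pt_lim.
  apply is_derive_filterdiff with (dfx := D1 f).
  - apply filter_forall; intros u. eapply Ck_is_derive1; eauto.
  - eapply Ck_is_derive2; eauto.
  - apply (Ck_cont2 0). apply Ck_D1; assumption.
Qed.

Lemma ex_RInt_cont (f : R -> R) a b : (forall x, continuous f x) -> ex_RInt f a b.
Proof. intros H; apply (ex_RInt_continuous (V := R_CompleteNormedModule)); auto. Qed.

Ltac exint := apply ex_RInt_cont; intros; cont.

Lemma cont_RInt_param f a b : cont2 f -> forall x, continuous (fun x => RInt (fun y => f x y) a b) x.
Proof.
  assert (W : forall a b x, a <= b -> cont2 f -> continuous (fun x => RInt (fun y => f x y) a b) x).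
  { clear a b; intros a b x Hab Hf.
    apply continuity_pt_filterlim.
    intros eps Heps.
    (* The summand 1 keeps the quotient meaningful when a = b. *)
    assert (He : 0 < eps / (b - a + 1)) by (apply Rdiv_lt_0_compat; lra).
    destruct (uniform_continuity_2d_1d' f a b x (fun y _ => cont2_continuity_2d f x y Hf)
                (mkposreal _ He)) as [d Hd].
    exists d; split; [ apply d |].
    intros x' [_ Hx']; simpl in *; unfold R_dist in *.
    rewrite <- (RInt_minus (V := R_CompleteNormedModule)) by exint.
    apply Rle_lt_trans with ((b - a) * (eps / (b - a + 1))).
    - apply abs_RInt_le_const; auto.
      + change (ex_RInt (fun t => f x' t - f x t) a b). exint.
      + intros t Ht. apply Rlt_le. pose proof (cond_pos d).
        apply Rabs_def2 in Hx'. apply Hd; try lra.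
        rewrite Rminus_diag, Rabs_R0; lra.
    - apply Rlt_le_trans with ((b - a + 1) * (eps / (b - a + 1))).
      + apply Rmult_lt_compat_r; lra.
      + apply Req_le; field; lra. }
  intros Hf x; destruct (Rle_dec a b) as [H|H].
  - apply W; auto.
  - apply continuous_ext with (fun x => - RInt (fun y => f x y) b a).
    + intros t. apply (opp_RInt_swap (V := R_CompleteNormedModule)). exint.
    + apply cont_opp, W; auto; lra.
Qed.

Lemma is_derive_RInt_upper (f : R -> R) a t :
  (forall x, continuous f x) -> is_derive (fun s => RInt f a s) t (f t).
Proof.
  intros Hf; apply (is_derive_RInt (V := R_NormedModule)) with (a := a); auto.
  apply filter_forall; intros s. apply (RInt_correct (V := R_CompleteNormedModule)); exint; auto.
Qed.

Lemma is_derive_RInt_param_cont2 f f1 a b x :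
  (forall x y, is_derive (fun t => f t y) x (f1 x y)) -> cont2 f1 ->
  (forall x y, continuous (fun t => f x t) y) ->
  is_derive (fun s => RInt (fun y => f s y) a b) x (RInt (fun y => f1 x y) a b).
Proof.
  intros Hd Hc Hf.
  assert (E : (fun u v => Derive (fun z => f z v) u) = f1)
    by (extensionality u; extensionality v; apply is_derive_unique, Hd).
  rewrite <- (RInt_ext (fun y => Derive (fun u => f u y) x)).
  2: intros; apply is_derive_unique, Hd.
  apply (is_derive_RInt_param f).
  - apply filter_forall; intros; eexists; apply Hd.
  - intros t _. rewrite E. apply cont2_continuity_2d; assumption.
  - apply filter_forall; intros. apply ex_RInt_cont; auto.
Qed.

(** As functions of the upper limit t of the x-integral, both sides have the same derivative, and
    both vanish at t = a. *)
Lemma fubini_rect f a b c d : cont2 f -> a <= b ->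
  RInt (fun y => RInt (fun x => f x y) a b) c d = RInt (fun x => RInt (fun y => f x y) c d) a b.
Proof.
  intros Hf Hab.
  assert (Hs : cont2 (fun y x => f x y)) by cont.
  pose (h t := RInt (fun y => RInt (fun x => f x y) a t) c d
               - RInt (fun x => RInt (fun y => f x y) c d) a t).
  assert (Hh : forall t, is_derive h t 0).
  { intros t. replace 0 with (RInt (fun y => f t y) c d - RInt (fun y => f t y) c d) by ring.
    apply (is_derive_minus (V := R_NormedModule)).
    - apply (is_derive_RInt_param_cont2 (fun t y => RInt (fun x => f x y) a t)); auto.
      + intros; apply (is_derive_RInt_upper (fun s => f s y)). intros; cont.
      + intros; apply (cont_RInt_param (fun y x => f x y)); assumption.
    - apply (is_derive_RInt_upper (fun s => RInt (fun y => f s y) c d)).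
      apply cont_RInt_param; assumption. }
  assert (E : h a = h b).
  { destruct Hab as [Hab | ->]; auto.
    apply (eq_is_derive (V := R_NormedModule)); auto. }
  unfold h in E.
  rewrite (RInt_ext _ (fun _ => 0)) in E.
  2: { intros; apply (RInt_point (V := R_CompleteNormedModule)). }
  rewrite (RInt_const (V := R_CompleteNormedModule)) in E.
  rewrite (RInt_point (V := R_CompleteNormedModule)) in E.
  unfold scal, zero in E; simpl in E; unfold mult in E; simpl in E; lra.
Qed.

(** * Lines of small energy *)

Lemma RInt_nonneg_mono (f : R -> R) a b a' b' :
  (forall x, continuous f x) -> (forall x, a' <= x <= b' -> 0 <= f x) ->
  a' <= a -> a <= b -> b <= b' -> RInt f a b <= RInt f a' b'.
Proof.
  intros Hc Hp H1 H2 H3.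
  rewrite <- (RInt_Chasles (V := R_CompleteNormedModule) f a' a b') by exint.
  rewrite <- (RInt_Chasles (V := R_CompleteNormedModule) f a b b') by exint.
  unfold plus; simpl.
  assert (0 <= RInt f a' a) by (apply RInt_ge_0; [ lra | exint | intros; apply Hp; lra ]).
  assert (0 <= RInt f b b') by (apply RInt_ge_0; [ lra | exint | intros; apply Hp; lra ]).
  lra.
Qed.

Definition iint (f : R -> R -> R) (a1 a2 b1 b2 : R) : R :=
  RInt (fun y => RInt (fun x => f x y) a1 a2) b1 b2.

Lemma iint_swap f a1 a2 b1 b2 : cont2 f -> a1 <= a2 ->
  iint (fun x y => f y x) b1 b2 a1 a2 = iint f a1 a2 b1 b2.
Proof. intros Hf Ha; symmetry; apply fubini_rect; assumption. Qed.

Lemma cont_RInt_inner f a b : cont2 f -> forall y, continuous (fun y => RInt (fun x => f x y) a b) y.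
Proof. intros Hf; apply (cont_RInt_param (fun y x => f x y)). cont. Qed.

Lemma exists_le_mean (f : R -> R) s M :
  0 < s -> (forall x, continuous f x) -> RInt f 0 s <= M ->
  exists t, 0 <= t <= s /\ f t <= M / s.
Proof.
  intros Hs Hc HM; apply NNPP; intros Hn.
  assert (H : RInt (fun _ => M / s) 0 s < RInt f 0 s).
  { apply RInt_lt; auto.
    - intros; cont.
    - intros x Hx; apply Rnot_le_lt; intros H; apply Hn; exists x; split; lra. }
  rewrite (RInt_const (V := R_CompleteNormedModule)) in H.
  unfold scal in H; simpl in H; unfold mult in H; simpl in H.
  replace ((s - 0) * (M / s)) with M in H by (field; lra). lra.
Qed.

(** The lines x = m + k (y - y1) + t, for t in [0, s], sweep out a sheared strip inside the
    rectangle. Shearing preserves area, so the mean over t of the line integrals is at most M / s,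
    and some line does not exceed the mean. *)
Lemma good_line f a1 a2 b1 b2 m k y1 y2 s M :
  cont2 f -> (forall x y, 0 <= f x y) -> iint f a1 a2 b1 b2 <= M -> 0 < s ->
  b1 <= y1 -> y1 <= y2 -> y2 <= b2 ->
  (forall y, y1 <= y <= y2 -> a1 <= m + k * (y - y1) /\ m + k * (y - y1) + s <= a2) ->
  exists t, 0 <= t <= s /\ RInt (fun y => f (m + k * (y - y1) + t) y) y1 y2 <= M / s.
Proof.
  intros Hf Hp HM Hs H1 H12 H2 Hx.
  assert (Hg : cont2 (fun t y => f (m + k * (y - y1) + t) y)) by cont.
  apply (exists_le_mean (fun t => RInt (fun y => f (m + k * (y - y1) + t) y) y1 y2)); auto.
  - apply (cont_RInt_param (fun t y => f (m + k * (y - y1) + t) y)); assumption.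
  - rewrite <- (fubini_rect (fun t y => f (m + k * (y - y1) + t) y)) by (auto; lra).
    assert (Hpos : forall y, 0 <= RInt (fun x => f x y) a1 a2 \/ a2 < a1).
    { intros y; destruct (Rle_dec a1 a2) as [Ha|Ha]; [ left | right; lra ].
      apply RInt_ge_0; auto; exint. }
    assert (Ha : a1 <= a2) by (specialize (Hx y1 (conj (Rle_refl _) H12)); lra).
    apply Rle_trans with (RInt (fun y => RInt (fun x => f x y) a1 a2) y1 y2).
    + apply RInt_le; auto.
      * apply ex_RInt_cont; intros.
        apply (cont_RInt_inner (fun t y => f (m + k * (y - y1) + t) y)); assumption.
      * apply ex_RInt_cont; intros; apply cont_RInt_inner; assumption.
      * intros y Hy.
        rewrite (RInt_ext _ (fun t => scal 1 (f (1 * t + (m + k * (y - y1))) y))).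
        2: { intros t _; unfold scal; simpl; unfold mult; simpl.
             rewrite Rmult_1_l; f_equal; ring. }
        rewrite (RInt_comp_lin (V := R_CompleteNormedModule) (fun x => f x y)) by exint.
        specialize (Hx y ltac:(lra)).
        apply RInt_nonneg_mono; try lra; auto. intros; cont.
    + apply Rle_trans with (2 := HM).
      apply RInt_nonneg_mono; try lra.
      * apply cont_RInt_inner; assumption.
      * intros y _; destruct (Hpos y); lra.
Qed.

Lemma RInt_const_R a b c : RInt (fun _ => c) a b = (b - a) * c.
Proof. rewrite (RInt_const (V := R_CompleteNormedModule)). reflexivity. Qed.

Lemma RInt_plus_R f g a b : (forall x, continuous f x) -> (forall x, continuous g x) ->
  RInt (fun x => f x + g x) a b = RInt f a b + RInt g a b.
Proof. intros; apply (RInt_plus (V := R_CompleteNormedModule)); exint. Qed.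

Lemma RInt_scal_R f c a b : (forall x, continuous f x) ->
  RInt (fun x => c * f x) a b = c * RInt f a b.
Proof. intros; apply (RInt_scal (V := R_CompleteNormedModule)); exint. Qed.

Lemma RInt_opp_R f a b : (forall x, continuous f x) ->
  RInt (fun x => - f x) a b = - RInt f a b.
Proof. intros; apply (RInt_opp (V := R_CompleteNormedModule)); exint. Qed.

Lemma RInt_le_cont f g a b : a <= b -> (forall x, continuous f x) -> (forall x, continuous g x) ->
  (forall x, a <= x <= b -> f x <= g x) -> RInt f a b <= RInt g a b.
Proof. intros; apply RInt_le; auto; try exint; intros; auto with real. apply H2; lra. Qed.

Lemma RInt_is_derive (f f' : R -> R) a b :
  (forall x, is_derive f x (f' x)) -> (forall x, continuous f' x) -> RInt f' a b = f b - f a.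
Proof.
  intros Hd Hc. apply is_RInt_unique.
  apply (is_RInt_derive (V := R_CompleteNormedModule)); intros; auto.
Qed.

(* Young's inequality [|g'| <= (l g'^2 + 1/l) / 2] with [l = (b - a) / eta]. *)
Lemma oscillation_bound (g g' : R -> R) a b eta p q :
  (forall t, is_derive g t (g' t)) -> (forall t, continuous g' t) ->
  a < b -> 0 < eta -> (b - a) * RInt (fun t => g' t ^ 2) a b <= eta ^ 2 ->
  a <= p <= b -> a <= q <= b -> Rabs (g q - g p) <= eta.
Proof.
  intros Hd Hc Hab He HI.
  assert (W : forall p q, a <= p -> p <= q -> q <= b -> Rabs (g q - g p) <= eta).
  { clear p q; intros p q Hp Hpq Hq.
    set (l := (b - a) / eta).
    assert (Hl : 0 < l) by (apply Rdiv_lt_0_compat; lra).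
    assert (Hil : 0 < / l) by (apply Rinv_0_lt_compat; lra).
    assert (Y : forall z, z <= l / 2 * z ^ 2 + / l / 2 /\ - z <= l / 2 * z ^ 2 + / l / 2).
    { intros z.
      assert (0 <= l / 2 * (z - / l) ^ 2) by (apply Rmult_le_pos; [ lra | apply pow2_ge_0 ]).
      assert (0 <= l / 2 * (z + / l) ^ 2) by (apply Rmult_le_pos; [ lra | apply pow2_ge_0 ]).
      replace (l / 2 * (z - / l) ^ 2) with (l / 2 * z ^ 2 + / l / 2 - z) in * by (field; lra).
      replace (l / 2 * (z + / l) ^ 2) with (l / 2 * z ^ 2 + / l / 2 + z) in * by (field; lra).
      lra. }
    assert (B : RInt (fun t => l / 2 * g' t ^ 2 + / l / 2) p q <= eta).
    { apply Rle_trans with (RInt (fun t => l / 2 * g' t ^ 2 + / l / 2) a b).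
      - apply RInt_nonneg_mono; try lra.
        + intros; cont.
        + intros; specialize (Y (g' x)); lra.
      - rewrite (RInt_plus_R (fun t => l / 2 * g' t ^ 2) (fun _ => / l / 2)) by (intros; cont).
        rewrite (RInt_scal_R (fun t => g' t ^ 2)) by (intros; cont).
        rewrite RInt_const_R.
        set (I := RInt (fun t => g' t ^ 2) a b) in *.
        change (l / 2 * I + (b - a) * (/ l / 2) <= eta).
        replace (l / 2 * I) with ((b - a) * I / (2 * eta)) by (unfold l; field; lra).
        replace ((b - a) * (/ l / 2)) with (eta / 2) by (unfold l; field; lra).
        apply Rle_trans with (eta ^ 2 / (2 * eta) + eta / 2).
        + apply Rplus_le_compat_r; unfold Rdiv.
          apply (Rmult_le_compat_r (/ (2 * eta)) ((b - a) * I)); auto.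
          left; apply Rinv_0_lt_compat; lra.
        + apply Req_le; field; lra. }
    rewrite <- (RInt_is_derive g g') by auto.
    apply Rabs_le; split.
    - assert (RInt (fun t => - g' t) p q <= RInt (fun t => l / 2 * g' t ^ 2 + / l / 2) p q).
      { apply RInt_le_cont; auto; intros; try (cont). apply Y. }
      rewrite (RInt_opp_R g') in H by auto. lra.
    - apply Rle_trans with (2 := B).
      apply RInt_le_cont; auto; intros; try (cont). apply Y. }
  intros Hp Hq; destruct (Rle_dec p q).
  - apply W; lra.
  - rewrite Rabs_minus_sym; apply W; lra.
Qed.

(** The last term is the scalar product of grad (atan (w - c)) with grad w, the quantity that the
    divergence identity in [log_energy_bound] controls. *)
Definition energy_density (u w : R -> R -> R) (c x y : R) : R :=
  D1 u x y ^ 2 + D2 u x y ^ 2 + (D1 w x y ^ 2 + D2 w x y ^ 2) / (1 + (w x y - c) ^ 2).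

Lemma one_plus_sq_pos t : 0 < 1 + t ^ 2.
Proof. pose proof (pow2_ge_0 t); lra. Qed.

Lemma cont2_energy_density u w c : Ck 1 u -> Ck 1 w -> cont2 (energy_density u w c).
Proof.
  intros (Hu & _ & _ & [Hu1 _] & [Hu2 _]) (Hw & _ & _ & [Hw1 _] & [Hw2 _]).
  unfold energy_density. cont. apply Rgt_not_eq, one_plus_sq_pos.
Qed.

Lemma energy_density_nonneg u w c x y : 0 <= energy_density u w c x y.
Proof.
  unfold energy_density. repeat apply Rplus_le_le_0_compat; try apply pow2_ge_0.
  apply Rdiv_le_0_compat; [| apply one_plus_sq_pos ].
  apply Rplus_le_le_0_compat; apply pow2_ge_0.
Qed.

Lemma atan_ge_half x : 0 <= x <= 1 -> x / 2 <= atan x.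
Proof.
  intros [[Hx | <-] H1].
  2: { rewrite atan_0; lra. }
  destruct (MVT_gen atan 0 x (fun t => / (1 + t ^ 2))) as (z & Hz & E).
  - intros; apply is_derive_Reals. rewrite <- Rsqr_pow2.
    apply is_derive_Reals, is_derive_atan.
  - intros; apply continuity_pt_filterlim, continuous_atan.
  - rewrite atan_0, Rmin_left, Rmax_right in * by lra.
    rewrite !Rminus_0_r in E; rewrite E.
    unfold Rdiv; rewrite (Rmult_comm x); apply Rmult_le_compat_r; [ lra |].
    apply Rinv_le_contravar; nra.
Qed.

Lemma atan_small t eta : 0 < eta <= / 2 -> Rabs (atan t) <= eta -> Rabs t <= 2 * eta.
Proof.
  intros He.
  assert (W : forall t, atan t <= eta -> t <= 2 * eta).
  { intros s Hs; apply Rnot_lt_le; intros H; apply atan_increasing in H.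
    pose proof (atan_ge_half (2 * eta)); lra. }
  intros H; apply Rabs_le_between in H.
  apply Rabs_le; split.
  - assert (- t <= 2 * eta) by (apply W; rewrite atan_opp; lra). lra.
  - apply W; lra.
Qed.

(** For w, the oscillation bound is applied to atan (w - w0), where w0 is the value of w at y0. The
    6 is a product: Cauchy-Schwarz along a line of slope at most 1 costs a factor 2, and recentring
    the weight from c to w0 costs a factor 3 because |w0 - c| <= 1. Passing from atan back to w
    doubles eta. *)
Lemma line_propagation u w c m k y1 t y2 J eta y0 :
  Ck 1 u -> Ck 1 w -> Rabs k <= 1 -> y1 < y2 -> 0 < eta <= / 2 ->
  RInt (fun y => energy_density u w c (m + k * (y - y1) + t) y) y1 y2 <= J ->
  6 * J * (y2 - y1) <= eta ^ 2 ->
  y1 <= y0 <= y2 -> Rabs (w (m + k * (y0 - y1) + t) y0 - c) <= 1 ->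
  forall y, y1 <= y <= y2 ->
    Rabs (u (m + k * (y - y1) + t) y - u (m + k * (y0 - y1) + t) y0) <= eta /\
    Rabs (w (m + k * (y - y1) + t) y - w (m + k * (y0 - y1) + t) y0) <= 2 * eta.
Proof.
  intros Hu Hw Hk Hy He HJ HE Hy0 Hc y Hyy.
  set (X := fun y => m + k * (y - y1) + t) in *.
  assert (HX : forall y, is_derive X y k) by (intros; unfold X; auto_derive; auto; ring).
  assert (CX : forall y, continuous X y).
  { intros z; apply (ex_derive_continuous (V := R_NormedModule)); eexists; apply HX. }
  assert (Hid : forall y : R, is_derive (fun y => y) y 1)
    by (intros; apply (is_derive_id (K := R_AbsRing))).
  destruct Hu as (Hu0 & Hu'). assert (Hu : Ck 1 u) by (split; auto).
  destruct Hu' as (_ & _ & [Hu1 _] & [Hu2 _]).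
  destruct Hw as (Hw0 & Hw'). assert (Hw : Ck 1 w) by (split; auto).
  destruct Hw' as (_ & _ & [Hw1 _] & [Hw2 _]).
  pose proof (cont2_energy_density u w c Hu Hw) as Hed.
  assert (Hk2 : k ^ 2 <= 1).
  { rewrite <- (pow2_abs k). pose proof (Rabs_pos k). nra. }
  assert (CS : forall a b, (a * k + b * 1) ^ 2 <= 2 * (a ^ 2 + b ^ 2)).
  { intros a b. pose proof (pow2_ge_0 (a - b * k)). pose proof (pow2_ge_0 a); pose proof (pow2_ge_0 b). nra. }
  assert (HE6 : (y2 - y1) * RInt (fun y => 6 * energy_density u w c (X y) y) y1 y2 <= eta ^ 2).
  { rewrite (RInt_scal_R (fun y => energy_density u w c (X y) y)) by (intros; cont; auto).
    apply Rle_trans with (2 := HE).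
    replace (6 * J * (y2 - y1)) with ((y2 - y1) * (6 * J)) by ring.
    apply Rmult_le_compat_l; [ lra |]. apply Rmult_le_compat_l; [ lra |]. exact HJ. }
  split.
  - apply (oscillation_bound (fun y => u (X y) y) (fun y => D1 u (X y) y * k + D2 u (X y) y * 1) y1 y2);
      try lra; auto.
    + intros z. apply is_derive_comp2; auto.
    + intros z; cont.
    + apply Rle_trans with (2 := HE6). apply Rmult_le_compat_l; [ lra |].
      apply RInt_le_cont; [ lra | intros; cont | intros; cont |].
      intros z _. eapply Rle_trans; [ apply CS |].
      unfold energy_density.
      assert (0 <= (D1 w (X z) z ^ 2 + D2 w (X z) z ^ 2) / (1 + (w (X z) z - c) ^ 2)).
      { apply Rdiv_le_0_compat; [| apply one_plus_sq_pos ].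
        apply Rplus_le_le_0_compat; apply pow2_ge_0. }
      pose proof (pow2_ge_0 (D1 u (X z) z)); pose proof (pow2_ge_0 (D2 u (X z) z)). lra.
  - set (w0 := w (X y0) y0) in *.
    apply atan_small; auto.
    rewrite <- (Rminus_0_r (atan _)). rewrite <- atan_0.
    replace (atan 0) with (atan (w (X y0) y0 - w0)) by (f_equal; unfold w0; ring).
    apply (oscillation_bound (fun y => atan (w (X y) y - w0))
             (fun y => (D1 w (X y) y * k + D2 w (X y) y * 1) * / (1 + (w (X y) y - w0) ^ 2)) y1 y2);
      try lra; auto.
    + intros z.
      replace (/ (1 + (w (X z) z - w0) ^ 2)) with (/ (1 + (w (X z) z - w0)²))
        by (rewrite Rsqr_pow2; reflexivity).
      apply (is_derive_comp atan (fun y => w (X y) y - w0)); [ apply is_derive_atan |].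
      rewrite <- (Rminus_0_r (_ + _)).
      apply (is_derive_minus (V := R_NormedModule) (fun y => w (X y) y) (fun _ => w0)).
      * apply is_derive_comp2; auto.
      * apply (is_derive_const (V := R_NormedModule)).
    + intros z; cont. apply Rgt_not_eq, one_plus_sq_pos.
    + apply Rle_trans with (2 := HE6). apply Rmult_le_compat_l; [ lra |].
      apply RInt_le_cont; [ lra | intros; cont; apply Rgt_not_eq, one_plus_sq_pos | intros; cont |].
      intros z _. unfold energy_density.
      set (d1 := D1 w (X z) z); set (d2 := D2 w (X z) z); set (wz := w (X z) z).
      specialize (CS d1 d2).
      pose proof (one_plus_sq_pos (wz - w0)) as P0. pose proof (one_plus_sq_pos (wz - c)) as Pc.
      assert (A : 1 + (wz - c) ^ 2 <= 3 * (1 + (wz - w0) ^ 2)).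
      { assert ((w0 - c) ^ 2 <= 1).
        { rewrite <- (pow2_abs (w0 - c)). pose proof (Rabs_pos (w0 - c)).
          change (Rabs (w0 - c) <= 1) in Hc. nra. }
        pose proof (pow2_ge_0 ((wz - w0) - (w0 - c))). pose proof (pow2_ge_0 (wz - w0)).
        replace ((wz - c) ^ 2) with (2 * (wz - w0) ^ 2 + 2 * (w0 - c) ^ 2 - ((wz - w0) - (w0 - c)) ^ 2) by ring.
        lra. }
      set (G := d1 ^ 2 + d2 ^ 2) in *.
      assert (0 <= G) by (apply Rplus_le_le_0_compat; apply pow2_ge_0).
      apply Rle_trans with (6 * (G / (1 + (wz - c) ^ 2))).
      2: { pose proof (pow2_ge_0 (D1 u (X z) z)); pose proof (pow2_ge_0 (D2 u (X z) z)). lra. }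
      apply Rle_trans with (2 * G / (1 + (wz - w0) ^ 2)).
      * rewrite Rpow_mult_distr. unfold Rdiv. apply Rmult_le_compat; auto; try apply pow2_ge_0.
        rewrite pow_inv. apply Rinv_le_contravar; auto.
        pose proof (pow2_ge_0 (wz - w0)); nra.
      * replace (6 * (G / (1 + (wz - c) ^ 2))) with (2 * G * (3 / (1 + (wz - c) ^ 2))) by (field; lra).
        unfold Rdiv at 1. apply Rmult_le_compat_l; [ lra |].
        apply Rmult_le_reg_r with (1 + (wz - w0) ^ 2); auto.
        rewrite Rinv_l by lra.
        apply Rmult_le_reg_r with (1 + (wz - c) ^ 2); auto.
        replace (3 / (1 + (wz - c) ^ 2) * (1 + (wz - w0) ^ 2) * (1 + (wz - c) ^ 2))
          with (3 * (1 + (wz - w0) ^ 2)) by (field; lra).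
        lra.
Qed.

(** * Short paths for conformal metrics of small energy *)

(* [reach x y x' y' l]: the points (x, y) and (x', y') of the rectangle are
   joined by a path whose length for the metric e^(2v) (dx^2 + dy^2) is at most l. *)
Record conformal_reach (a1 a2 b1 b2 : R) (v : R -> R -> R)
    (reach : R -> R -> R -> R -> R -> Prop) : Prop := {
  reach_refl x y : reach x y x y 0;
  reach_sym x y x' y' l : reach x y x' y' l -> reach x' y' x y l;
  reach_trans x y x' y' x'' y'' l l' :
    reach x y x' y' l -> reach x' y' x'' y'' l' -> reach x y x'' y'' (l + l');
  reach_mono x y x' y' l l' : l <= l' -> reach x y x' y' l -> reach x y x' y' l';
  reach_segment x y x' y' B :
    a1 <= x <= a2 -> b1 <= y <= b2 -> a1 <= x' <= a2 -> b1 <= y' <= b2 ->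
    (forall t, 0 <= t <= 1 -> v ((1 - t) * x + t * x') ((1 - t) * y + t * y') <= B) ->
    reach x y x' y' (exp B * sqrt ((x' - x) ^ 2 + (y' - y) ^ 2))
}.

Lemma conformal_reach_swap a1 a2 b1 b2 v reach :
  conformal_reach a1 a2 b1 b2 v reach ->
  conformal_reach b1 b2 a1 a2 (fun x y => v y x) (fun x y x' y' l => reach y x y' x' l).
Proof.
  intros [H1 H2 H3 H4 H5]; constructor; intros; eauto.
  rewrite Rplus_comm; apply H5; auto.
Qed.

Lemma convex_between a b t : 0 <= t <= 1 -> Rmin a b <= (1 - t) * a + t * b <= Rmax a b.
Proof.
  intros Ht; pose proof (Rmin_l a b); pose proof (Rmin_r a b).
  pose proof (Rmax_l a b); pose proof (Rmax_r a b). nra.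
Qed.

Lemma exp_monotone x y : x <= y -> exp x <= exp y.
Proof. intros [H | ->]; [ left; apply exp_increasing; auto | apply Rle_refl ]. Qed.

Lemma exp_bound_inv x : x < 1 -> exp x <= / (1 - x).
Proof.
  intros Hx. rewrite <- (Ropp_involutive x) at 1. rewrite exp_Ropp.
  apply Rinv_le_contravar; [ lra |]. pose proof (exp_ineq1_le (- x)); lra.
Qed.

Lemma reach_horizontal a1 a2 b1 b2 v reach x x' y B :
  conformal_reach a1 a2 b1 b2 v reach ->
  a1 <= x <= a2 -> a1 <= x' <= a2 -> b1 <= y <= b2 ->
  (forall z, Rmin x x' <= z <= Rmax x x' -> v z y <= B) ->
  reach x y x' y (exp B * Rabs (x' - x)).
Proof.
  intros HR Hx Hx' Hy HB.
  replace (Rabs (x' - x)) with (sqrt ((x' - x) ^ 2 + (y - y) ^ 2)).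
  - apply (reach_segment _ _ _ _ _ _ HR); auto.
    intros t Ht. replace ((1 - t) * y + t * y) with y by ring. apply HB, convex_between, Ht.
  - rewrite <- sqrt_Rsqr_abs. f_equal. unfold Rsqr; ring.
Qed.

Lemma reach_vertical a1 a2 b1 b2 v reach x y y' B :
  conformal_reach a1 a2 b1 b2 v reach ->
  a1 <= x <= a2 -> b1 <= y <= b2 -> b1 <= y' <= b2 ->
  (forall z, Rmin y y' <= z <= Rmax y y' -> v x z <= B) ->
  reach x y x y' (exp B * Rabs (y' - y)).
Proof.
  intros HR. apply conformal_reach_swap in HR.
  intros Hx Hy Hy' HB. apply (reach_horizontal _ _ _ _ _ _ y y' x B HR); auto.
Qed.

Lemma Rmin_Rmax_in a b c d z : c <= a <= d -> c <= b <= d -> Rmin a b <= z <= Rmax a b -> c <= z <= d.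
Proof. unfold Rmin, Rmax; destruct (Rle_dec a b); lra. Qed.

Lemma energy_density_swap u w c x y :
  energy_density (fun x y => u y x) (fun x y => w y x) c x y = energy_density u w c y x.
Proof. unfold energy_density, D1, D2; f_equal; [| f_equal ]; apply Rplus_comm. Qed.

(** The bound is uniform in c because c will be a value of w at a point that is found only later and
    depends on the metric. *)
Definition small_energy u w a1 a2 b1 b2 E : Prop :=
  forall c, iint (energy_density u w c) a1 a2 b1 b2 <= E.

Lemma small_energy_swap u w a1 a2 b1 b2 E :
  Ck 1 u -> Ck 1 w -> a1 <= a2 -> small_energy u w a1 a2 b1 b2 E ->
  small_energy (fun x y => u y x) (fun x y => w y x) b1 b2 a1 a2 E.
Proof.
  intros Hu Hw Ha H c.
  replace (energy_density (fun x y => u y x) (fun x y => w y x) c)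
    with (fun x y => energy_density u w c y x)
    by (extensionality x; extensionality y; symmetry; apply energy_density_swap).
  rewrite iint_swap; auto. apply cont2_energy_density; auto.
Qed.

(** The line depends on c but not on the anchor y0, which is quantified afterwards. So a line can be
    selected first and then anchored where it crosses a line already under control. *)
Lemma good_slanted_line u w a1 a2 b1 b2 E c m k y1 y2 s eta :
  Ck 1 u -> Ck 1 w -> small_energy u w a1 a2 b1 b2 E ->
  Rabs k <= 1 -> 0 < s -> b1 <= y1 -> y1 < y2 -> y2 <= b2 ->
  (forall y, y1 <= y <= y2 -> a1 <= m + k * (y - y1) /\ m + k * (y - y1) + s <= a2) ->
  0 < eta <= / 2 -> 6 * E * (y2 - y1) <= eta ^ 2 * s ->
  exists t, 0 <= t <= s /\
    forall y0, y1 <= y0 <= y2 -> Rabs (w (m + k * (y0 - y1) + t) y0 - c) <= 1 ->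
    forall y, y1 <= y <= y2 ->
      Rabs (u (m + k * (y - y1) + t) y - u (m + k * (y0 - y1) + t) y0) <= eta /\
      Rabs (w (m + k * (y - y1) + t) y - w (m + k * (y0 - y1) + t) y0) <= 2 * eta.
Proof.
  intros Hu Hw HE Hk Hs H1 H12 H2 Hx He HEs.
  destruct (good_line (energy_density u w c) a1 a2 b1 b2 m k y1 y2 s E) as (t & Ht & HI);
    auto using cont2_energy_density, energy_density_nonneg, Rlt_le.
  exists t; split; auto; intros y0 Hy0 Hc y Hy.
  apply (line_propagation u w c m k y1 t y2 (E / s)); auto.
  apply Rmult_le_reg_r with s; auto.
  replace (6 * (E / s) * (y2 - y1) * s) with (6 * E * (y2 - y1)) by (field; lra). exact HEs.
Qed.

Lemma good_vertical_line u w a1 a2 b1 b2 E c x1 y1 y2 s eta :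
  Ck 1 u -> Ck 1 w -> small_energy u w a1 a2 b1 b2 E ->
  0 < s -> a1 <= x1 -> x1 + s <= a2 -> b1 <= y1 -> y1 < y2 -> y2 <= b2 ->
  0 < eta <= / 2 -> 6 * E * (y2 - y1) <= eta ^ 2 * s ->
  exists x, x1 <= x <= x1 + s /\
    forall y0, y1 <= y0 <= y2 -> Rabs (w x y0 - c) <= 1 ->
    forall y, y1 <= y <= y2 ->
      Rabs (u x y - u x y0) <= eta /\ Rabs (w x y - w x y0) <= 2 * eta.
Proof.
  intros Hu Hw HE Hs Ha1 Ha2 H1 H12 H2 He HEs.
  destruct (good_slanted_line u w a1 a2 b1 b2 E c x1 0 y1 y2 s eta) as (t & Ht & H); auto.
  - rewrite Rabs_R0; lra.
  - intros; lra.
  - exists (x1 + t); split; [ lra |]. intros y0 Hy0 Hc y Hy.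
    specialize (H y0 Hy0).
    assert (X : forall z, x1 + 0 * (z - y1) + t = x1 + t) by (intros; ring).
    rewrite X in H. specialize (H Hc y Hy). rewrite X in H. exact H.
Qed.

Lemma good_horizontal_line u w a1 a2 b1 b2 E c y1 x1 x2 s eta :
  Ck 1 u -> Ck 1 w -> small_energy u w a1 a2 b1 b2 E ->
  0 < s -> b1 <= y1 -> y1 + s <= b2 -> a1 <= x1 -> x1 < x2 -> x2 <= a2 ->
  0 < eta <= / 2 -> 6 * E * (x2 - x1) <= eta ^ 2 * s ->
  exists y, y1 <= y <= y1 + s /\
    forall x0, x1 <= x0 <= x2 -> Rabs (w x0 y - c) <= 1 ->
    forall x, x1 <= x <= x2 ->
      Rabs (u x y - u x0 y) <= eta /\ Rabs (w x y - w x0 y) <= 2 * eta.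
Proof.
  intros Hu Hw HE Hs Hb1 Hb2 H1 H12 H2 He HEs.
  apply (good_vertical_line (fun x y => u y x) (fun x y => w y x) b1 b2 a1 a2 E);
    auto using Ck_swap.
  apply small_energy_swap; auto; lra.
Qed.

(* Alternating good horizontal and vertical lines at scales r, r/2, r/4, ...
   The value of u + w drifts by at most 6 eta per scale, so that the lengths
   decay geometrically. *)
Lemma dyadic_chain u w a1 a2 b1 b2 E eta p q reach :
  Ck 1 u -> Ck 1 w -> small_energy u w a1 a2 b1 b2 E ->
  conformal_reach a1 a2 b1 b2 (fun x y => u x y + w x y) reach ->
  0 < eta <= / 24 -> 24 * E <= eta ^ 2 -> a1 <= p -> b1 <= q ->
  forall (N : nat) r y U W x0,
  0 < r -> p + 2 * r <= a2 -> q + r <= b2 -> q + r / 2 <= y <= q + r ->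
  (forall x, p <= x <= p + 2 * r -> Rabs (u x y - U) <= eta /\ Rabs (w x y - W) <= 2 * eta) ->
  p <= x0 <= p + 2 * r ->
  exists x' y', p <= x' <= p + 2 * r / 2 ^ N /\ q <= y' <= q + r / 2 ^ N /\
    reach x0 y x' y' (16 * r * exp (U + W)).
Proof.
  intros Hu Hw HE HR He HEe Hp Hq N.
  induction N as [|N IH]; intros r y U W x0 Hr Ha2 Hb2 Hy HH Hx0.
  - exists x0, y; simpl. split; [ lra |]; split; [ lra |].
    apply (reach_mono _ _ _ _ _ _ HR) with 0; [| apply (reach_refl _ _ _ _ _ _ HR) ].
    pose proof (exp_pos (U + W)); nra.
  - destruct (good_vertical_line u w a1 a2 b1 b2 E W (p + r / 2) q (q + r) (r / 2) eta)
      as (x1 & Hx1 & V); auto; try lra; [ nra |].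
    specialize (V y ltac:(lra)).
    destruct (HH x1 ltac:(lra)) as [Hu1 Hw1].
    specialize (V ltac:(lra)).
    (* This strip has length r and width r / 4, the least favourable proportion used here: 6 E r <=
       eta^2 r / 4 is the hypothesis 24 E <= eta^2. It places y1 between q + r / 4 and q + r / 2, as
       the induction hypothesis at scale r / 2 requires. *)
    destruct (good_horizontal_line u w a1 a2 b1 b2 E (w x1 y) (q + r / 4) p (p + r) (r / 4) eta)
      as (y1 & Hy1 & H); auto; try lra; [ nra |].
    destruct (V y1 ltac:(lra)) as [Hu2 Hw2].
    specialize (H x1 ltac:(lra) ltac:(lra)).
    destruct (IH (r / 2) y1 (u x1 y1) (w x1 y1) x1) as (x' & y' & Hx' & Hy' & L); try lra.
    { intros x Hx; apply H; lra. }
    exists x', y'.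
    split; [ simpl; unfold Rdiv in *; rewrite Rinv_mult; lra |].
    split; [ simpl; unfold Rdiv in *; rewrite Rinv_mult; lra |].
    assert (L1 : reach x0 y x1 y (exp (U + W + 3 * eta) * Rabs (x1 - x0))).
    { apply (reach_horizontal _ _ _ _ _ _ _ _ _ _ HR); try lra.
      intros z Hz; destruct (HH z) as [A B].
      - apply (Rmin_Rmax_in x0 x1); auto; lra.
      - apply Rabs_le_between in A; apply Rabs_le_between in B; lra. }
    assert (L2 : reach x1 y x1 y1 (exp (U + W + 6 * eta) * Rabs (y1 - y))).
    { apply (reach_vertical _ _ _ _ _ _ _ _ _ _ HR); try lra.
      intros z Hz; destruct (V z) as [A B].
      - apply (Rmin_Rmax_in y y1); auto; lra.
      - apply Rabs_le_between in A; apply Rabs_le_between in B.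
        apply Rabs_le_between in Hu1; apply Rabs_le_between in Hw1. lra. }
    eapply (reach_mono _ _ _ _ _ _ HR);
      [| eapply (reach_trans _ _ _ _ _ _ HR); [ exact L1 | eapply (reach_trans _ _ _ _ _ _ HR); [ exact L2 | exact L ] ] ].
    (* Since 6 eta <= 1/4, one scale multiplies the conformal factor by at most 4/3. In units of r
       exp (U + W), the two new legs cost at most (4/3) (2 + 1) = 4 and the remaining scales (16 /
       2) (4/3) = 32/3; the sum stays below 16, which closes the induction. *)
    assert (E6 : exp (6 * eta) <= 4 / 3).
    { eapply Rle_trans; [ apply exp_bound_inv; lra |].
      replace (4 / 3) with (/ (3 / 4)) by field. apply Rinv_le_contravar; lra. }
    assert (A1 : exp (U + W + 3 * eta) <= exp (U + W) * (4 / 3)).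
    { apply Rle_trans with (exp (U + W + 6 * eta)); [ apply exp_monotone; lra |].
      rewrite exp_plus. apply Rmult_le_compat_l; auto. apply Rlt_le, exp_pos. }
    assert (A2 : exp (U + W + 6 * eta) <= exp (U + W) * (4 / 3)).
    { rewrite exp_plus. apply Rmult_le_compat_l; auto. apply Rlt_le, exp_pos. }
    assert (A3 : exp (u x1 y1 + w x1 y1) <= exp (U + W + 6 * eta)).
    { apply exp_monotone. apply Rabs_le_between in Hu1; apply Rabs_le_between in Hw1.
      apply Rabs_le_between in Hu2; apply Rabs_le_between in Hw2. lra. }
    assert (D1' : Rabs (x1 - x0) <= 2 * r) by (apply Rabs_le; lra).
    assert (D2' : Rabs (y1 - y) <= r) by (apply Rabs_le; lra).
    pose proof (Rabs_pos (x1 - x0)); pose proof (Rabs_pos (y1 - y)).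
    pose proof (exp_pos (U + W)); pose proof (exp_pos (U + W + 3 * eta)).
    pose proof (exp_pos (U + W + 6 * eta)).
    set (e := exp (U + W)) in *.
    assert (exp (U + W + 3 * eta) * Rabs (x1 - x0) <= e * (4 / 3) * (2 * r))
      by (apply Rmult_le_compat; lra).
    assert (exp (U + W + 6 * eta) * Rabs (y1 - y) <= e * (4 / 3) * r)
      by (apply Rmult_le_compat; lra).
    assert (r * exp (u x1 y1 + w x1 y1) <= r * (e * (4 / 3)))
      by (apply Rmult_le_compat_l; lra).
    assert (0 < e * r) by (apply Rmult_lt_0_compat; lra).
    lra.
Qed.

Lemma cont2_eps_delta f x y eps : cont2 f -> 0 < eps ->
  exists d, 0 < d /\ forall x' y', Rabs (x' - x) < d -> Rabs (y' - y) < d ->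
    Rabs (f x' y' - f x y) < eps.
Proof.
  intros Hf He.
  destruct (cont2_continuity_2d f x y Hf (mkposreal eps He)) as [d Hd].
  exists d; split; [ apply cond_pos | intros; apply Hd; auto ].
Qed.

Lemma exists_half_pow_small c d : 0 < d -> exists N : nat, c / 2 ^ N < d.
Proof.
  intros Hd.
  destruct (Rle_or_lt c 0) as [Hc|Hc].
  - exists 0%nat; simpl; lra.
  - destruct (pow_lt_1_zero (/ 2)) with (y := d / c) as [N HN].
    + rewrite Rabs_pos_eq; lra.
    + apply Rdiv_lt_0_compat; auto.
    + exists N. specialize (HN N (le_n N)).
      rewrite Rabs_pos_eq in HN by (apply pow_le; lra).
      rewrite pow_inv in HN. apply Rmult_lt_reg_r with (/ c).
      * apply Rinv_0_lt_compat; auto.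
      * unfold Rdiv in *. replace (c * / 2 ^ N * / c) with (/ 2 ^ N); auto.
        field. split; [ lra | apply pow_nonzero; lra ].
Qed.

(** The dyadic chain only comes arbitrarily close to the corner (p, q). Continuity of u + w there
    bounds the last small segment. The number N of scales depends on the metric, but neither E nor
    the final length depends on N. *)
Lemma reach_corner u w a1 a2 b1 b2 E eta p q reach r y U W :
  Ck 1 u -> Ck 1 w -> small_energy u w a1 a2 b1 b2 E ->
  conformal_reach a1 a2 b1 b2 (fun x y => u x y + w x y) reach ->
  0 < eta <= / 24 -> 24 * E <= eta ^ 2 -> a1 <= p -> b1 <= q ->
  0 < r -> p + 2 * r <= a2 -> q + r <= b2 -> q + r / 2 <= y <= q + r ->
  (forall x, p <= x <= p + 2 * r -> Rabs (u x y - U) <= eta /\ Rabs (w x y - W) <= 2 * eta) ->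
  reach p y p q (17 * r * exp (U + W)).
Proof.
  intros Hu Hw HE HR He HEe Hp Hq Hr Ha2 Hb2 Hy HH.
  assert (Hv : cont2 (fun x y => u x y + w x y)).
  { apply Ck_cont2 in Hu; apply Ck_cont2 in Hw; cont. }
  destruct (cont2_eps_delta _ p q 1 Hv Rlt_0_1) as (d & Hd & HN).
  set (v0 := u p q + w p q) in *.
  set (e := exp (v0 + 1)). assert (0 < e) by apply exp_pos.
  assert (He2 : 0 < r * exp (U + W) / (3 * e)).
  { apply Rdiv_lt_0_compat; [| lra ]. apply Rmult_lt_0_compat; auto. apply exp_pos. }
  (* The last segment has length at most 3 h with h = r / 2^N, and conformal factor at most e near
     the corner. The second entry of the minimum makes its cost at most r exp (U + W), which turns
     16 into 17. *)
  destruct (exists_half_pow_small (2 * r) (Rmin d (r * exp (U + W) / (3 * e)))) as [N H2N].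
  { apply Rmin_pos; auto. }
  pose proof (Rmin_l d (r * exp (U + W) / (3 * e))).
  pose proof (Rmin_r d (r * exp (U + W) / (3 * e))).
  destruct (dyadic_chain u w a1 a2 b1 b2 E eta p q reach Hu Hw HE HR He HEe Hp Hq N r y U W p)
    as (x' & y' & Hx' & Hy' & L); auto; try lra.
  set (h := r / 2 ^ N) in *.
  assert (Eh : 2 * r / 2 ^ N = 2 * h) by (unfold h, Rdiv; ring).
  assert (Hh : 0 < h) by (apply Rdiv_lt_0_compat; auto; apply pow_lt; lra).
  assert (Hhr : h <= r).
  { unfold h. apply Rmult_le_reg_r with (2 ^ N); [ apply pow_lt; lra |].
    unfold Rdiv; rewrite Rmult_assoc, Rinv_l by (apply pow_nonzero; lra).
    pose proof (pow_R1_Rle 2 N). nra. }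
  rewrite Eh in *.
  apply (reach_mono _ _ _ _ _ _ HR) with (16 * r * exp (U + W) + e * sqrt ((p - x') ^ 2 + (q - y') ^ 2)).
  - assert (sqrt ((p - x') ^ 2 + (q - y') ^ 2) <= 3 * h).
    { rewrite <- (sqrt_pow2 (3 * h)) by lra. apply sqrt_le_1_alt. nra. }
    assert (e * sqrt ((p - x') ^ 2 + (q - y') ^ 2) <= e * (3 * (r * exp (U + W) / (3 * e)))).
    { apply Rmult_le_compat_l; lra. }
    replace (e * (3 * (r * exp (U + W) / (3 * e)))) with (r * exp (U + W)) in * by (field; lra).
    lra.
  - apply (reach_trans _ _ _ _ _ _ HR) with x' y'; auto.
    apply (reach_segment _ _ _ _ _ _ HR); try lra.
    intros t Ht.
    pose proof (convex_between x' p t Ht). pose proof (convex_between y' q t Ht).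
    rewrite (Rmin_right x' p), (Rmax_left x' p) in * by lra.
    rewrite (Rmin_right y' q), (Rmax_left y' q) in * by lra.
    assert (A : Rabs (u ((1 - t) * x' + t * p) ((1 - t) * y' + t * q) +
                 w ((1 - t) * x' + t * p) ((1 - t) * y' + t * q) - v0) < 1)
      by (apply HN; apply Rabs_def1; lra).
    apply Rabs_def2 in A. lra.
Qed.

(** Each endpoint is joined to a horizontal line that reaches the edge x = a2, where u and w are
    small. A line parallel to the segment, shifted by at most r, connects the two horizontal lines.
    The two ends cost 20 r each, and the shifted piece is longer than the segment by at most 2 r. *)
Lemma reach_along u w a1 a2 b1 b2 E eta r p q p' q' reach :
  Ck 1 u -> Ck 1 w -> small_energy u w a1 a2 b1 b2 E ->
  conformal_reach a1 a2 b1 b2 (fun x y => u x y + w x y) reach ->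
  0 < eta <= / 24 -> 24 * E <= eta ^ 2 -> 0 < r ->
  108 * E * (a2 - a1) <= eta ^ 2 * r -> 108 * E * (b2 - b1) <= eta ^ 2 * r ->
  (forall y, b1 <= y <= b2 -> Rabs (u a2 y) <= eta / 3 /\ Rabs (w a2 y) <= eta / 3) ->
  a1 + r <= p -> p + 2 * r <= a2 -> b1 <= q -> q + r <= b2 ->
  a1 + r <= p' -> p' + 2 * r <= a2 -> b1 <= q' -> q' + r <= b2 ->
  Rabs (p' - p) <= q' - q ->
  reach p q p' q' (40 * r + exp (6 * eta) * (sqrt ((p' - p) ^ 2 + (q' - q) ^ 2) + 2 * r)).
Proof.
  intros Hu Hw HE HR He HEe Hr HEa HEb Hedge Hp1 Hp2 Hq1 Hq2 Hp1' Hp2' Hq1' Hq2' Hdir.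
  assert (Hqq : q <= q') by (pose proof (Rabs_pos (p' - p)); lra).
  assert (HX : forall y1, b1 <= y1 -> y1 + r <= b2 -> exists y, y1 + r / 2 <= y <= y1 + r /\
    forall x, a1 <= x <= a2 -> Rabs (u x y) <= eta /\ Rabs (w x y) <= eta).
  { intros y1 H1 H2.
    (* An oscillation 2 eta / 3 of w is added to the edge value eta / 3, hence the tolerance eta /
       3. With width r / 2 the requirement reads 108 E (a2 - a1) <= eta^2 r. *)
    destruct (good_horizontal_line u w a1 a2 b1 b2 E 0 (y1 + r / 2) a1 a2 (r / 2) (eta / 3))
      as (y & Hy & H); auto; try lra.
    exists y; split; [ lra |]. intros x Hx.
      destruct (Hedge y ltac:(lra)) as [Eu Ew].
      specialize (H a2 ltac:(lra)). rewrite Rminus_0_r in H.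
      destruct (H ltac:(lra) x Hx) as [Au Aw].
      apply Rabs_le_between in Eu; apply Rabs_le_between in Ew.
      apply Rabs_le_between in Au; apply Rabs_le_between in Aw.
      split; apply Rabs_le; lra. }
  destruct (HX q Hq1 Hq2) as (yh & Hyh & H).
  destruct (HX q' Hq1' Hq2') as (yh' & Hyh' & H').
  clear HX.
  set (k := (p' - p) / (q' - q)).
  assert (Hk : Rabs k <= 1 /\ k * (q' - q) = p' - p).
  { destruct (Req_dec (q' - q) 0) as [Z|Z].
    - assert (p' - p = 0).
      { pose proof (Rabs_pos (p' - p)). destruct (Req_dec (p' - p) 0) as [|Y]; auto.
        apply Rabs_pos_lt in Y; lra. }
      unfold k. rewrite Z, H0. unfold Rdiv; rewrite !Rmult_0_l, Rabs_R0; lra.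
    - split; [| unfold k; field; auto ].
      unfold k, Rdiv. rewrite Rabs_mult, Rabs_inv, (Rabs_pos_eq (q' - q)) by lra.
      apply Rmult_le_reg_r with (q' - q); [ lra |].
      rewrite Rmult_assoc, Rinv_l by auto. lra. }
  destruct Hk as [Hk Ek]. apply Rabs_le_between in Hdir.
  assert (Hk' := Hk). apply Rabs_le_between in Hk'.
  assert (HL : forall y, q <= y <= q' + r ->
     Rmin p p' - r <= p + k * (y - q) <= Rmax p p' + r).
  { intros y Hy.
    assert (A : k * (q' + r - q) = p' - p + k * r) by (rewrite <- Ek; ring).
    assert (A' : - r <= k * r <= r) by nra.
    destruct (Rle_dec 0 k).
    - assert (0 <= k * (y - q)) by (apply Rmult_le_pos; lra).
      assert (k * (y - q) <= k * (q' + r - q)) by (apply Rmult_le_compat_l; lra).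
      unfold Rmin, Rmax; destruct (Rle_dec p p'); lra.
    - assert (k * (y - q) <= 0) by nra.
      assert (k * (q' + r - q) <= k * (y - q)) by (apply Rmult_le_compat_neg_l; lra).
      unfold Rmin, Rmax; destruct (Rle_dec p p'); lra. }
  (* The line is continued up to q' + r so that it crosses both horizontal lines and has positive
     length even if q = q'. It is anchored below at its crossing with the line y = yh. *)
  destruct (good_slanted_line u w a1 a2 b1 b2 E 0 p k q (q' + r) r eta) as (t & Ht & HS); auto; try lra.
  { intros y Hy; specialize (HL y Hy).
    unfold Rmin, Rmax in HL; destruct (Rle_dec p p'); lra. }
  { assert (0 <= E).
    { apply Rle_trans with (2 := HE 0). apply RInt_ge_0; [ lra | |].
      - apply ex_RInt_cont, cont_RInt_inner, cont2_energy_density; auto.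
      - intros; apply RInt_ge_0; [ lra | | intros; apply energy_density_nonneg ].
        pose proof (cont2_energy_density u w 0 Hu Hw). exint. }
    assert (6 * E * (q' + r - q) <= 6 * E * (b2 - b1)) by (apply Rmult_le_compat_l; lra).
    assert (0 <= E * (b2 - b1)) by (apply Rmult_le_pos; lra). lra. }
  set (X := fun y => p + k * (y - q) + t).
  assert (HXa : forall y, q <= y <= q' + r -> a1 <= X y <= a2).
  { intros y Hy; specialize (HL y Hy). unfold X.
    unfold Rmin, Rmax in HL; destruct (Rle_dec p p'); lra. }
  assert (HSv : forall y, q <= y <= q' + r -> u (X y) y + w (X y) y <= 6 * eta).
  { intros y Hy. destruct (H (X yh)) as [A1 A2]; [ apply HXa; lra |].
    specialize (HS yh ltac:(lra)). fold (X yh) in HS. rewrite Rminus_0_r in HS.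
    destruct (HS ltac:(lra) y Hy) as [A3 A4]. fold (X y) in A3, A4.
    apply Rabs_le_between in A1; apply Rabs_le_between in A2.
    apply Rabs_le_between in A3; apply Rabs_le_between in A4. lra. }
  assert (E2 : exp (2 * eta) <= 4 / 3).
  { eapply Rle_trans; [ apply exp_bound_inv; lra |].
    replace (4 / 3) with (/ (3 / 4)) by field. apply Rinv_le_contravar; lra. }
  assert (Hend : forall p q yh, a1 + r <= p -> p + 2 * r <= a2 -> b1 <= q -> q + r <= b2 ->
     q + r / 2 <= yh <= q + r ->
     (forall x, a1 <= x <= a2 -> Rabs (u x yh) <= eta /\ Rabs (w x yh) <= eta) ->
     forall x, p - r <= x <= p + 2 * r -> reach p q x yh (20 * r)).
  { clear - Hu Hw HE HR He HEe Hr E2. intros p q yh H1 H2 H3 H4 H5 H x Hx.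
    (* The corner is reached with U = W = 0, and the horizontal leg costs at most (4/3) 2 r, so that
       17 + 8/3 <= 20. *)
    apply (reach_mono _ _ _ _ _ _ HR) with (17 * r * exp (0 + 0) + exp (2 * eta) * Rabs (x - p)).
    - rewrite Rplus_0_l, exp_0. assert (Rabs (x - p) <= 2 * r) by (apply Rabs_le; lra).
      assert (exp (2 * eta) * Rabs (x - p) <= 4 / 3 * (2 * r)).
      { apply Rmult_le_compat; auto; [ apply Rlt_le, exp_pos | apply Rabs_pos ]. }
      lra.
    - apply (reach_trans _ _ _ _ _ _ HR) with p yh.
      + apply (reach_sym _ _ _ _ _ _ HR).
        apply (reach_corner u w a1 a2 b1 b2 E eta); auto; try lra.
        intros z Hz; rewrite !Rminus_0_r. destruct (H z); lra.
      + apply (reach_horizontal _ _ _ _ _ _ _ _ _ _ HR); try lra.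
        intros z Hz. destruct (H z) as [A B].
        * apply (Rmin_Rmax_in p x); auto; lra.
        * apply Rabs_le_between in A; apply Rabs_le_between in B. lra. }
  assert (B1 : reach p q (X yh) yh (20 * r)).
  { apply Hend; auto. unfold X. nra. }
  assert (B2 : reach p' q' (X yh') yh' (20 * r)).
  { apply Hend; auto. unfold X. replace (k * (yh' - q)) with (p' - p + k * (yh' - q')) by (rewrite <- Ek; ring). nra. }
  assert (B3 : reach (X yh) yh (X yh') yh'
     (exp (6 * eta) * sqrt ((X yh' - X yh) ^ 2 + (yh' - yh) ^ 2))).
  { apply (reach_segment _ _ _ _ _ _ HR); try lra; try (apply HXa; lra).
    intros s Hs.
    replace ((1 - s) * X yh + s * X yh') with (X ((1 - s) * yh + s * yh')) by (unfold X; ring).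
    apply HSv. apply (Rmin_Rmax_in yh yh'); try lra. apply convex_between; auto. }
  apply (reach_sym _ _ _ _ _ _ HR) in B2.
  eapply (reach_mono _ _ _ _ _ _ HR);
    [| eapply (reach_trans _ _ _ _ _ _ HR); [ exact B1 | eapply (reach_trans _ _ _ _ _ _ HR); [ exact B3 | exact B2 ] ] ].
  assert (BL : sqrt ((X yh' - X yh) ^ 2 + (yh' - yh) ^ 2) <= sqrt ((p' - p) ^ 2 + (q' - q) ^ 2) + 2 * r).
  { replace ((X yh' - X yh) ^ 2 + (yh' - yh) ^ 2) with ((1 + k ^ 2) * (yh' - yh) ^ 2) by (unfold X; ring).
    replace ((p' - p) ^ 2 + (q' - q) ^ 2) with ((1 + k ^ 2) * (q' - q) ^ 2) by (rewrite <- Ek; ring).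
    assert (0 <= 1 + k ^ 2) by nra.
    rewrite !sqrt_mult_alt by auto. rewrite (sqrt_pow2 (q' - q)) by lra.
    replace (sqrt ((yh' - yh) ^ 2)) with (Rabs (yh' - yh)) by (rewrite <- sqrt_Rsqr_abs; f_equal; unfold Rsqr; ring).
    assert (sqrt (1 + k ^ 2) <= 2).
    { rewrite <- (sqrt_pow2 2) by lra. apply sqrt_le_1_alt; nra. }
    pose proof (sqrt_pos (1 + k ^ 2)).
    apply Rle_trans with (sqrt (1 + k ^ 2) * (q' - q + r)).
    - apply Rmult_le_compat_l; auto. apply Rabs_le; lra.
    - nra. }
  pose proof (exp_pos (6 * eta)). nra.
Qed.

(** The edge tolerance kappa precedes the size La, so that the rectangle can afterwards be taken
    large enough for the decay to beat kappa; only E depends on La. *)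
Lemma short_path D eps r0 :
  0 <= D -> 0 < eps -> 0 < r0 ->
  exists kappa, 0 < kappa /\ forall La, 0 < La -> exists E, 0 < E /\
  forall a1 a2 b1 b2 u w reach p q p' q',
  a1 <= a2 -> b1 <= b2 -> a2 - a1 <= La -> b2 - b1 <= La ->
  Ck 1 u -> Ck 1 w -> small_energy u w a1 a2 b1 b2 E ->
  conformal_reach a1 a2 b1 b2 (fun x y => u x y + w x y) reach ->
  (forall y, b1 <= y <= b2 -> Rabs (u a2 y) <= kappa /\ Rabs (w a2 y) <= kappa) ->
  (forall x, a1 <= x <= a2 -> Rabs (u x b2) <= kappa /\ Rabs (w x b2) <= kappa) ->
  a1 + r0 <= p -> p + 2 * r0 <= a2 -> b1 + r0 <= q -> q + 2 * r0 <= b2 ->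
  a1 + r0 <= p' -> p' + 2 * r0 <= a2 -> b1 + r0 <= q' -> q' + 2 * r0 <= b2 ->
  sqrt ((p' - p) ^ 2 + (q' - q) ^ 2) <= D ->
  reach p q p' q' (sqrt ((p' - p) ^ 2 + (q' - q) ^ 2) + eps).
Proof.
  intros HD Heps Hr0.
  (* For eta <= 1/24 the factor exp (6 eta) is at most 1 + 8 eta, and the second entry makes 8 eta D
     at most eps / 2. Dividing by D + 1 allows D = 0. *)
  set (eta := Rmin (/ 24) (eps / (16 * (D + 1)))).
  assert (Heta : 0 < eta <= / 24).
  { split; [ apply Rmin_pos; [ lra | apply Rdiv_lt_0_compat; lra ] | apply Rmin_l ]. }
  assert (HetaD : eta * D <= eps / 16).
  { apply Rle_trans with (eps / (16 * (D + 1)) * (D + 1)).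
    - apply Rmult_le_compat; try lra. apply Rmin_r.
    - apply Req_le; field; lra. }
  (* The terms proportional to r add up to less than 43 r, which fits in the remaining eps / 2. *)
  set (r := Rmin r0 (eps / 100)).
  assert (Hr : 0 < r) by (apply Rmin_pos; lra).
  assert (Hrr : r <= r0) by apply Rmin_l.
  assert (Hre : r <= eps / 100) by apply Rmin_r.
  exists (eta / 3); split; [ lra |]. intros La HLa.
  set (E := Rmin (eta ^ 2 / 24) (eta ^ 2 * r / (108 * La))).
  assert (He2 : 0 < eta ^ 2) by (apply pow_lt; lra).
  assert (HE0 : 0 < E).
  { apply Rmin_pos; [ lra |]. apply Rdiv_lt_0_compat; nra. }
  assert (HE1 : 24 * E <= eta ^ 2) by (pose proof (Rmin_l (eta ^ 2 / 24) (eta ^ 2 * r / (108 * La))) as Hmin; fold E in Hmin; lra).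
  assert (HE2 : forall l, l <= La -> 108 * E * l <= eta ^ 2 * r).
  { intros l Hl. apply Rle_trans with (108 * E * La); [ apply Rmult_le_compat_l; lra |].
    apply Rle_trans with (108 * (eta ^ 2 * r / (108 * La)) * La).
    - apply Rmult_le_compat_r; [ lra |]. apply Rmult_le_compat_l; [ lra |]. apply Rmin_r.
    - apply Req_le; field; lra. }
  exists E; split; auto.
  assert (Hlen : forall d, 0 <= d <= D -> 40 * r + exp (6 * eta) * (d + 2 * r) <= d + eps).
  { intros d Hd.
    assert (exp (6 * eta) <= 1 + 8 * eta).
    { eapply Rle_trans; [ apply exp_bound_inv; lra |].
      apply Rmult_le_reg_r with (1 - 6 * eta); [ lra |]. rewrite Rinv_l by lra. nra. }
    apply Rle_trans with (40 * r + (1 + 8 * eta) * (d + 2 * r)).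
    - apply Rplus_le_compat_l, Rmult_le_compat_r; lra.
    - assert (eta * d <= eps / 16).
      { apply Rle_trans with (2 := HetaD). apply Rmult_le_compat_l; lra. }
      assert (eta * r <= / 24 * r) by (apply Rmult_le_compat_r; lra). lra. }
  assert (W : forall a1 a2 b1 b2 u w reach p q p' q',
    a1 <= a2 -> b1 <= b2 -> a2 - a1 <= La -> b2 - b1 <= La ->
    Ck 1 u -> Ck 1 w -> small_energy u w a1 a2 b1 b2 E ->
    conformal_reach a1 a2 b1 b2 (fun x y => u x y + w x y) reach ->
    (forall y, b1 <= y <= b2 -> Rabs (u a2 y) <= eta / 3 /\ Rabs (w a2 y) <= eta / 3) ->
    a1 + r0 <= p -> p + 2 * r0 <= a2 -> b1 + r0 <= q -> q + 2 * r0 <= b2 ->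
    a1 + r0 <= p' -> p' + 2 * r0 <= a2 -> b1 + r0 <= q' -> q' + 2 * r0 <= b2 ->
    sqrt ((p' - p) ^ 2 + (q' - q) ^ 2) <= D -> Rabs (p' - p) <= Rabs (q' - q) ->
    reach p q p' q' (sqrt ((p' - p) ^ 2 + (q' - q) ^ 2) + eps)).
  { intros a1 a2 b1 b2 u w reach p q p' q' Ha Hb HLa' HLb' Hu Hw HEn HR Hedge
      A1 A2 A3 A4 A5 A6 A7 A8 Hd Hdir.
    apply (reach_mono _ _ _ _ _ _ HR) with
      (40 * r + exp (6 * eta) * (sqrt ((p' - p) ^ 2 + (q' - q) ^ 2) + 2 * r)).
    { apply Hlen. split; auto. apply sqrt_pos. }
    destruct (Rle_dec q q') as [Hq|Hq].
    - rewrite (Rabs_pos_eq (q' - q)) in Hdir by lra.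
      apply (reach_along u w a1 a2 b1 b2 E); auto; lra.
    - rewrite (Rabs_left (q' - q)) in Hdir by lra.
      replace ((p' - p) ^ 2 + (q' - q) ^ 2) with ((p - p') ^ 2 + (q - q') ^ 2) by ring.
      apply (reach_sym _ _ _ _ _ _ HR).
      apply (reach_along u w a1 a2 b1 b2 E); auto; try lra.
      rewrite Rabs_minus_sym; lra. }
  intros a1 a2 b1 b2 u w reach p q p' q' Ha Hb HLa' HLb' Hu Hw HEn HR Hedge1 Hedge2
    A1 A2 A3 A4 A5 A6 A7 A8 Hd.
  destruct (Rle_dec (Rabs (p' - p)) (Rabs (q' - q))) as [Hdir|Hdir].
  - apply (W a1 a2 b1 b2 u w); auto.
  (* A flat segment becomes steep when the coordinates are exchanged; the top edge y = b2 then takes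
     over the role of x = a2. *)
  - apply conformal_reach_swap in HR.
    rewrite Rplus_comm. rewrite Rplus_comm in Hd. rewrite (Rplus_comm (_ ^ 2)). rewrite (Rplus_comm eps).
    apply (W b1 b2 a1 a2 (fun x y => u y x) (fun x y => w y x) (fun x y x' y' l => reach y x y' x' l));
      auto using Ck_swap.
    + apply small_energy_swap; auto.
    + lra.
Qed.

(** * Energy of the supersolution w *)

Lemma iint_le f g a1 a2 b1 b2 : cont2 f -> cont2 g -> a1 <= a2 -> b1 <= b2 ->
  (forall x y, a1 <= x <= a2 -> b1 <= y <= b2 -> f x y <= g x y) ->
  iint f a1 a2 b1 b2 <= iint g a1 a2 b1 b2.
Proof.
  intros Hf Hg Ha Hb H.
  apply RInt_le_cont; auto using cont_RInt_inner.
  intros y Hy; apply RInt_le_cont; auto; intros; cont.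
Qed.

Lemma iint_plus f g a1 a2 b1 b2 : cont2 f -> cont2 g ->
  iint (fun x y => f x y + g x y) a1 a2 b1 b2 = iint f a1 a2 b1 b2 + iint g a1 a2 b1 b2.
Proof.
  intros Hf Hg; unfold iint.
  rewrite <- RInt_plus_R by (apply cont_RInt_inner; auto).
  apply RInt_ext; intros y _. apply (RInt_plus_R (fun x => f x y) (fun x => g x y)); intros; cont.
Qed.

Lemma iint_scal f c a1 a2 b1 b2 : cont2 f ->
  iint (fun x y => c * f x y) a1 a2 b1 b2 = c * iint f a1 a2 b1 b2.
Proof.
  intros Hf; unfold iint.
  rewrite <- RInt_scal_R by (apply cont_RInt_inner; auto).
  apply RInt_ext; intros y _. apply (RInt_scal_R (fun x => f x y)); intros; cont.
Qed.

Lemma iint_const c a1 a2 b1 b2 : iint (fun _ _ => c) a1 a2 b1 b2 = (b2 - b1) * ((a2 - a1) * c).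
Proof.
  unfold iint. rewrite (RInt_ext _ (fun _ => (a2 - a1) * c)).
  - apply RInt_const_R.
  - intros; apply RInt_const_R.
Qed.

(* Integrate div ((atan (w - c) - 2) grad w). Since -4 <= atan - 2 <= 0, both the
   superharmonic part of w and the flux through x = a1 have a favourable sign, and
   the bound does not depend on c. *)
Lemma log_energy_bound u w a1 a2 b1 b2 beta M la c :
  Ck 1 u -> Ck 2 w -> 0 < a1 -> a1 <= a2 -> b1 <= b2 -> 0 < la ->
  (forall x y, a1 <= x -> D1 (D1 w) x y + D2 (D2 w) x y <= 2 * D1 u x y / x) ->
  (forall y, b1 <= y <= b2 -> D1 w a1 y <= 0) ->
  (forall y, b1 <= y <= b2 -> Rabs (D1 w a2 y) <= beta) ->
  (forall x, a1 <= x <= a2 -> Rabs (D2 w x b1) <= beta /\ Rabs (D2 w x b2) <= beta) ->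
  iint (fun x y => D1 u x y ^ 2 + D2 u x y ^ 2) a1 a2 b1 b2 <= M ->
  iint (fun x y => (D1 w x y ^ 2 + D2 w x y ^ 2) / (1 + (w x y - c) ^ 2)) a1 a2 b1 b2
  <= 4 / a1 * (la * M + (b2 - b1) * (a2 - a1) / la) + 4 * beta * ((b2 - b1) + 2 * (a2 - a1)).
Proof.
  intros Hu Hw Ha1 Ha Hb Hla Hsup Hmono Hright Htop HM.
  destruct Hu as (Hu0 & _ & _ & [Hu1 _] & [Hu2 _]).
  assert (Hw0 := Ck_cont2 _ _ Hw).
  assert (C1 := Ck_D1 _ _ Hw). assert (C2 := Ck_D2 _ _ Hw).
  assert (Hw1 := Ck_cont2 _ _ C1). assert (Hw2 := Ck_cont2 _ _ C2).
  assert (Hw11 := Ck_cont2 _ _ (Ck_D1 _ _ C1)). assert (Hw22 := Ck_cont2 _ _ (Ck_D2 _ _ C2)).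
  set (T := fun x y => atan (w x y - c)).
  assert (HT : cont2 T) by (unfold T; cont).
  assert (BT : forall x y, - 2 < T x y < 2).
  { intros x y. pose proof (atan_bound (w x y - c)). pose proof PI_4. unfold T; lra. }
  assert (Hq : forall x y, 1 + (w x y - c) ^ 2 <> 0) by (intros; apply Rgt_not_eq, one_plus_sq_pos).
  set (Ax := fun x y => D1 w x y * / (1 + (w x y - c) ^ 2) * D1 w x y + (T x y - 2) * D1 (D1 w) x y).
  set (By := fun x y => D2 w x y * / (1 + (w x y - c) ^ 2) * D2 w x y + (T x y - 2) * D2 (D2 w) x y).
  assert (HAx : cont2 Ax) by (unfold Ax; cont; apply Hq).
  assert (HBy : cont2 By) by (unfold By; cont; apply Hq).
  assert (DA : forall x y, is_derive (fun s => (T s y - 2) * D1 w s y) x (Ax x y)).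
  { intros x y. unfold Ax.
    apply (is_derive_mult (K := R_AbsRing) (fun s => T s y - 2) (fun s => D1 w s y));
      [| eapply Ck_is_derive1; eauto | exact Rmult_comm ].
    unfold T. rewrite <- Rsqr_pow2.
    apply (is_derive_ext (fun s => minus (atan (w s y - c)) 2)); [ reflexivity |].
    rewrite <- (Rminus_0_r (_ * _)). apply (is_derive_minus (V := R_NormedModule));
      [| apply (is_derive_const (V := R_NormedModule)) ].
    apply (is_derive_comp atan (fun s => w s y - c)); [ apply is_derive_atan |].
    rewrite <- (Rminus_0_r (D1 w x y)).
    apply (is_derive_minus (V := R_NormedModule) (fun s => w s y) (fun _ => c));
      [ eapply Ck_is_derive1; eauto | apply (is_derive_const (V := R_NormedModule)) ]. }
  assert (DB : forall x y, is_derive (fun s => (T x s - 2) * D2 w x s) y (By x y)).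
  { intros x y. unfold By.
    apply (is_derive_mult (K := R_AbsRing) (fun s => T x s - 2) (fun s => D2 w x s));
      [| eapply Ck_is_derive2; eauto | exact Rmult_comm ].
    unfold T. rewrite <- Rsqr_pow2.
    apply (is_derive_ext (fun s => minus (atan (w x s - c)) 2)); [ reflexivity |].
    rewrite <- (Rminus_0_r (_ * _)). apply (is_derive_minus (V := R_NormedModule));
      [| apply (is_derive_const (V := R_NormedModule)) ].
    apply (is_derive_comp atan (fun s => w x s - c)); [ apply is_derive_atan |].
    rewrite <- (Rminus_0_r (D2 w x y)).
    apply (is_derive_minus (V := R_NormedModule) (fun s => w x s) (fun _ => c));
      [ eapply Ck_is_derive2; eauto | apply (is_derive_const (V := R_NormedModule)) ]. }
  (* Young's inequality gives 2 u_x / x <= (la u_x^2 + 1 / la) / a1, and the factor 2 - T is below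
     4. A large la makes the constant term small; a small energy of u then makes the other term
     small. *)
  set (g := fun x y => 4 / a1 * la * (D1 u x y ^ 2 + D2 u x y ^ 2)).
  assert (Hg : cont2 g) by (unfold g; cont; lra).
  apply Rle_trans with (iint (fun x y => Ax x y + By x y + (g x y + 4 / a1 / la)) a1 a2 b1 b2).
  { apply iint_le; auto; [ cont; auto | cont; lra |].
    intros x y Hx Hy. specialize (Hsup x y ltac:(lra)). specialize (BT x y).
    unfold Ax, By, g.
    set (q := 1 + (w x y - c) ^ 2). set (w1 := D1 w x y). set (w2 := D2 w x y).
    set (u1 := D1 u x y) in *. set (De := D1 (D1 w) x y + D2 (D2 w) x y) in *.
    replace (w1 * / q * w1 + (T x y - 2) * D1 (D1 w) x y + (w2 * / q * w2 + (T x y - 2) * D2 (D2 w) x y))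
      with ((w1 ^ 2 + w2 ^ 2) / q - (2 - T x y) * De) by (unfold De, Rdiv; ring).
    assert (A1 : (2 - T x y) * De <= (2 - T x y) * (2 * u1 / x)) by (apply Rmult_le_compat_l; lra).
    assert (A2 : 2 * u1 / x <= (la * u1 ^ 2 + / la) / a1).
    { apply Rle_trans with (2 * Rabs u1 / a1).
      - unfold Rdiv. apply Rle_trans with (2 * Rabs u1 * / x).
        + apply Rmult_le_compat_r; [ left; apply Rinv_0_lt_compat; lra |]. pose proof (Rle_abs u1); lra.
        + apply Rmult_le_compat_l; [ pose proof (Rabs_pos u1); lra |]. apply Rinv_le_contravar; lra.
      - unfold Rdiv. apply Rmult_le_compat_r; [ left; apply Rinv_0_lt_compat; lra |].
        rewrite <- (pow2_abs u1). pose proof (pow2_ge_0 (la * Rabs u1 - 1)).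
        apply Rmult_le_reg_l with la; auto.
        replace (la * (la * Rabs u1 ^ 2 + / la)) with (la ^ 2 * Rabs u1 ^ 2 + 1) by (field; lra). nra. }
    assert (A3 : 0 <= (la * u1 ^ 2 + / la) / a1).
    { apply Rdiv_le_0_compat; auto. pose proof (pow2_ge_0 u1).
      assert (0 < / la) by (apply Rinv_0_lt_compat; auto). nra. }
    assert (A4 : (2 - T x y) * (2 * u1 / x) <= 4 * ((la * u1 ^ 2 + / la) / a1)).
    { apply Rle_trans with ((2 - T x y) * ((la * u1 ^ 2 + / la) / a1)).
      - apply Rmult_le_compat_l; lra.
      - apply Rmult_le_compat_r; lra. }
    replace (4 * ((la * u1 ^ 2 + / la) / a1)) with (4 / a1 * la * u1 ^ 2 + 4 / a1 / la) in A4 by (field; lra).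
    assert (0 <= 4 / a1 * la * D2 u x y ^ 2).
    { apply Rmult_le_pos; [| apply pow2_ge_0 ]. apply Rmult_le_pos; [| lra ].
      apply Rdiv_le_0_compat; lra. }
    lra. }
  rewrite iint_plus by (cont; lra).
  rewrite iint_plus by auto.
  rewrite iint_plus by (auto; cont; lra).
  rewrite iint_const. unfold g. rewrite iint_scal by cont.
  assert (I1 : iint Ax a1 a2 b1 b2 <= (b2 - b1) * (4 * beta)).
  { unfold iint. rewrite (RInt_ext _ (fun y => (T a2 y - 2) * D1 w a2 y - (T a1 y - 2) * D1 w a1 y)).
    2: { intros y _. apply (RInt_is_derive (fun x => (T x y - 2) * D1 w x y)); auto. intros; cont. }
    rewrite <- RInt_const_R. apply RInt_le_cont; auto; [ intros; cont | intros; cont |].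
    intros y Hy. specialize (Hright y Hy). specialize (Hmono y Hy).
    pose proof (BT a1 y). pose proof (BT a2 y). apply Rabs_le_between in Hright.
    nra. }
  assert (I2 : iint By a1 a2 b1 b2 <= (a2 - a1) * (8 * beta)).
  { unfold iint. rewrite fubini_rect by auto.
    rewrite (RInt_ext _ (fun x => (T x b2 - 2) * D2 w x b2 - (T x b1 - 2) * D2 w x b1)).
    2: { intros x _. apply (RInt_is_derive (fun y => (T x y - 2) * D2 w x y)); auto. intros; cont. }
    rewrite <- RInt_const_R. apply RInt_le_cont; auto; [ intros; cont | intros; cont |].
    intros x Hx. destruct (Htop x Hx) as [B1 B2].
    pose proof (BT x b1). pose proof (BT x b2).
    apply Rabs_le_between in B1. apply Rabs_le_between in B2. nra. }
  assert (I3 : 4 / a1 * la * iint (fun x y => D1 u x y ^ 2 + D2 u x y ^ 2) a1 a2 b1 b2 <= 4 / a1 * la * M).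
  { apply Rmult_le_compat_l; auto. apply Rmult_le_pos; [| lra ]. apply Rdiv_le_0_compat; lra. }
  replace (4 / a1 * (la * M + (b2 - b1) * (a2 - a1) / la))
    with (4 / a1 * la * M + (b2 - b1) * ((a2 - a1) * (4 / a1 / la))) by (field; lra).
  lra.
Qed.

(** * The mass function *)

(* Two successive one-dimensional substitutions, s = sqrt (x^2 + z^2) for fixed z
   and z = s cos th for fixed s; [sqrt] of a negative number is 0 and G vanishes on
   the axis, so H vanishes outside the half disc. *)
Lemma polar_domination G a L R0 :
  cont2 G -> (forall x y, 0 <= G x y) -> (forall y, G 0 y = 0) ->
  0 < a -> a <= L -> 0 <= R0 -> 2 * L ^ 2 <= R0 ^ 2 ->
  iint (fun x y => G x y * x) a L (- L) L <=
  RInt (fun s => RInt (fun th => G (s * sin th) (s * cos th) * (s ^ 2 * sin th)) 0 PI) 0 R0.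
Proof.
  intros HG Gp G0 Ha HL HR HLR.
  set (H := fun s z => G (sqrt (s ^ 2 - z ^ 2)) z * s).
  assert (HH : cont2 H) by (unfold H; cont).
  assert (Hp : forall s z, 0 <= s -> 0 <= H s z) by (intros; apply Rmult_le_pos; auto).
  assert (HLR' : L <= R0) by nra.
  apply Rle_trans with (iint H 0 R0 (- R0) R0).
  - apply Rle_trans with (RInt (fun z => RInt (fun s => H s z) 0 R0) (- L) L).
    + apply RInt_le_cont; [ lra | | |].
      * apply (cont_RInt_inner (fun x y => G x y * x)). cont.
      * apply cont_RInt_inner; auto.
      * intros z Hz.
        assert (Q : forall x, a <= x <= L -> 0 < x ^ 2 + z ^ 2) by (intros; nra).
        assert (E : RInt (fun x => G x z * x) a L = RInt (fun s => H s z) (sqrt (a ^ 2 + z ^ 2)) (sqrt (L ^ 2 + z ^ 2))).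
        { rewrite <- (RInt_comp (V := R_CompleteNormedModule) (fun s => H s z)
            (fun x => sqrt (x ^ 2 + z ^ 2)) (fun x => x / sqrt (x ^ 2 + z ^ 2))).
          - apply RInt_ext; rewrite Rmin_left, Rmax_right by auto. intros x Hx.
            unfold scal; simpl; unfold mult; simpl. unfold H.
            specialize (Q x ltac:(lra)).
            assert (Z := sqrt_lt_R0 _ Q).
            change (x * (x * 1)) with (x ^ 2). change (z * (z * 1)) with (z ^ 2).
            rewrite pow2_sqrt by lra.
            replace (x ^ 2 + z ^ 2 - z ^ 2) with (x ^ 2) by ring.
            rewrite sqrt_pow2 by lra. field. lra.
          - intros; cont.
          - rewrite Rmin_left, Rmax_right by auto. intros x Hx; specialize (Q x Hx).
            assert (Z := sqrt_lt_R0 _ Q).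
            split; [| cont; lra ].
            replace (x / sqrt (x ^ 2 + z ^ 2)) with (2 * x / (2 * sqrt (x ^ 2 + z ^ 2))) by (field; lra).
            apply (is_derive_sqrt (fun x => x ^ 2 + z ^ 2)); auto.
            auto_derive; auto; ring. }
        rewrite E. apply RInt_nonneg_mono.
        -- intros; cont.
        -- intros; apply Hp; lra.
        -- apply sqrt_pos.
        -- apply sqrt_le_1_alt. nra.
        -- rewrite <- (sqrt_pow2 R0) by auto. apply sqrt_le_1_alt. nra.
    + apply RInt_nonneg_mono; try lra; [ apply cont_RInt_inner; auto |].
      intros z _. apply RInt_ge_0; auto; [ exint |]. intros; apply Hp; lra.
  - unfold iint. rewrite fubini_rect by auto.
    apply Req_le, RInt_ext; rewrite Rmin_left, Rmax_right by auto. intros s Hs.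
    assert (Z : forall z, s <= Rabs z -> H s z = 0).
    { intros z Hz. unfold H. rewrite sqrt_neg_0, G0; [ ring |].
      rewrite <- (pow2_abs z). nra. }
    rewrite <- (RInt_Chasles (V := R_CompleteNormedModule) (fun z => H s z) (- R0) (- s) R0) by exint.
    rewrite <- (RInt_Chasles (V := R_CompleteNormedModule) (fun z => H s z) (- s) s R0) by exint.
    rewrite (RInt_ext (fun z => H s z) (fun _ => 0) (- R0) (- s)).
    2: { rewrite Rmin_left, Rmax_right by lra. intros z Hz; apply Z. rewrite Rabs_left; lra. }
    rewrite (RInt_ext (fun z => H s z) (fun _ => 0) s R0).
    2: { rewrite Rmin_left, Rmax_right by lra. intros z Hz; apply Z. rewrite Rabs_pos_eq; lra. }
    rewrite !RInt_const_R. unfold plus; simpl.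
    rewrite !Rmult_0_r, Rplus_0_r, Rplus_0_l.
    rewrite <- (opp_RInt_swap (V := R_CompleteNormedModule)) by exint.
    assert (E : RInt (fun th => - (s * sin th) * H s (s * cos th)) 0 PI = RInt (fun z => H s z) s (- s)).
    { replace (RInt (fun z => H s z) s (- s)) with (RInt (fun z => H s z) (s * cos 0) (s * cos PI))
        by (rewrite cos_PI, cos_0; f_equal; ring).
      apply (RInt_comp (V := R_CompleteNormedModule) (fun z => H s z)
            (fun th => s * cos th) (fun th => - (s * sin th))).
      - intros; cont.
      - intros th _. split; [ auto_derive; auto; ring | cont ]. }
    rewrite <- E. change (- RInt (fun th => - (s * sin th) * H s (s * cos th)) 0 PI =
      RInt (fun th => G (s * sin th) (s * cos th) * (s ^ 2 * sin th)) 0 PI).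
    rewrite <- RInt_opp_R by (intros; cont).
    apply RInt_ext; rewrite Rmin_left, Rmax_right by (pose proof PI_RGT_0; lra). intros th Hth.
    assert (0 < sin th) by (apply sin_gt_0; lra).
    unfold H. replace (s ^ 2 - (s * cos th) ^ 2) with ((s * sin th) ^ 2).
    2: { rewrite !Rpow_mult_distr. pose proof (sin2_cos2 th) as Y. unfold Rsqr in Y.
         replace (s ^ 2 - s ^ 2 * cos th ^ 2) with (s ^ 2 * (1 - cos th * cos th)) by ring.
         rewrite <- Y. ring. }
    rewrite sqrt_pow2 by (apply Rmult_le_pos; lra).
    ringR.
Qed.

Section MassFunction.
Context (u al : R -> R -> R) (Hu : Ck 2 u) (Hal : Ck 2 al).

(* Polar form, at x = r sin th, y = r cos th, of the flux density
   (4 u_r - 2 al_r + 2 al / r) r^2 sin th. *)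
Definition mass_density (r th : R) : R :=
  let x := r * sin th in let y := r * cos th in
  4 * (r ^ 2 * sin th) * (D1 u x y * sin th + D2 u x y * cos th)
  - 2 * (r ^ 2 * sin th) * (D1 al x y * sin th + D2 al x y * cos th)
  + 2 * r * sin th * al x y.

(** The planar divergence of V = 4 x grad u - 2 x grad al + 2 al e_x. By [scalar_curvature_diag] it
    equals x (e^(2 al - 2 u) R_g + 2 |grad u|^2). [mass_density] is r times the radial component of
    V. *)
Definition axial_source (x y : R) : R :=
  4 * (x * (D1 (D1 u) x y + D2 (D2 u) x y) + D1 u x y)
  - 2 * x * (D1 (D1 al) x y + D2 (D2 al) x y).

Definition mass_density_r (r th : R) : R :=
  let x := r * sin th in let y := r * cos th in let s := sin th in let c := cos th in
  8 * r * s * (D1 u x y * s + D2 u x y * c)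
  + 4 * r ^ 2 * s * (D1 (D1 u) x y * s ^ 2 + 2 * D2 (D1 u) x y * s * c + D2 (D2 u) x y * c ^ 2)
  - 4 * r * s * (D1 al x y * s + D2 al x y * c)
  - 2 * r ^ 2 * s * (D1 (D1 al) x y * s ^ 2 + 2 * D2 (D1 al) x y * s * c + D2 (D2 al) x y * c ^ 2)
  + 2 * s * al x y + 2 * r * s * (D1 al x y * s + D2 al x y * c).

(** The angular component of the same field V. The divergence theorem in polar coordinates reads r
    div V = d/dr (r V_r) + d/dth V_th, which is [angular_flux_derive]. *)
Definition angular_flux (r th : R) : R :=
  let x := r * sin th in let y := r * cos th in let s := sin th in let c := cos th in
  4 * s * (r * (D1 u x y * c - D2 u x y * s))
  - 2 * (s * (r * (D1 al x y * c - D2 al x y * s)) - c * al x y).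

Lemma is_derive_polar_r f r th : Ck 1 f ->
  is_derive (fun r => f (r * sin th) (r * cos th)) r
    (D1 f (r * sin th) (r * cos th) * sin th + D2 f (r * sin th) (r * cos th) * cos th).
Proof.
  intros Hf; apply (is_derive_comp2 f (fun r => r * sin th) (fun r => r * cos th)); auto;
    auto_derive; auto; ring.
Qed.

Lemma is_derive_polar_th f r th : Ck 1 f ->
  is_derive (fun th => f (r * sin th) (r * cos th)) th
    (D1 f (r * sin th) (r * cos th) * (r * cos th) + D2 f (r * sin th) (r * cos th) * (- (r * sin th))).
Proof.
  intros Hf; apply (is_derive_comp2 f (fun th => r * sin th) (fun th => r * cos th)); auto;
    auto_derive; auto; ring.
Qed.

Ltac der :=
  lazymatch goal with
  | |- is_derive (fun t => @?f t + @?g t) _ _ => eapply (is_derive_plus (V := R_NormedModule) f g); der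
  | |- is_derive (fun t => @?f t - @?g t) _ _ => eapply (is_derive_minus (V := R_NormedModule) f g); der
  | |- is_derive (fun t => @?f t * @?g t) _ _ => eapply (is_derive_mult (K := R_AbsRing) f g); [ der | der | exact Rmult_comm ]
  | |- is_derive (fun r => ?f (r * sin _) (r * cos _)) _ _ => apply is_derive_polar_r; auto using Ck_D1, Ck_D2, Ck_pred
  | |- is_derive (fun th => ?f (_ * sin th) (_ * cos th)) _ _ => apply is_derive_polar_th; auto using Ck_D1, Ck_D2, Ck_pred
  | |- is_derive (fun t => t) _ _ => apply (is_derive_id (K := R_AbsRing))
  | |- is_derive (fun t => t ^ 2) _ _ => apply (is_derive_ext (fun t => t * t)); [ intros; simpl; ring | der ]
  | |- is_derive (fun t => sin t) ?t _ => apply (is_derive_sin t)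
  | |- is_derive (fun t => cos t) ?t _ => apply (is_derive_cos t)
  | |- is_derive (fun t => ?c) _ _ => apply (is_derive_const (V := R_NormedModule))
  | |- _ => idtac
  end.

Lemma is_derive_eq (f : R -> R) x l l' : is_derive f x l -> l = l' -> is_derive f x l'.
Proof. intros; subst; auto. Qed.

Lemma mass_density_derive r th : is_derive (fun r => mass_density r th) r (mass_density_r r th).
Proof.
  unfold mass_density, mass_density_r; cbv zeta.
  eapply is_derive_eq; [ der |].
  rewrite !D12_D21 by auto.
  unfold plus, minus, mult, opp, one, zero; simpl. unfold plus, minus, mult, opp, one, zero; simpl. ring.
Qed.

Lemma angular_flux_derive r th :
  is_derive (fun th => angular_flux r th) th
    (r * axial_source (r * sin th) (r * cos th) - mass_density_r r th).
Proof.
  unfold angular_flux, mass_density_r, axial_source; cbv zeta.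
  eapply is_derive_eq; [ der |].
  rewrite !D12_D21 by auto.
  unfold plus, minus, mult, opp, one, zero; simpl. unfold plus, minus, mult, opp, one, zero; simpl.
  pose proof (sin2_cos2 th) as Y. unfold Rsqr in Y.
  set (s := sin th) in *; set (c := cos th) in *.
  assert (Y' : c * c = 1 - s * s) by lra.
  ring_simplify.
  replace (c ^ 2) with (1 - s ^ 2) by (simpl; lra). ring.
Qed.

End MassFunction.

Section MassFunction.
Context (u al : R -> R -> R) (Hu : Ck 2 u) (Hal : Ck 2 al).

Definition mass_function (r : R) : R := RInt (mass_density u al r) 0 PI.

Lemma Ck2_cont2 f : Ck 2 f ->
  cont2 f /\ cont2 (D1 f) /\ cont2 (D2 f) /\
  cont2 (D1 (D1 f)) /\ cont2 (D2 (D1 f)) /\ cont2 (D2 (D2 f)).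
Proof.
  intros Hf. assert (C1 := Ck_D1 _ _ Hf). assert (C2 := Ck_D2 _ _ Hf).
  repeat split; eapply Ck_cont2; eauto using Ck_D1, Ck_D2.
Qed.

Lemma cont2_mass_density : cont2 (mass_density u al).
Proof.
  destruct (Ck2_cont2 u Hu) as (U0 & U1 & U2 & U11 & U21 & U22).
  destruct (Ck2_cont2 al Hal) as (A0 & A1 & A2 & A11 & A21 & A22).
  unfold mass_density; cont.
Qed.

Lemma cont2_mass_density_r : cont2 (mass_density_r u al).
Proof.
  destruct (Ck2_cont2 u Hu) as (U0 & U1 & U2 & U11 & U21 & U22).
  destruct (Ck2_cont2 al Hal) as (A0 & A1 & A2 & A11 & A21 & A22).
  unfold mass_density_r; cont.
Qed.

Lemma cont2_axial_source : cont2 (axial_source u al).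
Proof.
  destruct (Ck2_cont2 u Hu) as (U0 & U1 & U2 & U11 & U21 & U22).
  destruct (Ck2_cont2 al Hal) as (A0 & A1 & A2 & A11 & A21 & A22).
  unfold axial_source; cont.
Qed.

Context (al_axis : forall y, al 0 y = 0).

Lemma mass_function_derive r :
  is_derive mass_function r (RInt (fun th => r * axial_source u al (r * sin th) (r * cos th)) 0 PI).
Proof.
  pose proof cont2_mass_density_r as Hm. pose proof cont2_mass_density as Hm0.
  pose proof cont2_axial_source as Hs.
  replace (RInt (fun th => r * axial_source u al (r * sin th) (r * cos th)) 0 PI)
    with (RInt (fun th => mass_density_r u al r th) 0 PI).
  - apply (is_derive_RInt_param_cont2 (fun r th => mass_density u al r th)); auto.
    + intros; apply mass_density_derive; auto.
    + intros; cont.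
  - assert (E : RInt (fun th => r * axial_source u al (r * sin th) (r * cos th)
                        - mass_density_r u al r th) 0 PI = 0).
    { rewrite (RInt_is_derive (angular_flux u al r)).
      (* The endpoints lie on the axis, where sin th = 0 and the one term without this factor, 2 cos
         th al, vanishes because al does. *)
      - unfold angular_flux. rewrite sin_PI, sin_0, cos_PI, cos_0, !Rmult_0_r, !al_axis. ringR.
      - intros; apply angular_flux_derive; auto.
      - intros; cont. }
    unfold Rminus in E. rewrite RInt_plus_R, RInt_opp_R in E by (intros; cont).
    exact (eq_sym (Rminus_diag_uniq _ _ E)).
Qed.

Lemma mass_function_0 : mass_function 0 = 0.
Proof.
  unfold mass_function. rewrite (RInt_ext _ (fun _ => 0)).
  - rewrite RInt_const_R; ringR.
  - intros; unfold mass_density; ringR.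
Qed.

(** The mass density carries the weight x, at least a on the rectangle. The cutoff x^2 / (x^2 + a^2)
    makes the integrand vanish on the axis, as [polar_domination] requires; it is at least 1/2 for x
    >= a, and this loss is paid for by the 2 in 2 |grad u|^2. The radius 2 L is large enough for the
    half disc to contain the rectangle. *)
Lemma dirichlet_energy_bound a L M :
  (forall x y, 0 < x -> 2 * x * (D1 u x y ^ 2 + D2 u x y ^ 2) <= axial_source u al x y) ->
  0 < a -> a <= L -> mass_function (2 * L) <= M ->
  iint (fun x y => D1 u x y ^ 2 + D2 u x y ^ 2) a L (- L) L <= M / a.
Proof.
  intros Hsrc Ha HL HM.
  pose proof cont2_axial_source as Hs.
  destruct (Ck2_cont2 u Hu) as (U0 & U1 & U2 & _).
  set (G := fun x y => (D1 u x y ^ 2 + D2 u x y ^ 2) * (x ^ 2 / (x ^ 2 + a ^ 2))).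
  assert (Hq : forall x, 0 < x ^ 2 + a ^ 2) by (intros x; pose proof (pow2_ge_0 x); nra).
  assert (Hq' : forall x, x ^ 2 + a ^ 2 <> 0) by (intros x; apply Rgt_not_eq, Hq).
  assert (HG : cont2 G) by (unfold G; cont).
  assert (Gp0 : forall x y, 0 <= D1 u x y ^ 2 + D2 u x y ^ 2).
  { intros; apply Rplus_le_le_0_compat; apply pow2_ge_0. }
  assert (Gp : forall x y, 0 <= G x y).
  { intros; apply Rmult_le_pos; auto. apply Rdiv_le_0_compat; auto. apply pow2_ge_0. }
  assert (Gle : forall x y, G x y <= D1 u x y ^ 2 + D2 u x y ^ 2).
  { intros x y. rewrite <- Rmult_1_r. apply Rmult_le_compat_l; auto.
    apply Rmult_le_reg_r with (x ^ 2 + a ^ 2); auto.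
    unfold Rdiv; rewrite Rmult_assoc, Rinv_l by auto. nra. }
  assert (S1 : a / 2 * iint (fun x y => D1 u x y ^ 2 + D2 u x y ^ 2) a L (- L) L
               <= iint (fun x y => G x y * x) a L (- L) L).
  { rewrite <- iint_scal by cont. apply iint_le; [ cont; lra | cont | auto | lra |].
    intros x y Hx _. unfold G.
    rewrite (Rmult_comm (a / 2)), Rmult_assoc. apply Rmult_le_compat_l; auto.
    apply Rmult_le_reg_r with (2 * (x ^ 2 + a ^ 2)); [ specialize (Hq x); lra |].
    replace (x ^ 2 / (x ^ 2 + a ^ 2) * x * (2 * (x ^ 2 + a ^ 2))) with (2 * x ^ 3) by (field; auto).
    replace (a / 2 * (2 * (x ^ 2 + a ^ 2))) with (a * x ^ 2 + a * a ^ 2) by field.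
    assert (a ^ 2 <= x ^ 2) by nra. nra. }
  assert (S2 := polar_domination G a L (2 * L) HG Gp).
  assert (S3 : 2 * RInt (fun s => RInt (fun th => G (s * sin th) (s * cos th) * (s ^ 2 * sin th)) 0 PI) 0 (2 * L)
               <= mass_function (2 * L)).
  { assert (Hc1 : cont2 (fun s th => G (s * sin th) (s * cos th) * (s ^ 2 * sin th))) by cont.
    assert (Hc2 : cont2 (fun r th => r * axial_source u al (r * sin th) (r * cos th))) by cont.
    replace (mass_function (2 * L)) with (mass_function (2 * L) - mass_function 0)
      by (rewrite mass_function_0; ring).
    rewrite <- (RInt_is_derive mass_function
      (fun r => RInt (fun th => r * axial_source u al (r * sin th) (r * cos th)) 0 PI)).
    - rewrite <- RInt_scal_R by (apply cont_RInt_param; auto).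
      apply RInt_le_cont; [ lra | | |].
      + intros s. cont. apply (cont_RInt_param _ _ _ Hc1).
      + apply (cont_RInt_param _ _ _ Hc2).
      + intros s Hs0. rewrite <- RInt_scal_R by (intros; cont).
        apply RInt_le; [ pose proof PI_RGT_0; lra | exint | exint |].
        intros th Hth. assert (0 < sin th) by (apply sin_gt_0; lra).
        destruct Hs0 as [[Hs0 | <-] _]; [| lra ].
        specialize (Hsrc (s * sin th) (s * cos th) ltac:(apply Rmult_lt_0_compat; auto)).
        specialize (Gle (s * sin th) (s * cos th)).
        replace (2 * (G (s * sin th) (s * cos th) * (s ^ 2 * sin th)))
          with (s * (2 * (s * sin th) * G (s * sin th) (s * cos th))) by ring.
        apply Rmult_le_compat_l; [ lra |]. eapply Rle_trans; [| exact Hsrc ].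
        apply Rmult_le_compat_l; auto. assert (0 < s * sin th) by (apply Rmult_lt_0_compat; auto). lra.
    - intros; apply mass_function_derive.
    - apply (cont_RInt_param _ _ _ Hc2). }
  assert (S2' : iint (fun x y => G x y * x) a L (- L) L <=
    RInt (fun s => RInt (fun th => G (s * sin th) (s * cos th) * (s ^ 2 * sin th)) 0 PI) 0 (2 * L)).
  { apply S2; auto; try lra; [| nra ]. intros; unfold G, Rdiv; ring. }
  apply Rmult_le_reg_l with a; auto.
  replace (a * (M / a)) with M by (field; lra). lra.
Qed.

Lemma mass_function_nondecreasing r r' :
  (forall x y, 0 < x -> 2 * x * (D1 u x y ^ 2 + D2 u x y ^ 2) <= axial_source u al x y) ->
  0 <= r <= r' -> mass_function r <= mass_function r'.
Proof.
  intros Hsrc Hr.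
  pose proof cont2_axial_source as Hs.
  assert (Hc2 : cont2 (fun r th => r * axial_source u al (r * sin th) (r * cos th))) by cont.
  assert (E : 0 <= mass_function r' - mass_function r).
  { rewrite <- (RInt_is_derive mass_function
      (fun r => RInt (fun th => r * axial_source u al (r * sin th) (r * cos th)) 0 PI)).
    - apply RInt_ge_0; [ lra | apply ex_RInt_cont, (cont_RInt_param _ _ _ Hc2) |].
      intros s Hs0. apply RInt_ge_0; [ pose proof PI_RGT_0; lra | exint |].
      intros th Hth. assert (0 < sin th) by (apply sin_gt_0; lra).
      assert (0 < s * sin th) by (apply Rmult_lt_0_compat; lra).
      apply Rmult_le_pos; [ lra |]. eapply Rle_trans; [| apply Hsrc; auto ].
      apply Rmult_le_pos; [ lra |]. apply Rplus_le_le_0_compat; apply pow2_ge_0.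
    - intros; apply mass_function_derive.
    - apply (cont_RInt_param _ _ _ Hc2). }
  lra.
Qed.
End MassFunction.

(** * Scalar curvature *)

Section Curvature.
Context (u al : R -> R -> R) (Hu : Ck 2 u) (Hal : Ck 2 al).

Definition conf (x z : R) : R := exp (2 * al x z - 2 * u x z).
Definition twist (x z : R) : R := exp (- 2 * al x z).

(* exp (- 2 u) = conf * twist. *)
Definition diag_metric (i j : idx) (x z : R) : R :=
  match i, j with
  | i1, i1 | i2, i2 => conf x z
  | i3, i3 => x * x * (conf x z * twist x z)
  | _, _ => 0
  end.

Definition diag_christoffel (k i j : idx) (x z : R) : R :=
  match k, i, j with
  | i1, i1, i1 | i2, i1, i2 | i2, i2, i1 => D1 al x z - D1 u x z
  | i1, i2, i2 => D1 u x z - D1 al x z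
  | i2, i2, i2 | i1, i1, i2 | i1, i2, i1 => D2 al x z - D2 u x z
  | i2, i1, i1 => D2 u x z - D2 al x z
  | i1, i3, i3 => (x * x * D1 u x z - x) * twist x z
  | i2, i3, i3 => x * x * D2 u x z * twist x z
  | i3, i1, i3 | i3, i3, i1 => / x - D1 u x z
  | i3, i2, i3 | i3, i3, i2 => - D2 u x z
  | _, _, _ => 0
  end.

Ltac der :=
  lazymatch goal with
  | |- is_derive (fun t => t) _ _ => apply (is_derive_id (K := R_AbsRing))
  | |- is_derive (fun t => @?f t + @?g t) _ _ => eapply (is_derive_plus (V := R_NormedModule) f g); der
  | |- is_derive (fun t => @?f t - @?g t) _ _ => eapply (is_derive_minus (V := R_NormedModule) f g); der
  | |- is_derive (fun t => - @?f t) _ _ => eapply (is_derive_opp (V := R_NormedModule) f); der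
  | |- is_derive (fun t => @?f t * @?g t) _ _ => eapply (is_derive_mult (K := R_AbsRing) f g); [ der | der | exact Rmult_comm ]
  | |- is_derive (fun t => / t) _ _ => eapply (is_derive_inv (fun t => t)); [ apply (is_derive_id (K := R_AbsRing)) | ]
  | |- is_derive (fun t => exp (@?f t)) _ _ => eapply (is_derive_comp exp f); [ apply is_derive_exp | der ]
  | |- is_derive (fun t => ?f t _) _ _ => eapply Ck_is_derive1; eauto using Ck_D1, Ck_D2, Ck_pred
  | |- is_derive (fun t => ?f _ t) _ _ => eapply Ck_is_derive2; eauto using Ck_D1, Ck_D2, Ck_pred
  | |- is_derive (fun t => ?c) _ _ => apply (is_derive_const (V := R_NormedModule))
  | |- _ => idtac
  end.

Ltac ralg := unfold plus, minus, mult, opp, scal, one, zero; simpl;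
  unfold plus, minus, mult, opp, scal, one, zero; simpl.

Lemma pd_planar l f F x z phi :
  (forall p, 0 < coord i1 p -> f p = F (coord i1 p) (coord i2 p)) -> 0 < x ->
  pd l f (x, z, phi) = match l with i1 => D1 F x z | i2 => D2 F x z | i3 => 0 end.
Proof.
  intros Hf Hx; unfold pd; destruct l; simpl.
  - apply Derive_ext_loc. exists (mkposreal x Hx). intros t Ht.
    apply Hf; simpl. apply Rabs_def2 in Ht. unfold minus, plus, opp in Ht; simpl in Ht. lra.
  - apply Derive_ext; intros t. apply Hf; auto.
  - rewrite (Derive_ext _ (fun _ => F x z)); [ apply Derive_const |].
    intros t; apply Hf; auto.
Qed.

Definition diag_metric_d1 (i j : idx) (x z : R) : R :=
  match i, j with
  | i1, i1 | i2, i2 => conf x z * (2 * D1 al x z - 2 * D1 u x z)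
  | i3, i3 => (2 * x - 2 * x * x * D1 u x z) * (conf x z * twist x z)
  | _, _ => 0
  end.

Definition diag_metric_d2 (i j : idx) (x z : R) : R :=
  match i, j with
  | i1, i1 | i2, i2 => conf x z * (2 * D2 al x z - 2 * D2 u x z)
  | i3, i3 => - 2 * x * x * D2 u x z * (conf x z * twist x z)
  | _, _ => 0
  end.

Lemma diag_metric_D1 i j x z : D1 (diag_metric i j) x z = diag_metric_d1 i j x z.
Proof.
  apply is_derive_unique.
  destruct i, j; simpl; unfold conf, twist; (eapply is_derive_eq; [ der |]); ralg; ring.
Qed.

Lemma diag_metric_D2 i j x z : D2 (diag_metric i j) x z = diag_metric_d2 i j x z.
Proof.
  apply is_derive_unique.
  destruct i, j; simpl; unfold conf, twist; (eapply is_derive_eq; [ der |]); ralg; ring.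
Qed.

Context (g : tensor2)
  (Hg : forall i j p, 0 < coord i1 p -> g i j p = diag_metric i j (coord i1 p) (coord i2 p)).

Lemma christoffel_diag k i j p : 0 < coord i1 p ->
  christoffel g k i j p = diag_christoffel k i j (coord i1 p) (coord i2 p).
Proof.
  destruct p as [[x z] phi]; simpl coord; intros Hx.
  assert (Hc := exp_pos (2 * al x z - 2 * u x z)). fold (conf x z) in Hc.
  assert (Ht := exp_pos (- 2 * al x z)). fold (twist x z) in Ht.
  assert (E : forall l i j, pd l (g i j) (x, z, phi) =
    match l with i1 => diag_metric_d1 i j x z | i2 => diag_metric_d2 i j x z | i3 => 0 end).
  { intros l i' j'. rewrite (pd_planar l _ (diag_metric i' j')) by auto.
    rewrite diag_metric_D1, diag_metric_D2; auto. }
  unfold christoffel, sum3. rewrite !E.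
  unfold ginv, det, sum3, cofactor. rewrite !Hg by auto.
  clear E. simpl coord.
  destruct k, i, j; cbn [next diag_metric diag_metric_d1 diag_metric_d2 diag_christoffel];
    field; lra.
Qed.

(** The link between geometry and mass: nonnegative curvature makes [axial_source] dominate the
    Dirichlet density of u. Off-diagonal Ricci components drop out because the inverse metric is
    diagonal. *)
Lemma scalar_curvature_diag x z phi : 0 < x ->
  x * conf x z * scalar_curvature g (x, z, phi) =
  axial_source u al x z - 2 * x * (D1 u x z ^ 2 + D2 u x z ^ 2).
Proof.
  intros Hx.
  assert (Hc := exp_pos (2 * al x z - 2 * u x z)). fold (conf x z) in Hc.
  assert (Ht := exp_pos (- 2 * al x z)). fold (twist x z) in Ht.
  (* The closed form of the symbols holds on the open half-space x > 0, so it may be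
     differentiated. *)
  assert (E : forall l k i j, pd l (christoffel g k i j) (x, z, phi) =
    match l with i1 => D1 (diag_christoffel k i j) x z | i2 => D2 (diag_christoffel k i j) x z | i3 => 0 end).
  { intros l k i j. apply pd_planar; auto. intros; apply christoffel_diag; auto. }
  assert (Hoff : forall i j, i <> j -> ginv g i j (x, z, phi) = 0).
  { intros i j Hij. unfold ginv, cofactor. rewrite !Hg by auto.
    destruct i, j; try congruence; cbn [next diag_metric]; unfold Rdiv; ring. }
  assert (Hdiag : forall i, ginv g i i (x, z, phi) =
    match i with i3 => / (x * x * (conf x z * twist x z)) | _ => / conf x z end).
  { intros i. unfold ginv, det, sum3, cofactor. rewrite !Hg by auto.
    destruct i; cbn [next diag_metric coord fst snd]; field; lra. }
  assert (d211 : D2 (diag_christoffel i2 i1 i1) x z = D2 (D2 u) x z - D2 (D2 al) x z).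
  { apply is_derive_unique; cbn [diag_christoffel]; eapply is_derive_eq; [ der |]; ralg; ring. }
  assert (d212 : D1 (diag_christoffel i2 i1 i2) x z = D1 (D1 al) x z - D1 (D1 u) x z).
  { apply is_derive_unique; cbn [diag_christoffel]; eapply is_derive_eq; [ der |]; ralg; ring. }
  assert (d313 : D1 (diag_christoffel i3 i1 i3) x z = - / (x * x) - D1 (D1 u) x z).
  { apply is_derive_unique; cbn [diag_christoffel]; eapply is_derive_eq; [ der; lra |]; ralg.
    match goal with |- ?l = ?r => change (l = r :> R) end; field; lra. }
  assert (d122 : D1 (diag_christoffel i1 i2 i2) x z = D1 (D1 u) x z - D1 (D1 al) x z).
  { apply is_derive_unique; cbn [diag_christoffel]; eapply is_derive_eq; [ der |]; ralg; ring. }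
  assert (d121 : D2 (diag_christoffel i1 i2 i1) x z = D2 (D2 al) x z - D2 (D2 u) x z).
  { apply is_derive_unique; cbn [diag_christoffel]; eapply is_derive_eq; [ der |]; ralg; ring. }
  assert (d323 : D2 (diag_christoffel i3 i2 i3) x z = - D2 (D2 u) x z).
  { apply is_derive_unique; cbn [diag_christoffel]; eapply is_derive_eq; [ der |]; ralg; ring. }
  assert (d133 : D1 (diag_christoffel i1 i3 i3) x z =
    (2 * x * D1 u x z + x * x * D1 (D1 u) x z - 1 - 2 * D1 al x z * (x * x * D1 u x z - x)) * twist x z).
  { apply is_derive_unique; cbn [diag_christoffel]; unfold twist; eapply is_derive_eq; [ der |]; ralg; ring. }
  assert (d233 : D2 (diag_christoffel i2 i3 i3) x z =
    (x * x * D2 (D2 u) x z - 2 * D2 al x z * (x * x * D2 u x z)) * twist x z).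
  { apply is_derive_unique; cbn [diag_christoffel]; unfold twist; eapply is_derive_eq; [ der |]; ralg; ring. }
  unfold scalar_curvature, sum3.
  rewrite (Hoff i1 i2), (Hoff i1 i3), (Hoff i2 i1), (Hoff i2 i3), (Hoff i3 i1), (Hoff i3 i2), !Hdiag by discriminate.
  unfold ricci, sum3. rewrite !E. rewrite !christoffel_diag by auto. clear E.
  rewrite d211, d212, d313, d122, d121, d323, d133, d233.
  unfold axial_source. cbn [coord fst snd diag_christoffel].
  field. lra.
Qed.
End Curvature.

(** * Axisymmetric metrics in Cartesian coordinates *)

Lemma cont_pair {T U V : UniformSpace} (f : T -> U) (g : T -> V) x :
  continuous f x -> continuous g x -> continuous (fun t => (f t, g t)) x.
Proof.
  intros Hf Hg. apply (continuous_comp_2 f g (fun a b => (a, b))); auto.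
  apply (continuous_ext (fun p : U * V => p)); [ intros []; reflexivity | apply continuous_id ].
Qed.

Lemma pds_pd l i f : pds l (pd i f) = pds (l ++ i :: nil) f.
Proof. unfold pds; rewrite fold_right_app; reflexivity. Qed.

Lemma smooth_pd i f : smooth f -> smooth (pd i f).
Proof. intros H l p; rewrite pds_pd; apply H. Qed.

Lemma smooth_slice f n : smooth f -> Ck n (fun x z => f (x, 0, z)).
Proof.
  revert f; induction n as [|n IH]; intros f Hf.
  - split; auto. intros x z.
    apply (continuous_comp (fun p : R * R => (fst p, 0, snd p)) f).
    + apply cont_pair; [ apply cont_pair |]; cont.
    + exact (proj1 (Hf nil (x, 0, z))).
  - pose proof (IH f Hf) as H0. apply Ck_cont2 in H0.
    split; auto. split; [| split; [| split ] ].
    + intros x z. exact (proj2 (Hf nil (x, 0, z)) i1).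
    + intros x z. exact (proj2 (Hf nil (x, 0, z)) i3).
    + exact (IH _ (smooth_pd i1 f Hf)).
    + exact (IH _ (smooth_pd i3 f Hf)).
Qed.

Section Axisymmetric.
Context (G : axisym_metric).

Lemma ax_g_diag_pos i p : 0 < ax_g G i i p.
Proof.
  destruct (ax_riemannian G) as (_ & _ & H).
  specialize (H p (fun k => delta i k)).
  assert (X : 0 < quad (ax_g G) p (fun k => delta i k)).
  { apply H. exists i. destruct i; unfold delta; simpl; lra. }
  unfold quad, sum3, delta in X. destruct i; simpl in X; ring_simplify in X; lra.
Qed.

(* The coefficients u and alpha are only meaningful off the axis; these are their
   smooth extensions to the whole plane. *)
Definition ext_u (x z : R) : R := - / 2 * ln (ax_g G i2 i2 (x, 0, z)).
Definition ext_al (x z : R) : R :=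
  / 2 * (ln (ax_g G i3 i3 (x, 0, z)) + -1 * ln (ax_g G i2 i2 (x, 0, z))).

Lemma ext_u_Ck n : Ck (S n) ext_u.
Proof.
  apply Ck_mult; [ apply Ck_const |]. apply (Ck_ln n (fun x z => ax_g G i2 i2 (x, 0, z))).
  - intros; apply ax_g_diag_pos.
  - apply smooth_slice, (ax_riemannian G).
Qed.

Lemma ext_al_Ck n : Ck (S n) ext_al.
Proof.
  apply Ck_mult; [ apply Ck_const |].
  apply Ck_plus; [| apply Ck_mult; [ apply Ck_const |] ].
  - apply (Ck_ln n (fun x z => ax_g G i3 i3 (x, 0, z))).
    + intros; apply ax_g_diag_pos.
    + apply smooth_slice, (ax_riemannian G).
  - apply (Ck_ln n (fun x z => ax_g G i2 i2 (x, 0, z))).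
    + intros; apply ax_g_diag_pos.
    + apply smooth_slice, (ax_riemannian G).
Qed.

Context (HAB : forall rho z, 0 < rho -> ax_A G rho z = 0 /\ ax_B G rho z = 0).

(** P is the eigenvalue in the direction of rotation and Q the double eigenvalue of the meridian
    plane; (c, s) is the radial direction. *)
Definition cartesian (P Q c s : R) (i j : idx) : R :=
  match i, j with
  | i1, i1 => Q * (c * c) + P * (s * s)
  | i1, i2 | i2, i1 => (Q - P) * (c * s)
  | i2, i2 => Q * (s * s) + P * (c * c)
  | i3, i3 => Q
  | _, _ => 0
  end.

(** The pullback formula is a linear system for the six Cartesian components. It is inverted by
    rotating back by phi, after removing the powers of rho carried by the angular direction. *)
Lemma cartesian_components_ax rho z phi i j : 0 < rho ->
  ax_g G i j (cyl_pt rho z phi) =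
  cartesian (exp (-2 * ax_u G rho z)) (exp (2 * ax_al G rho z - 2 * ax_u G rho z))
    (cos phi) (sin phi) i j.
Proof.
  intros Hr.
  destruct (HAB rho z Hr) as [HA HB].
  assert (J : forall i k, pd i (fun q => coord k (cyl_pt (coord i1 q) (coord i2 q) (coord i3 q))) (rho, z, phi) =
    match i, k with
    | i1, i1 => cos phi | i1, i2 => sin phi
    | i2, i3 => 1
    | i3, i1 => - (rho * sin phi) | i3, i2 => rho * cos phi
    | _, _ => 0 end).
  { intros a b; apply is_derive_unique; destruct a, b; simpl; auto_derive; auto; ring. }
  assert (R := fun i j => ax_repr G rho z phi i j Hr).
  unfold pullback_cyl, sum3, cyl_metric in R.
  destruct (ax_riemannian G) as (_ & Hsym & _).
  set (P := exp (-2 * ax_u G rho z)) in *.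
  set (Q := exp (2 * ax_al G rho z - 2 * ax_u G rho z)) in *.
  cbv beta zeta in R.
  change (cyl_pt (coord i1 (rho, z, phi)) (coord i2 (rho, z, phi)) (coord i3 (rho, z, phi)))
    with (cyl_pt rho z phi) in R.
  change (coord i1 (rho, z, phi)) with rho in R. change (coord i2 (rho, z, phi)) with z in R.
  set (p := cyl_pt rho z phi) in *.
  assert (R11 := R i1 i1). assert (R12 := R i1 i2). assert (R13 := R i1 i3).
  assert (R22 := R i2 i2). assert (R23 := R i2 i3). assert (R33 := R i3 i3). clear R.
  rewrite !J, ?HA, ?HB in R11. rewrite !J, ?HA, ?HB in R12. rewrite !J, ?HA, ?HB in R13.
  rewrite !J, ?HA, ?HB in R22. rewrite !J, ?HA, ?HB in R23. rewrite !J, ?HA, ?HB in R33.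
  fold P Q in R11, R12, R13, R22, R23, R33.
  rewrite (Hsym i2 i1), (Hsym i3 i1), (Hsym i3 i2) in R11, R12, R13, R22, R23, R33.
  assert (Y := sin2_cos2 phi). unfold Rsqr in Y.
  set (c := cos phi) in *; set (s := sin phi) in *.
  set (g11 := ax_g G i1 i1 p) in *. set (g12 := ax_g G i1 i2 p) in *.
  set (g13 := ax_g G i1 i3 p) in *. set (g22 := ax_g G i2 i2 p) in *.
  set (g23 := ax_g G i2 i3 p) in *. set (g33 := ax_g G i3 i3 p) in *.
  assert (E11 : Q = g11 * (c * c) + 2 * g12 * (c * s) + g22 * (s * s)) by lra.
  assert (E13 : - g11 * (c * s) + g12 * (c * c - s * s) + g22 * (c * s) = 0).
  { apply Rmult_eq_reg_l with rho; [| lra ]. lra. }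
  assert (E33 : P = g11 * (s * s) - 2 * g12 * (c * s) + g22 * (c * c)).
  { apply Rmult_eq_reg_l with (rho * rho); [ lra | nra ]. }
  assert (E22 : g33 = Q) by lra.
  assert (E12 : g13 * c + g23 * s = 0) by lra.
  assert (E23 : - (g13 * s) + g23 * c = 0).
  { apply Rmult_eq_reg_l with rho; [| lra ]. lra. }
  assert (F11 : g11 = Q * (c * c) + P * (s * s)).
  (* The added multiple of the vanishing expression in [E13] completes the inverse rotation; what
     remains is a polynomial identity modulo s^2 + c^2 = 1. *)
  { transitivity (Q * (c * c) + P * (s * s) - 2 * (c * s) * (- g11 * (c * s) + g12 * (c * c - s * s) + g22 * (c * s))).
    - rewrite E11, E33. replace g11 with (g11 * ((s * s + c * c) * (s * s + c * c))) at 1 by (rewrite Y; ring). ring.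
    - rewrite E13; ring. }
  assert (F22 : g22 = Q * (s * s) + P * (c * c)).
  { transitivity (Q * (s * s) + P * (c * c) + 2 * (c * s) * (- g11 * (c * s) + g12 * (c * c - s * s) + g22 * (c * s))).
    - rewrite E11, E33. replace g22 with (g22 * ((s * s + c * c) * (s * s + c * c))) at 1 by (rewrite Y; ring). ring.
    - rewrite E13; ring. }
  assert (F12 : g12 = (Q - P) * (c * s)).
  { transitivity ((Q - P) * (c * s) + (c * c - s * s) * (- g11 * (c * s) + g12 * (c * c - s * s) + g22 * (c * s))).
    - rewrite E11, E33. replace g12 with (g12 * ((s * s + c * c) * (s * s + c * c))) at 1 by (rewrite Y; ring). ring.
    - rewrite E13; ring. }
  assert (F13 : g13 = 0).
  { replace g13 with (c * (g13 * c + g23 * s) - s * (- (g13 * s) + g23 * c)) by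
      (replace g13 with (g13 * (s * s + c * c)) at 3 by (rewrite Y; ring); ring).
    rewrite E12, E23; ring. }
  assert (F23 : g23 = 0).
  { transitivity (s * (g13 * c + g23 * s) + c * (- (g13 * s) + g23 * c)).
    - replace g23 with (g23 * (s * s + c * c)) at 1 by (rewrite Y; ring); ring.
    - rewrite E12, E23; ring. }
  destruct i, j; cbn [cartesian]; auto; rewrite Hsym; auto.
Qed.
End Axisymmetric.

Lemma continuous_eq_from_right (f h : R -> R) a :
  continuous f a -> continuous h a -> (forall t, a < t -> f t = h t) -> f a = h a.
Proof.
  intros Hf Hh Heq.
  apply NNPP; intros Hne.
  assert (Hd : continuous (fun t => f t - h t) a) by (apply cont_minus; auto).
  apply continuity_pt_filterlim in Hd.
  destruct (Hd (Rabs (f a - h a))) as (d & Hd0 & Hd1).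
  { apply Rabs_pos_lt; lra. }
  specialize (Hd1 (a + d / 2)).
  assert (X : Rabs (f (a + d / 2) - h (a + d / 2) - (f a - h a)) < Rabs (f a - h a)).
  { apply Hd1. split; [ split; [ exact I | lra ] |]. simpl; unfold R_dist.
    replace (a + d / 2 - a) with (d / 2) by ring. rewrite Rabs_pos_eq; lra. }
  rewrite (Heq (a + d / 2)) in X by lra.
  replace (h (a + d / 2) - h (a + d / 2) - (f a - h a)) with (- (f a - h a)) in X by ring.
  rewrite Rabs_Ropp in X; lra.
Qed.

Section Axisymmetric.
Context (G : axisym_metric).
Context (HAB : forall rho z, 0 < rho -> ax_A G rho z = 0 /\ ax_B G rho z = 0).

Lemma cyl_pt_0 x z : cyl_pt x z 0 = (x, 0, z).
Proof. unfold cyl_pt; rewrite cos_0, sin_0; f_equal; f_equal; ring. Qed.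

Lemma cyl_pt_quarter x z : cyl_pt x z (PI / 2) = (0, x, z).
Proof. unfold cyl_pt; rewrite cos_PI2, sin_PI2; f_equal; f_equal; ring. Qed.

(** On the half-plane phi = 0 the second Cartesian direction is angular and the third is meridional,
    so their diagonal components are e^(-2 u) and e^(2 al - 2 u). *)
Lemma ext_u_eq x z : 0 < x -> ext_u G x z = ax_u G x z.
Proof.
  intros Hx; unfold ext_u. rewrite <- cyl_pt_0, (cartesian_components_ax G HAB) by auto.
  cbn [cartesian]. rewrite sin_0, cos_0. rewrite !Rmult_0_r, Rplus_0_l, !Rmult_1_r, ln_exp. lra.
Qed.

Lemma ext_al_eq x z : 0 < x -> ext_al G x z = ax_al G x z.
Proof.
  intros Hx; unfold ext_al. rewrite <- cyl_pt_0, !(cartesian_components_ax G HAB) by auto.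
  cbn [cartesian]. rewrite sin_0, cos_0. rewrite !Rmult_0_r, Rplus_0_l, !Rmult_1_r, !ln_exp. lra.
Qed.

(** Smoothness across the axis forces this. Along phi = PI / 2 the second Cartesian direction is
    radial, so its component is the meridional factor e^(2 al - 2 u), as is the third component
    along phi = 0. Both approach the same point of the axis, so the two components agree there. *)
Lemma ext_al_axis z : ext_al G 0 z = 0.
Proof.
  unfold ext_al.
  assert (E : ax_g G i3 i3 (0, 0, z) = ax_g G i2 i2 (0, 0, z)).
  { destruct (ax_riemannian G) as (Hs & _).
    apply (continuous_eq_from_right (fun t => ax_g G i3 i3 (t, 0, z)) (fun t => ax_g G i2 i2 (0, t, z))).
    - apply (continuous_comp (fun t => (t, 0, z)) (ax_g G i3 i3)).
      + apply cont_pair; [ apply cont_pair |]; cont.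
      + exact (proj1 (Hs i3 i3 nil _)).
    - apply (continuous_comp (fun t => (0, t, z)) (ax_g G i2 i2)).
      + apply cont_pair; [ apply cont_pair |]; cont.
      + exact (proj1 (Hs i2 i2 nil _)).
    - intros t Ht. rewrite <- cyl_pt_0, <- cyl_pt_quarter, !(cartesian_components_ax G HAB) by auto.
      cbn [cartesian]. rewrite cos_PI2, sin_PI2; ring. }
  rewrite E; ring.
Qed.

Lemma cartesian_components rho z phi i j : 0 < rho ->
  ax_g G i j (cyl_pt rho z phi) =
  cartesian (exp (-2 * ext_u G rho z)) (conf (ext_u G) (ext_al G) rho z) (cos phi) (sin phi) i j.
Proof.
  intros Hr; rewrite (cartesian_components_ax G HAB) by auto.
  unfold conf. rewrite ext_u_eq, ext_al_eq by auto. reflexivity.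
Qed.

Lemma ax_cyl_diag i j p : 0 < coord i1 p ->
  ax_cyl G i j p = diag_metric (ext_u G) (ext_al G) i j (coord i1 p) (coord i2 p).
Proof.
  intros Hp. unfold ax_cyl, cyl_metric. cbv zeta.
  destruct (HAB (coord i1 p) (coord i2 p) Hp) as [HA HB]. rewrite HA, HB.
  rewrite <- ext_u_eq, <- ext_al_eq by auto.
  destruct i, j; unfold diag_metric, conf, twist; try ring.
  rewrite <- exp_plus. replace (2 * ext_al G (coord i1 p) (coord i2 p) -
    2 * ext_u G (coord i1 p) (coord i2 p) + -2 * ext_al G (coord i1 p) (coord i2 p))
    with (- 2 * ext_u G (coord i1 p) (coord i2 p)) by ring. ring.
Qed.

Lemma axial_source_ge : nonneg_scalar_curvature G ->
  forall x y, 0 < x ->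
  2 * x * (D1 (ext_u G) x y ^ 2 + D2 (ext_u G) x y ^ 2) <= axial_source (ext_u G) (ext_al G) x y.
Proof.
  intros Hs x y Hx.
  pose proof (scalar_curvature_diag _ _ (ext_u_Ck G 1) (ext_al_Ck G 1) (ax_cyl G) ax_cyl_diag x y 0 Hx) as E.
  specialize (Hs x y 0 Hx).
  assert (0 <= x * conf (ext_u G) (ext_al G) x y * scalar_curvature (ax_cyl G) (x, y, 0)).
  { apply Rmult_le_pos; auto. apply Rmult_le_pos; [ lra |]. apply Rlt_le, exp_pos. }
  lra.
Qed.

Definition ext_w (x z : R) : R := ext_al G x z + -2 * ext_u G x z.

Lemma ext_w_Ck n : Ck (S n) ext_w.
Proof.
  apply Ck_plus; [ apply ext_al_Ck |]. apply Ck_mult; [ apply Ck_const | apply ext_u_Ck ].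
Qed.

Lemma D_ext_w x z :
  D1 ext_w x z = D1 (ext_al G) x z - 2 * D1 (ext_u G) x z /\
  D2 ext_w x z = D2 (ext_al G) x z - 2 * D2 (ext_u G) x z.
Proof.
  split; apply is_derive_unique.
  - eapply is_derive_eq.
    + apply (is_derive_plus (V := R_NormedModule) (fun t => ext_al G t z)).
      * eapply Ck_is_derive1, (ext_al_Ck G 0).
      * apply (is_derive_scal (fun t => ext_u G t z)). eapply Ck_is_derive1, (ext_u_Ck G 0).
    + unfold plus; simpl. ring.
  - eapply is_derive_eq.
    + apply (is_derive_plus (V := R_NormedModule) (fun t => ext_al G x t)).
      * eapply Ck_is_derive2, (ext_al_Ck G 0).
      * apply (is_derive_scal (fun t => ext_u G x t)). eapply Ck_is_derive2, (ext_u_Ck G 0).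
    + unfold plus; simpl. ring.
Qed.

Lemma D_D_ext_w x z :
  D1 (D1 ext_w) x z = D1 (D1 (ext_al G)) x z - 2 * D1 (D1 (ext_u G)) x z /\
  D2 (D2 ext_w) x z = D2 (D2 (ext_al G)) x z - 2 * D2 (D2 (ext_u G)) x z.
Proof.
  assert (E1 : D1 ext_w = fun x z => D1 (ext_al G) x z - 2 * D1 (ext_u G) x z)
    by (extensionality a; extensionality b; apply D_ext_w).
  assert (E2 : D2 ext_w = fun x z => D2 (ext_al G) x z - 2 * D2 (ext_u G) x z)
    by (extensionality a; extensionality b; apply D_ext_w).
  rewrite E1, E2. split; apply is_derive_unique.
  - apply (is_derive_minus (V := R_NormedModule) (fun t => D1 (ext_al G) t z)).
    + eapply Ck_is_derive1, Ck_D1, (ext_al_Ck G 1).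
    + apply (is_derive_scal (fun t => D1 (ext_u G) t z)). eapply Ck_is_derive1, Ck_D1, (ext_u_Ck G 1).
  - apply (is_derive_minus (V := R_NormedModule) (fun t => D2 (ext_al G) x t)).
    + eapply Ck_is_derive2, Ck_D2, (ext_al_Ck G 1).
    + apply (is_derive_scal (fun t => D2 (ext_u G) x t)). eapply Ck_is_derive2, Ck_D2, (ext_u_Ck G 1).
Qed.

Lemma ext_w_supersolution : nonneg_scalar_curvature G ->
  forall x y, 0 < x ->
  D1 (D1 ext_w) x y + D2 (D2 ext_w) x y <= 2 * D1 (ext_u G) x y / x.
Proof.
  intros Hs x y Hx. pose proof (axial_source_ge Hs x y Hx) as H. unfold axial_source in H.
  destruct (D_D_ext_w x y) as [-> ->].
  assert (0 <= 2 * x * (D1 (ext_u G) x y ^ 2 + D2 (ext_u G) x y ^ 2)).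
  { apply Rmult_le_pos; [ lra |]. apply Rplus_le_le_0_compat; apply pow2_ge_0. }
  apply Rmult_le_reg_r with (2 * x); [ lra |].
  replace (2 * D1 (ext_u G) x y / x * (2 * x)) with (4 * D1 (ext_u G) x y) by (field; lra).
  lra.
Qed.

(** With |eta| = rho e^(-u) and |grad rho| = e^(u - al), the function in the monotonicity condition
    is e^w, whose radial derivative has the sign of that of w. *)
Lemma ext_w_monotone rho0 z : 0 < rho0 ->
  pd i1 (fun p => / coord i1 p * (norm_eta G p / norm_grad_rho G p)) (rho0, z, 0) <= 0 ->
  D1 ext_w rho0 z <= 0.
Proof.
  intros Hr H.
  rewrite (pd_planar _ _ (fun x z => exp (ext_w x z))) in H; auto.
  - assert (E : D1 (fun x z => exp (ext_w x z)) rho0 z = D1 ext_w rho0 z * exp (ext_w rho0 z)).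
    { apply is_derive_unique. apply (is_derive_comp exp (fun t => ext_w t z)).
      - apply is_derive_exp.
      - eapply Ck_is_derive1, (ext_w_Ck 0). }
    rewrite E in H. pose proof (exp_pos (ext_w rho0 z)).
    apply Rnot_lt_le; intros Hn. assert (0 < D1 ext_w rho0 z * exp (ext_w rho0 z)) by (apply Rmult_lt_0_compat; auto).
    lra.
  - clear - HAB. intros p Hp. unfold norm_eta, norm_grad_rho.
    set (x := coord i1 p) in *. set (z := coord i2 p).
    set (h := exp (ext_al G x z - ext_u G x z)). set (k := exp (- ext_u G x z)).
    assert (Hh : 0 < h) by apply exp_pos. assert (Hk : 0 < k) by apply exp_pos.
    assert (Eh : conf (ext_u G) (ext_al G) x z = h * h).
    { unfold conf, h. rewrite <- exp_plus. f_equal; ring. }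
    assert (Ek : conf (ext_u G) (ext_al G) x z * twist (ext_al G) x z = k * k).
    { unfold conf, twist, k. rewrite <- !exp_plus. f_equal; ring. }
    assert (E1 : ginv (ax_cyl G) i1 i1 p = (/ h) * / h).
    { unfold ginv, det, sum3, cofactor. rewrite !ax_cyl_diag by auto. fold x z.
      cbn [next diag_metric]. rewrite Ek, Eh. field; lra. }
    rewrite E1, ax_cyl_diag by auto. fold x z. cbn [diag_metric].
    rewrite Ek. rewrite sqrt_square by (left; apply Rinv_0_lt_compat; auto).
    replace (x * x * (k * k)) with ((x * k) * (x * k)) by ring.
    rewrite sqrt_square by (apply Rmult_le_pos; lra).
    replace (exp (ext_w x z)) with (h * k) by (unfold h, k, ext_w; rewrite <- exp_plus; f_equal; ring).
    field; lra.
Qed.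

Lemma ext_decay R0 C x z : decays R0 C (ax_u G) -> decays R0 C (ax_al G) ->
  0 < x -> R0 <= sqrt (x ^ 2 + z ^ 2) ->
  let r := sqrt (x ^ 2 + z ^ 2) in
  (Rabs (ext_u G x z) <= C / r /\ Rabs (ext_al G x z) <= C / r) /\
  (Rabs (D1 (ext_u G) x z) <= C / r ^ 2 /\ Rabs (D2 (ext_u G) x z) <= C / r ^ 2) /\
  (Rabs (D1 (ext_al G) x z) <= C / r ^ 2 /\ Rabs (D2 (ext_al G) x z) <= C / r ^ 2).
Proof.
  intros Hu Ha Hx Hr r.
  assert (L : forall f e, (forall x z, 0 < x -> e x z = f x z) ->
    D1 e x z = partial2 1 0 f x z /\ D2 e x z = partial2 0 1 f x z /\ e x z = partial2 0 0 f x z).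
  { intros f e He; repeat split; unfold partial2; simpl; auto.
    - apply Derive_ext_loc. exists (mkposreal x Hx). intros t Ht. apply He.
      apply Rabs_def2 in Ht; simpl in Ht; unfold minus, plus, opp in Ht; simpl in Ht; lra.
    - apply Derive_ext; intros t; auto. }
  destruct (L (ax_u G) (ext_u G) ext_u_eq) as (-> & -> & ->).
  destruct (L (ax_al G) (ext_al G) ext_al_eq) as (-> & -> & ->).
  assert (K : forall a b f, decays R0 C f -> (a + b <= 2)%nat ->
     Rabs (partial2 a b f x z) <= C / r ^ (1 + (a + b))) by (intros; auto).
  repeat split.
  - pose proof (K 0%nat 0%nat _ Hu ltac:(lia)) as Y; simpl in Y. rewrite Rmult_1_r in Y; auto.
  - pose proof (K 0%nat 0%nat _ Ha ltac:(lia)) as Y; simpl in Y. rewrite Rmult_1_r in Y; auto.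
  - apply (K 1%nat 0%nat _ Hu); lia.
  - apply (K 0%nat 1%nat _ Hu); lia.
  - apply (K 1%nat 0%nat _ Ha); lia.
  - apply (K 0%nat 1%nat _ Ha); lia.
Qed.
End Axisymmetric.

(** * The ADM flux *)

Lemma polar_angle x y : 0 < x * x + y * y ->
  exists phi, x = sqrt (x * x + y * y) * cos phi /\ y = sqrt (x * x + y * y) * sin phi.
Proof.
  intros H. set (r := sqrt (x * x + y * y)).
  assert (Hr : 0 < r) by (apply sqrt_lt_R0; auto).
  assert (Er : r * r = x * x + y * y) by (apply sqrt_sqrt; lra).
  assert (Hb : -1 <= x / r <= 1).
  { split; apply Rmult_le_reg_r with r; auto; unfold Rdiv; rewrite Rmult_assoc, Rinv_l by lra; nra. }
  assert (Hs : sin (acos (x / r)) = Rabs (y / r)).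
  { rewrite sin_acos by auto. rewrite <- sqrt_Rsqr_abs. f_equal.
    unfold Rsqr. apply Rmult_eq_reg_r with (r * r); [| nra ].
    replace ((1 - x / r * (x / r)) * (r * r)) with (r * r - x * x) by (field; lra).
    replace (y / r * (y / r) * (r * r)) with (y * y) by (field; lra). lra. }
  destruct (Rle_dec 0 y).
  - exists (acos (x / r)). rewrite Hs, cos_acos by auto. rewrite Rabs_pos_eq by (apply Rdiv_le_0_compat; auto).
    split; field; lra.
  - exists (- acos (x / r)). rewrite sin_neg, cos_neg, Hs, cos_acos by auto.
    rewrite Rabs_left.
    + split; field; lra.
    + unfold Rdiv. assert (0 < / r) by (apply Rinv_0_lt_compat; auto). nra.
Qed.

(* Coefficients of Q and of P in the Cartesian components. *)
Definition weight_Q (i j : idx) (x y : R) : R :=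
  match i, j with
  | i1, i1 => x * x / (x * x + y * y)
  | i1, i2 | i2, i1 => x * y / (x * x + y * y)
  | i2, i2 => y * y / (x * x + y * y)
  | i3, i3 => 1
  | _, _ => 0
  end.

Definition weight_P (i j : idx) (x y : R) : R :=
  match i, j with
  | i1, i1 => y * y / (x * x + y * y)
  | i1, i2 | i2, i1 => - (x * y / (x * x + y * y))
  | i2, i2 => x * x / (x * x + y * y)
  | _, _ => 0
  end.

Definition weight_Q_d (l i j : idx) (rho c s : R) : R :=
  match l, i, j with
  | i1, i1, i1 => 2 * c * s * s / rho
  | i1, i1, i2 | i1, i2, i1 => s * (s * s - c * c) / rho
  | i1, i2, i2 => - (2 * c * s * s) / rho
  | i2, i1, i1 => - (2 * s * c * c) / rho
  | i2, i1, i2 | i2, i2, i1 => c * (c * c - s * s) / rho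
  | i2, i2, i2 => 2 * s * c * c / rho
  | _, _, _ => 0
  end.

Definition weight_P_d (l i j : idx) (rho c s : R) : R :=
  match l, i, j with
  | i1, i1, i1 => - (2 * c * s * s) / rho
  | i1, i1, i2 | i1, i2, i1 => - (s * (s * s - c * c)) / rho
  | i1, i2, i2 => 2 * c * s * s / rho
  | i2, i1, i1 => 2 * s * c * c / rho
  | i2, i1, i2 | i2, i2, i1 => - (c * (c * c - s * s)) / rho
  | i2, i2, i2 => - (2 * s * c * c) / rho
  | _, _, _ => 0
  end.

(** Once 1 / rho is an unknown [ir] with rho ir = 1, each derivative formula is a polynomial
    identity modulo c^2 + s^2 = 1. *)
Ltac weight_derivative i j rho c s :=
  intros Hr Hcs;
  assert (Hh : rho * c * (rho * c) + rho * s * (rho * s) = rho * rho)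
    by (rewrite <- (Rmult_1_r (rho * rho)), <- Hcs; ring);
  assert (Hrr : 0 < rho * rho) by nra;
  destruct i, j; unfold weight_Q, weight_Q_d, weight_P, weight_P_d; auto_derive;
    rewrite ?Hh; auto; try lra;
    unfold Rdiv; rewrite ?Rinv_mult;
    assert (Hi : rho * / rho = 1) by (field; lra);
    set (ir := / rho) in *; clearbody ir; clear Hrr Hh Hr; nsatz.

Lemma weight_Q_derive1 i j rho c s : 0 < rho -> c * c + s * s = 1 ->
  is_derive (fun t => weight_Q i j t (rho * s)) (rho * c) (weight_Q_d i1 i j rho c s).
Proof.
  weight_derivative i j rho c s.
Qed.

Lemma weight_Q_derive2 i j rho c s : 0 < rho -> c * c + s * s = 1 ->
  is_derive (fun t => weight_Q i j (rho * c) t) (rho * s) (weight_Q_d i2 i j rho c s).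
Proof.
  weight_derivative i j rho c s.
Qed.

Lemma weight_P_derive1 i j rho c s : 0 < rho -> c * c + s * s = 1 ->
  is_derive (fun t => weight_P i j t (rho * s)) (rho * c) (weight_P_d i1 i j rho c s).
Proof.
  weight_derivative i j rho c s.
Qed.

Lemma weight_P_derive2 i j rho c s : 0 < rho -> c * c + s * s = 1 ->
  is_derive (fun t => weight_P i j (rho * c) t) (rho * s) (weight_P_d i2 i j rho c s).
Proof.
  weight_derivative i j rho c s.
Qed.

Lemma weight_values i j rho c s : 0 < rho -> c * c + s * s = 1 ->
  weight_Q i j (rho * c) (rho * s) = cartesian 0 1 c s i j /\
  weight_P i j (rho * c) (rho * s) = cartesian 1 0 c s i j.
Proof.
  intros Hr Hcs.
  assert (Hh : rho * c * (rho * c) + rho * s * (rho * s) = rho * rho)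
    by (rewrite <- (Rmult_1_r (rho * rho)), <- Hcs; ring).
  destruct i, j; unfold weight_Q, weight_P, cartesian; rewrite ?Hh; split; field; lra.
Qed.

Lemma radius_derive rho c s : 0 < rho -> c * c + s * s = 1 ->
  is_derive (fun t => sqrt (t * t + rho * s * (rho * s))) (rho * c) c.
Proof.
  intros Hr Hcs.
  assert (Hh : rho * c * (rho * c) + rho * s * (rho * s) = rho * rho)
    by (rewrite <- (Rmult_1_r (rho * rho)), <- Hcs; ring).
  replace c with ((2 * (rho * c)) / (2 * sqrt (rho * c * (rho * c) + rho * s * (rho * s)))) at 2.
  - apply (is_derive_sqrt (fun t => t * t + rho * s * (rho * s))).
    + auto_derive; auto; ring.
    + nra.
  - rewrite Hh, sqrt_square by lra. field; lra.
Qed.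

Lemma is_derive_two_products (m a n b : R -> R) t dm da dn db :
  is_derive m t dm -> is_derive a t da -> is_derive n t dn -> is_derive b t db ->
  is_derive (fun t => m t * a t + n t * b t) t (dm * a t + m t * da + (dn * b t + n t * db)).
Proof.
  intros; apply (is_derive_plus (V := R_NormedModule) (fun t => m t * a t) (fun t => n t * b t));
    apply (is_derive_mult (K := R_AbsRing)); auto; exact Rmult_comm.
Qed.

Section CartesianDerivatives.
Context (P Q : R -> R -> R) (HP : Ck 1 P) (HQ : Ck 1 Q).

(** The components of [cartesian] rewritten as functions of x, y and z, with no angle, so that they
    can be differentiated off the axis. *)
Definition cartesian_field (i j : idx) (p : pt) : R :=
  let x := coord i1 p in let y := coord i2 p in
  weight_Q i j x y * Q (sqrt (x * x + y * y)) (coord i3 p)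
  + weight_P i j x y * P (sqrt (x * x + y * y)) (coord i3 p).

Definition frame_derivative (F : R -> R -> R) (l : idx) (rho z c s : R) : R :=
  match l with i1 => D1 F rho z * c | i2 => D1 F rho z * s | i3 => D2 F rho z end.

Lemma pd_cartesian_field f l i j rho z phi :
  (forall p, 0 < coord i1 p * coord i1 p + coord i2 p * coord i2 p -> f p = cartesian_field i j p) ->
  0 < rho ->
  let c := cos phi in let s := sin phi in
  pd l f (cyl_pt rho z phi) =
    weight_Q_d l i j rho c s * Q rho z + cartesian 0 1 c s i j * frame_derivative Q l rho z c s
    + (weight_P_d l i j rho c s * P rho z + cartesian 1 0 c s i j * frame_derivative P l rho z c s).
Proof.
  intros Hf Hr c s.
  assert (Hcs : c * c + s * s = 1).
  { pose proof (sin2_cos2 phi) as Y; unfold Rsqr in Y; unfold c, s; lra. }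
  assert (Hh : rho * c * (rho * c) + rho * s * (rho * s) = rho * rho)
    by (rewrite <- (Rmult_1_r (rho * rho)), <- Hcs; ring).
  assert (Hrr : 0 < rho * rho) by nra.
  destruct (weight_values i j rho c s Hr Hcs) as [<- <-].
  assert (Hs : sqrt (rho * c * (rho * c) + rho * s * (rho * s)) = rho)
    by (rewrite Hh; apply sqrt_square; lra).
  assert (Hloc : forall t0 k, t0 * t0 + k * k = rho * rho ->
     locally t0 (fun t => 0 < t * t + k * k)).
  { intros t0 k E.
    assert (Hc : continuous (fun t => t * t + k * k) t0) by cont.
    apply (Hc (fun y => 0 < y)). rewrite E.
    exists (mkposreal _ Hrr). intros y Hy. apply Rabs_def2 in Hy.
    unfold minus, plus, opp in Hy; simpl in Hy; lra. }
  apply is_derive_unique.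
  destruct l; unfold cyl_pt; cbn [coord upd fst snd frame_derivative]; fold c s.
  - apply (is_derive_ext_loc (fun t => cartesian_field i j (t, rho * s, z))).
    + apply (filter_imp (fun t => 0 < t * t + rho * s * (rho * s))); [| apply Hloc; auto ].
      intros t Ht; symmetry; apply Hf; auto.
    + unfold cartesian_field; cbn [coord fst snd].
      eapply is_derive_eq.
      * apply (is_derive_two_products (fun t => weight_Q i j t (rho * s))
          (fun t => Q (sqrt (t * t + rho * s * (rho * s))) z) (fun t => weight_P i j t (rho * s))
          (fun t => P (sqrt (t * t + rho * s * (rho * s))) z)).
        -- apply weight_Q_derive1; auto.
        -- apply (is_derive_comp (fun x => Q x z) (fun t => sqrt (t * t + rho * s * (rho * s))));
             [ rewrite Hs; eapply Ck_is_derive1; eauto | apply radius_derive; auto ].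
        -- apply weight_P_derive1; auto.
        -- apply (is_derive_comp (fun x => P x z) (fun t => sqrt (t * t + rho * s * (rho * s))));
             [ rewrite Hs; eapply Ck_is_derive1; eauto | apply radius_derive; auto ].
      * cbv beta. rewrite Hs. unfold scal; simpl. unfold mult; simpl. ring.
  - apply (is_derive_ext_loc (fun t => cartesian_field i j (rho * c, t, z))).
    + apply (filter_imp (fun t => 0 < t * t + rho * c * (rho * c))); [| apply Hloc; lra ].
      intros t Ht; symmetry; apply Hf; cbn [coord fst snd]; lra.
    + assert (Hsw : forall t, rho * c * (rho * c) + t * t = t * t + rho * c * (rho * c)) by (intros; ring).
      unfold cartesian_field; cbn [coord fst snd].
      assert (Hrd : is_derive (fun t => sqrt (rho * c * (rho * c) + t * t)) (rho * s) s).
      { apply (is_derive_ext (fun t => sqrt (t * t + rho * c * (rho * c)))).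
        - intros; f_equal; ring.
        - apply radius_derive; auto; lra. }
      eapply is_derive_eq.
      * apply (is_derive_two_products (fun t => weight_Q i j (rho * c) t)
          (fun t => Q (sqrt (rho * c * (rho * c) + t * t)) z) (fun t => weight_P i j (rho * c) t)
          (fun t => P (sqrt (rho * c * (rho * c) + t * t)) z)).
        -- apply weight_Q_derive2; auto.
        -- apply (is_derive_comp (fun x => Q x z) (fun t => sqrt (rho * c * (rho * c) + t * t)));
             [ rewrite Hs; eapply Ck_is_derive1; eauto | exact Hrd ].
        -- apply weight_P_derive2; auto.
        -- apply (is_derive_comp (fun x => P x z) (fun t => sqrt (rho * c * (rho * c) + t * t)));
             [ rewrite Hs; eapply Ck_is_derive1; eauto | exact Hrd ].
      * cbv beta. rewrite Hs. unfold scal; simpl. unfold mult; simpl. ring.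
  - apply (is_derive_ext (fun t => cartesian_field i j (rho * c, rho * s, t))).
    + intros t; symmetry; apply Hf; cbn [coord fst snd]; lra.
    + unfold cartesian_field; cbn [coord fst snd]. rewrite Hs.
      eapply is_derive_eq.
      * apply (is_derive_plus (V := R_NormedModule)
          (fun t => weight_Q i j (rho * c) (rho * s) * Q rho t));
        apply is_derive_scal; eapply Ck_is_derive2; eauto.
      * assert (weight_Q_d i3 i j rho c s = 0 /\ weight_P_d i3 i j rho c s = 0) as [-> ->]
          by (destruct i, j; split; reflexivity).
        unfold plus; simpl. ring.
Qed.

(** The first two components of the integrand vector are cos phi and sin phi times the same factor,
    so phi disappears after contraction with the normal. The term (Q - P) / x comes from the turning
    of the frame; the factor sin th of the normal turns it into (Q - P) / r. *)
Lemma flux_integrand (f : tensor2) r th phi :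
  (forall i j p, 0 < coord i1 p * coord i1 p + coord i2 p * coord i2 p -> f i j p = cartesian_field i j p) ->
  0 < r -> 0 < sin th ->
  let p := sphere_pt r th phi in let x := r * sin th in let y := r * cos th in
  sum3 (fun i => sum3 (fun j => pd j (f i j) p - pd i (f j j) p) * (coord i p / r)) * (r ^ 2 * sin th)
  = (- ((D1 P x y + D1 Q x y) * sin th + (D2 P x y + D2 Q x y) * cos th) + (Q x y - P x y) / r)
    * (r ^ 2 * sin th).
Proof.
  intros Hf Hr Hs p x y. f_equal.
  assert (Hx : 0 < x) by (apply Rmult_lt_0_compat; auto).
  (* The point [sphere_pt r th phi] is convertible with [cyl_pt x y phi]. *)
  assert (E : forall l i j, pd l (f i j) p = _) by
    (intros l i j; exact (pd_cartesian_field (f i j) l i j x y phi (Hf i j) Hx)).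
  pose proof (sin2_cos2 phi) as Y; unfold Rsqr in Y.
  assert (V : forall i, sum3 (fun j => pd j (f i j) p - pd i (f j j) p) =
    match i with
    | i1 => cos phi * (- (D1 P x y + D1 Q x y) + (Q x y - P x y) * / x)
    | i2 => sin phi * (- (D1 P x y + D1 Q x y) + (Q x y - P x y) * / x)
    | i3 => - (D2 P x y + D2 Q x y)
    end).
  { intros i; unfold sum3. rewrite !E. cbv zeta. clear E.
    set (c := cos phi) in *; set (s := sin phi) in *.
    set (q := Q x y); set (q1 := D1 Q x y); set (q2 := D2 Q x y).
    set (p0 := P x y); set (p1 := D1 P x y); set (p2 := D2 P x y).
    destruct i; cbn [frame_derivative weight_Q_d weight_P_d cartesian]; fold q1 q2 p1 p2;
      unfold Rdiv; set (ix := / x); clearbody q q1 q2 p0 p1 p2 ix c s; clear - Y; nsatz. }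
  unfold sum3 at 1. rewrite !V.
  unfold p, sphere_pt; cbn [coord fst snd].
  replace (r * sin th * cos phi / r) with (sin th * cos phi) by (field; lra).
  replace (r * sin th * sin phi / r) with (sin th * sin phi) by (field; lra).
  replace (r * cos th / r) with (cos th) by (field; lra).
  replace ((Q x y - P x y) / r) with ((Q x y - P x y) * / x * sin th) by (unfold x; field; lra).
  set (k := - (D1 P x y + D1 Q x y) + (Q x y - P x y) * / x).
  transitivity (sin th * k * (sin phi * sin phi + cos phi * cos phi) - (D2 P x y + D2 Q x y) * cos th); [ ring |].
  rewrite Y. unfold k; ring.
Qed.
End CartesianDerivatives.

Lemma Ck_exp n f : Ck n f -> Ck n (fun x y => exp (f x y)).
Proof.
  revert f; induction n as [|n IH]; intros f Hf.
  - destruct Hf as [Hf _]; split; auto; cont.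
  - pose proof (Ck_cont2 _ _ Hf).
    apply Ck_intro with (fun x y => D1 f x y * exp (f x y)) (fun x y => D2 f x y * exp (f x y)).
    + cont.
    + intros; apply (is_derive_comp exp (fun t => f t y)); [ apply is_derive_exp | eapply Ck_is_derive1; eauto ].
    + intros; apply (is_derive_comp exp (fun t => f x t)); [ apply is_derive_exp | eapply Ck_is_derive2; eauto ].
    + apply Ck_mult; auto using Ck_D1, Ck_pred.
    + apply Ck_mult; auto using Ck_D2, Ck_pred.
Qed.

Lemma exp_second_order t : Rabs t <= / 2 -> 0 <= exp t - 1 - t <= 2 * t ^ 2.
Proof.
  intros Ht; apply Rabs_le_between in Ht. pose proof (exp_ineq1_le t). split; [ lra |].
  assert (exp t <= / (1 - t)) by (apply exp_bound_inv; lra).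
  assert (/ (1 - t) <= 1 + t + 2 * t ^ 2); [| lra ].
  apply Rmult_le_reg_r with (1 - t); [ lra |]. rewrite Rinv_l by lra.
  assert (0 <= t ^ 2 * (1 - 2 * t)) by (apply Rmult_le_pos; [ apply pow2_ge_0 | lra ]). nra.
Qed.

Lemma exp_first_order t e : Rabs t <= e -> e <= / 2 -> Rabs (exp t - 1) <= 2 * e.
Proof.
  intros Ht He. pose proof (exp_second_order t ltac:(lra)) as H.
  rewrite <- (pow2_abs t) in H. pose proof (Rabs_pos t).
  assert (2 * Rabs t ^ 2 <= Rabs t) by nra.
  pose proof (Rle_abs t). pose proof (Rle_abs (- t)). rewrite Rabs_Ropp in *.
  apply Rabs_le; lra.
Qed.

Lemma Rabs_mult_le a b x y : Rabs a <= x -> Rabs b <= y -> Rabs (a * b) <= x * y.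
Proof. intros; rewrite Rabs_mult; apply Rmult_le_compat; auto using Rabs_pos. Qed.

Lemma Rabs_plus_le a b x y : Rabs a <= x -> Rabs b <= y -> Rabs (a + b) <= x + y.
Proof. intros; eapply Rle_trans; [ apply Rabs_triang |]; lra. Qed.

(* The flux density is linear in u and alpha up to terms of order C^2 / r. *)
Lemma flux_linearization r s c u a u1 u2 a1 a2 e :
  0 < r -> Rabs s <= 1 -> Rabs c <= 1 -> e <= / 8 ->
  Rabs u <= e -> Rabs a <= e -> Rabs u1 <= e / r -> Rabs u2 <= e / r ->
  Rabs a1 <= e / r -> Rabs a2 <= e / r ->
  let p := exp (- 2 * u) in let q := exp (2 * a - 2 * u) in
  Rabs ((- ((- 2 * u1 * p + (2 * a1 - 2 * u1) * q) * s + (- 2 * u2 * p + (2 * a2 - 2 * u2) * q) * c)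
         + (q - p) / r) * (r ^ 2 * s)
        - (4 * (r ^ 2 * s) * (u1 * s + u2 * c) - 2 * (r ^ 2 * s) * (a1 * s + a2 * c) + 2 * r * s * a))
  <= 200 * e ^ 2 * r.
Proof.
  intros Hr Hs Hc He Hu Ha Hu1 Hu2 Ha1 Ha2 p q.
  assert (He0 : 0 <= e) by (pose proof (Rabs_pos u); lra).
  assert (T1 : Rabs (- 2 * u) <= 2 * e).
  { apply Rabs_mult_le; auto. rewrite Rabs_left; lra. }
  assert (T2 : Rabs (2 * a - 2 * u) <= 4 * e).
  { replace (4 * e) with (2 * e + 2 * e) by ring. replace (2 * a - 2 * u) with (2 * a + - 2 * u) by ring.
    apply Rabs_plus_le; auto. apply Rabs_mult_le; auto. rewrite Rabs_pos_eq; lra. }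
  assert (Pp : Rabs (p - 1) <= 4 * e).
  { replace (4 * e) with (2 * (2 * e)) by ring. apply exp_first_order; auto; lra. }
  assert (Pq : Rabs (q - 1) <= 8 * e).
  { replace (8 * e) with (2 * (4 * e)) by ring. apply exp_first_order; auto; lra. }
  assert (Sp : Rabs (p - 1 + 2 * u) <= 2 * (2 * e) ^ 2).
  { pose proof (exp_second_order (- 2 * u) ltac:(lra)) as H. fold p in H.
    rewrite <- (pow2_abs (- 2 * u)) in H.
    assert (Rabs (- 2 * u) ^ 2 <= (2 * e) ^ 2) by (apply pow_incr; split; auto; apply Rabs_pos).
    rewrite Rabs_pos_eq; lra. }
  assert (Sq : Rabs (q - 1 - (2 * a - 2 * u)) <= 2 * (4 * e) ^ 2).
  { pose proof (exp_second_order (2 * a - 2 * u) ltac:(lra)) as H. fold q in H.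
    rewrite <- (pow2_abs (2 * a - 2 * u)) in H.
    assert (Rabs (2 * a - 2 * u) ^ 2 <= (4 * e) ^ 2) by (apply pow_incr; split; auto; apply Rabs_pos).
    rewrite Rabs_pos_eq; lra. }
  assert (HU : Rabs (u1 * s + u2 * c) <= e / r * 1 + e / r * 1).
  { apply Rabs_plus_le; apply Rabs_mult_le; auto. }
  assert (HA : Rabs (a1 * s + a2 * c) <= e / r * 1 + e / r * 1).
  { apply Rabs_plus_le; apply Rabs_mult_le; auto. }
  set (U := u1 * s + u2 * c) in *. set (A := a1 * s + a2 * c) in *.
  (* Once the linear part is removed, only products of two small factors and the second-order
     remainders of the two exponentials are left. They add up to at most 120 e^2 r. *)
  replace (_ - _) with ((r ^ 2 * s) * (2 * (U * (p - 1)) + - 2 * ((A + - 1 * U) * (q - 1))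
     + / r * ((q - 1 - (2 * a - 2 * u)) + - 1 * (p - 1 + 2 * u)))) by (unfold U, A; field; lra).
  assert (Hir : 0 < / r) by (apply Rinv_0_lt_compat; auto).
  assert (M1 : Rabs (- 1) = 1) by (rewrite Rabs_left; lra).
  assert (M2 : Rabs 2 = 2) by (apply Rabs_pos_eq; lra).
  assert (M3 : Rabs (- 2) = 2) by (rewrite Rabs_left; lra).
  assert (B : Rabs (2 * (U * (p - 1)) + - 2 * ((A + - 1 * U) * (q - 1))
     + / r * ((q - 1 - (2 * a - 2 * u)) + - 1 * (p - 1 + 2 * u)))
    <= (2 * ((e / r * 1 + e / r * 1) * (4 * e))
       + 2 * (((e / r * 1 + e / r * 1) + 1 * (e / r * 1 + e / r * 1)) * (8 * e)))
       + / r * (2 * (4 * e) ^ 2 + 1 * (2 * (2 * e) ^ 2))).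
  { apply Rabs_plus_le; [ apply Rabs_plus_le |].
    - apply Rabs_mult_le; [ lra |]. apply Rabs_mult_le; auto.
    - apply Rabs_mult_le; [ lra |]. apply Rabs_mult_le; auto.
      apply Rabs_plus_le; auto. apply Rabs_mult_le; auto; lra.
    - apply Rabs_mult_le; [ rewrite Rabs_pos_eq; lra |].
      apply Rabs_plus_le; auto. apply Rabs_mult_le; auto; lra. }
  apply Rle_trans with ((r ^ 2 * 1) * (2 * ((e / r * 1 + e / r * 1) * (4 * e))
       + 2 * (((e / r * 1 + e / r * 1) + 1 * (e / r * 1 + e / r * 1)) * (8 * e))
       + / r * (2 * (4 * e) ^ 2 + 1 * (2 * (2 * e) ^ 2)))).
  - apply Rabs_mult_le; auto. apply Rabs_mult_le; auto.
    rewrite Rabs_pos_eq; [ lra | apply pow2_ge_0 ].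
  - replace (r ^ 2 * 1 * _) with (120 * e ^ 2 * r) by (field; lra).
    assert (0 <= e ^ 2 * r) by (apply Rmult_le_pos; [ apply pow2_ge_0 | lra ]). lra.
Qed.

Section Flux.
Context (G : axisym_metric).
Context (HAB : forall rho z, 0 < rho -> ax_A G rho z = 0 /\ ax_B G rho z = 0).

Let P x z := exp (- 2 * ext_u G x z).
Let Q := conf (ext_u G) (ext_al G).

Lemma ax_g_cartesian_field i j p : 0 < coord i1 p * coord i1 p + coord i2 p * coord i2 p ->
  ax_g G i j p = cartesian_field P Q i j p.
Proof.
  destruct p as [[x y] z]; cbn [coord fst snd]; intros H.
  destruct (polar_angle x y H) as (phi & Hx & Hy).
  set (rho := sqrt (x * x + y * y)) in *.
  assert (Hr : 0 < rho) by (apply sqrt_lt_R0; auto).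
  replace (ax_g G i j (x, y, z)) with (ax_g G i j (cyl_pt rho z phi))
    by (unfold cyl_pt; rewrite <- Hx, <- Hy; reflexivity).
  rewrite (cartesian_components G HAB) by auto.
  unfold cartesian_field; cbn [coord fst snd]. fold rho.
  assert (Hcs : cos phi * cos phi + sin phi * sin phi = 1).
  { pose proof (sin2_cos2 phi) as Y; unfold Rsqr in Y; lra. }
  destruct (weight_values i j rho (cos phi) (sin phi) Hr Hcs) as [E1 E2].
  rewrite <- Hx, <- Hy in E1, E2. rewrite E1, E2. unfold P, Q.
  destruct i, j; unfold cartesian; ring.
Qed.

Definition flux_density (r th : R) : R :=
  let x := r * sin th in let y := r * cos th in
  (- ((D1 P x y + D1 Q x y) * sin th + (D2 P x y + D2 Q x y) * cos th) + (Q x y - P x y) / r)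
  * (r ^ 2 * sin th).

Lemma Ck_P : Ck 1 P.
Proof. apply Ck_exp. apply Ck_mult; [ apply Ck_const | apply ext_u_Ck ]. Qed.

Lemma Ck_Q : Ck 1 Q.
Proof.
  apply Ck_exp.
  replace (fun x y => 2 * ext_al G x y - 2 * ext_u G x y)
    with (fun x y => 2 * ext_al G x y + -2 * ext_u G x y)
    by (extensionality x; extensionality y; ring).
  apply Ck_plus; (apply Ck_mult; [ apply Ck_const |]); [ apply ext_al_Ck | apply ext_u_Ck ].
Qed.

Lemma adm_flux_axisymmetric r : 0 < r ->
  adm_flux (ax_g G) r = / 8 * RInt (fun th => flux_density r th) 0 PI.
Proof.
  intros Hr. unfold adm_flux. cbv zeta.
  rewrite (RInt_ext _ (fun _ => RInt (fun th => flux_density r th) 0 PI)).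
  - rewrite RInt_const_R. field. pose proof PI_RGT_0; lra.
  - intros phi _. apply RInt_ext. pose proof PI_RGT_0.
    rewrite Rmin_left, Rmax_right by lra. intros th Hth.
    apply (flux_integrand P Q Ck_P Ck_Q (ax_g G) r th phi); auto.
    + intros; apply ax_g_cartesian_field; auto.
    + apply sin_gt_0; lra.
Qed.

Lemma D_P x y : D1 P x y = - 2 * D1 (ext_u G) x y * P x y /\ D2 P x y = - 2 * D2 (ext_u G) x y * P x y.
Proof.
  split; apply is_derive_unique.
  - apply (is_derive_comp exp (fun t => - 2 * ext_u G t y)); [ apply is_derive_exp |].
    apply is_derive_scal. eapply Ck_is_derive1, (ext_u_Ck G 0).
  - apply (is_derive_comp exp (fun t => - 2 * ext_u G x t)); [ apply is_derive_exp |].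
    apply is_derive_scal. eapply Ck_is_derive2, (ext_u_Ck G 0).
Qed.

Lemma D_Q x y :
  D1 Q x y = (2 * D1 (ext_al G) x y - 2 * D1 (ext_u G) x y) * Q x y /\
  D2 Q x y = (2 * D2 (ext_al G) x y - 2 * D2 (ext_u G) x y) * Q x y.
Proof.
  split; apply is_derive_unique.
  - apply (is_derive_comp exp (fun t => 2 * ext_al G t y - 2 * ext_u G t y)); [ apply is_derive_exp |].
    apply (is_derive_minus (V := R_NormedModule) (fun t => 2 * ext_al G t y) (fun t => 2 * ext_u G t y));
      apply is_derive_scal; eapply Ck_is_derive1; [ apply (ext_al_Ck G 0) | apply (ext_u_Ck G 0) ].
  - apply (is_derive_comp exp (fun t => 2 * ext_al G x t - 2 * ext_u G x t)); [ apply is_derive_exp |].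
    apply (is_derive_minus (V := R_NormedModule) (fun t => 2 * ext_al G x t) (fun t => 2 * ext_u G x t));
      apply is_derive_scal; eapply Ck_is_derive2; [ apply (ext_al_Ck G 0) | apply (ext_u_Ck G 0) ].
Qed.

(** This is [flux_linearization] with e = C / r, integrated over th; the condition 8 C <= r is e <=
    1/8. The factor 8 is 16 PI / (2 PI). *)
Lemma flux_mass_function R0 C r :
  decays R0 C (ax_u G) -> decays R0 C (ax_al G) -> 0 < r -> R0 <= r -> 8 * C <= r ->
  mass_function (ext_u G) (ext_al G) r <= 8 * adm_flux (ax_g G) r + PI * (200 * C ^ 2) * / r.
Proof.
  intros Hu Ha Hr HR HC.
  rewrite adm_flux_axisymmetric by auto.
  assert (E8 : forall I : R, 8 * (/ 8 * I) = I) by (intros; field). rewrite E8.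
  pose proof PI_RGT_0.
  assert (CP := Ck_P). assert (CQ := Ck_Q).
  destruct CP as (P0 & _ & _ & [P1 _] & [P2 _]). destruct CQ as (Q0 & _ & _ & [Q1 _] & [Q2 _]).
  (* The radius is frozen at r: the density divides by it, and only continuity in th is at stake. *)
  assert (Cf : cont2 (fun r0 th => flux_density r th)).
  { unfold flux_density, Rdiv. cont. }
  assert (Cm : cont2 (mass_density (ext_u G) (ext_al G))).
  { apply cont2_mass_density; [ apply ext_u_Ck | apply ext_al_Ck ]. }
  unfold mass_function.
  assert (EK : PI * (200 * C ^ 2) * / r = RInt (fun _ => 200 * C ^ 2 * / r) 0 PI)
    by (rewrite RInt_const_R; ring).
  rewrite EK.
  assert (Cf1 : forall th, continuous (fun th => flux_density r th) th).
  { intros th. apply (cont_comp2 (fun r0 th => flux_density r th) (fun _ => 0) (fun th => th)); auto; cont. }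
  rewrite <- RInt_plus_R by (auto; intros; cont).
  apply RInt_le; [ lra | exint | apply ex_RInt_cont; intros; apply cont_plus; [ apply Cf1 | cont ] |].
  intros th Hth.
  assert (Hs : 0 < sin th) by (apply sin_gt_0; lra).
  set (x := r * sin th). set (y := r * cos th).
  assert (Hx : 0 < x) by (apply Rmult_lt_0_compat; auto).
  assert (Er : sqrt (x ^ 2 + y ^ 2) = r).
  { replace (x ^ 2 + y ^ 2) with (r ^ 2 * ((sin th)² + (cos th)²)) by (unfold x, y, Rsqr; ring).
    rewrite sin2_cos2, Rmult_1_r. apply sqrt_pow2; lra. }
  destruct (ext_decay G HAB R0 C x y Hu Ha Hx) as ((B1 & B2) & (B3 & B4) & (B5 & B6)); [ lra |].
  rewrite Er in *.
  replace (C / r ^ 2) with (C / r / r) in * by (field; lra).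
  unfold flux_density, mass_density. fold x y. cbv zeta.
  destruct (D_P x y) as [-> ->]. destruct (D_Q x y) as [-> ->].
  unfold P, Q, conf.
  pose proof (flux_linearization r (sin th) (cos th) (ext_u G x y) (ext_al G x y)
    (D1 (ext_u G) x y) (D2 (ext_u G) x y) (D1 (ext_al G) x y) (D2 (ext_al G) x y) (C / r) Hr) as L.
  cbv zeta in L.
  assert (X : 200 * (C / r) ^ 2 * r = 200 * C ^ 2 * / r) by (field; lra).
  rewrite X in L.
  assert (Y := L).
  apply Rabs_le_between in Y; auto.
  - lra.
  - apply Rabs_le; pose proof (SIN_bound th); lra.
  - apply Rabs_le; pose proof (COS_bound th); lra.
  - apply Rmult_le_reg_r with r; auto. unfold Rdiv; rewrite Rmult_assoc, Rinv_l by lra. lra.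
Qed.

(** The mass function is nondecreasing, so its value at r is below its value at every larger radius
    s, hence below 8 times the flux through the sphere of radius s plus O(1 / s). Now s tends to
    infinity. *)
Lemma mass_function_le R0 C m r :
  decays R0 C (ax_u G) -> decays R0 C (ax_al G) -> nonneg_scalar_curvature G ->
  is_adm_mass (ax_g G) m -> 0 <= r ->
  mass_function (ext_u G) (ext_al G) r <= 8 * m.
Proof.
  intros Hu Ha Hs Hm Hr.
  assert (L : is_lim (fun r => 8 * adm_flux (ax_g G) r + PI * (200 * C ^ 2) * / r) p_infty
                (8 * m + PI * (200 * C ^ 2) * 0)).
  { apply is_lim_plus'.
    - apply (is_lim_scal_l (adm_flux (ax_g G)) 8 p_infty m Hm).
    - apply (is_lim_scal_l Rinv (PI * (200 * C ^ 2)) p_infty 0).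
      replace (Finite 0) with (Rbar_inv p_infty) by reflexivity.
      apply is_lim_inv; [ apply is_lim_id | discriminate ]. }
  rewrite Rmult_0_r, Rplus_0_r in L.
  apply (is_lim_le_loc (fun _ => mass_function (ext_u G) (ext_al G) r)
    (fun r => 8 * adm_flux (ax_g G) r + PI * (200 * C ^ 2) * / r) p_infty
    (mass_function (ext_u G) (ext_al G) r) (8 * m)); auto; [| apply is_lim_const ].
  exists (Rmax (Rmax r 1) (Rmax R0 (8 * C))). intros s Hs1.
  pose proof (Rmax_l (Rmax r 1) (Rmax R0 (8 * C))). pose proof (Rmax_r (Rmax r 1) (Rmax R0 (8 * C))).
  pose proof (Rmax_l r 1). pose proof (Rmax_r r 1).
  pose proof (Rmax_l R0 (8 * C)). pose proof (Rmax_r R0 (8 * C)).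
  apply Rle_trans with (mass_function (ext_u G) (ext_al G) s).
  - apply mass_function_nondecreasing; try lra.
    + apply ext_u_Ck.
    + apply ext_al_Ck.
    + apply ext_al_axis; auto.
    + apply axial_source_ge; auto.
  - apply (flux_mass_function R0 C); auto; lra.
Qed.
End Flux.

(** * Curves in a meridian half-plane *)

Lemma path_length_trans g x y z L L' :
  path_length g x y L -> path_length g y z L' -> path_length g x z (L + L').
Proof.
  induction 1 as [x|c y L Hc Hp IH]; intros H.
  - rewrite Rplus_0_l; auto.
  - rewrite Rplus_assoc; apply path_cons; auto.
Qed.

Lemma path_length_curve g c : C1_curve c -> path_length g (c 0) (c 1) (arc_length g c).
Proof. intros Hc; rewrite <- (Rplus_0_r (arc_length g c)). apply path_cons; auto; apply path_nil. Qed.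

Section Reach.
Context (G : axisym_metric).
Context (HAB : forall rho z, 0 < rho -> ax_A G rho z = 0 /\ ax_B G rho z = 0).
Context (phi0 : R).

Definition path_bound (x y x' y' l : R) : Prop :=
  exists L, path_length (ax_g G) (cyl_pt x y phi0) (cyl_pt x' y' phi0) L /\ L <= l.

(** Both directions are carried along, so that symmetry holds without reversing a concatenation of
    arcs. *)
Definition meridian_reach (x y x' y' l : R) : Prop :=
  path_bound x y x' y' l /\ path_bound x' y' x y l.

(** Along a straight segment of the half-plane phi = phi0 the speed is e^(al - u) times the constant
    Euclidean speed, and al - u = u + w. *)
Lemma path_bound_segment a1 a2 b1 b2 x y x' y' B :
  0 < a1 -> a1 <= x <= a2 -> b1 <= y <= b2 -> a1 <= x' <= a2 -> b1 <= y' <= b2 ->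
  (forall t, 0 <= t <= 1 ->
     ext_u G ((1 - t) * x + t * x') ((1 - t) * y + t * y')
     + ext_w G ((1 - t) * x + t * x') ((1 - t) * y + t * y') <= B) ->
  path_bound x y x' y' (exp B * sqrt ((x' - x) ^ 2 + (y' - y) ^ 2)).
Proof.
  intros Ha Hx Hy Hx' Hy' HB.
  set (c := fun t => cyl_pt ((1 - t) * x + t * x') ((1 - t) * y + t * y') phi0).
  set (V := fun i => match i with i1 => (x' - x) * cos phi0 | i2 => (x' - x) * sin phi0 | i3 => y' - y end).
  assert (HV : forall i t, is_derive (fun s => coord i (c s)) t (V i)).
  { intros i t; destruct i; unfold c, V, cyl_pt; cbn [coord fst snd]; auto_derive; auto; ring. }
  assert (DV : forall i, Derive (fun s => coord i (c s)) = fun _ => V i)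
    by (intros i; extensionality t; apply is_derive_unique, HV).
  assert (Hc : C1_curve c).
  { intros i t; split; [ eexists; apply HV |]. rewrite DV. apply continuous_const. }
  exists (arc_length (ax_g G) c); split.
  - replace (cyl_pt x y phi0) with (c 0) by (unfold c; f_equal; ring).
    replace (cyl_pt x' y' phi0) with (c 1) by (unfold c; f_equal; ring).
    apply path_length_curve; auto.
  - set (v := fun x z => ext_u G x z + ext_w G x z) in *.
    set (d := (x' - x) ^ 2 + (y' - y) ^ 2).
    assert (Hd : 0 <= d) by (apply Rplus_le_le_0_compat; apply pow2_ge_0).
    assert (Cv : cont2 v).
    { assert (Cu := Ck_cont2 _ _ (ext_u_Ck G 0)). assert (Cw := Ck_cont2 _ _ (ext_w_Ck G 0)).
      unfold v; cont. }
    unfold arc_length.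
    rewrite (RInt_ext _ (fun t => exp (v ((1 - t) * x + t * x') ((1 - t) * y + t * y')) * sqrt d)).
    + replace (exp B * sqrt d) with ((1 - 0) * (exp B * sqrt d)) by ring.
      rewrite <- RInt_const_R. apply RInt_le_cont; [ lra | intros; cont | intros; cont |].
      intros t Ht. apply Rmult_le_compat_r; [ apply sqrt_pos |].
      apply exp_monotone, HB; auto.
    + rewrite Rmin_left, Rmax_right by lra. intros t Ht.
      set (X := (1 - t) * x + t * x'). set (Y := (1 - t) * y + t * y').
      assert (HX : 0 < X).
      { pose proof (convex_between x x' t ltac:(lra)) as Hb. fold X in Hb.
        unfold Rmin in Hb; destruct (Rle_dec x x'); lra. }
      assert (E : quad (ax_g G) (c t) (fun i => Derive (fun s => coord i (c s)) t) = conf (ext_u G) (ext_al G) X Y * d).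
      { unfold quad, sum3. rewrite !DV. unfold c at 1 2 3 4 5 6 7 8 9. fold X Y.
        rewrite !(cartesian_components G HAB) by auto.
        unfold cartesian, V, d.
        pose proof (sin2_cos2 phi0) as Z; unfold Rsqr in Z.
        set (q := conf (ext_u G) (ext_al G) X Y). set (p := exp (-2 * ext_u G X Y)).
        set (cc := cos phi0) in *; set (ss := sin phi0) in *.
        transitivity (q * (x' - x) ^ 2 * ((ss * ss + cc * cc) * (ss * ss + cc * cc)) + q * (y' - y) ^ 2);
          [ ring | rewrite Z; ring ]. }
      rewrite E.
      replace (conf (ext_u G) (ext_al G) X Y) with (exp (v X Y) * exp (v X Y)).
      * rewrite sqrt_mult_alt, sqrt_square; auto.
        -- apply Rlt_le, exp_pos.
        -- apply Rlt_le, Rmult_lt_0_compat; apply exp_pos.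
      * unfold conf, v, ext_w. rewrite <- exp_plus; f_equal; ring.
Qed.

Lemma meridian_conformal_reach a1 a2 b1 b2 : 0 < a1 ->
  conformal_reach a1 a2 b1 b2 (fun x y => ext_u G x y + ext_w G x y) meridian_reach.
Proof.
  intros Ha; unfold meridian_reach; constructor.
  - intros x y; split; exists 0; split; try apply path_nil; lra.
  - intros x y x' y' l [H H']; auto.
  - intros x y x' y' x'' y'' l l' [(L1 & P1 & B1) (L2 & P2 & B2)] [(L3 & P3 & B3) (L4 & P4 & B4)].
    split.
    + exists (L1 + L3); split; [ eapply path_length_trans; eauto | lra ].
    + exists (L4 + L2); split; [ eapply path_length_trans; eauto | lra ].
  - intros x y x' y' l l' Hl [(L1 & P1 & B1) (L2 & P2 & B2)].
    split; [ exists L1 | exists L2 ]; split; auto; lra.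
  - intros x y x' y' B Hx Hy Hx' Hy' HB; split.
    + apply (path_bound_segment a1 a2 b1 b2); auto.
    + replace ((x' - x) ^ 2 + (y' - y) ^ 2) with ((x - x') ^ 2 + (y - y') ^ 2) by ring.
      apply (path_bound_segment a1 a2 b1 b2); auto.
      intros t Ht. specialize (HB (1 - t) ltac:(lra)).
      replace (1 - (1 - t)) with t in HB by ring.
      rewrite (Rplus_comm ((1 - t) * x')), (Rplus_comm ((1 - t) * y')). exact HB.
Qed.
End Reach.

(** * From small mass to small energy, and the choice of the constants *)

Lemma iint_widen f a1 a2 b1 b2 a2' b1' b2' : cont2 f -> (forall x y, 0 <= f x y) ->
  a1 <= a2 -> a2 <= a2' -> b1' <= b1 -> b1 <= b2 -> b2 <= b2' ->
  iint f a1 a2 b1 b2 <= iint f a1 a2' b1' b2'.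
Proof.
  intros Hf Hp H1 H2 H3 H4 H5.
  apply Rle_trans with (iint f a1 a2' b1 b2).
  - apply RInt_le_cont; auto using cont_RInt_inner.
    intros y _; apply RInt_nonneg_mono; auto; try lra. intros; cont.
  - apply RInt_nonneg_mono; auto using cont_RInt_inner.
    intros y _; apply RInt_ge_0; [ lra | exint | auto ].
Qed.

(** The factor 3 = 1 + 2 comes from w = al - 2 u. The absolute value of C is taken because its sign
    is not prescribed. *)
Lemma edge_decay G (HAB : forall rho z, 0 < rho -> ax_A G rho z = 0 /\ ax_B G rho z = 0) R0 C L x z :
  decays R0 C (ax_u G) -> decays R0 C (ax_al G) ->
  0 < L -> R0 <= L -> 0 < x -> L <= x \/ L <= Rabs z ->
  (Rabs (ext_u G x z) <= 3 * Rabs C / L /\ Rabs (ext_w G x z) <= 3 * Rabs C / L) /\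
  (Rabs (D1 (ext_w G) x z) <= 3 * Rabs C / L ^ 2 /\ Rabs (D2 (ext_w G) x z) <= 3 * Rabs C / L ^ 2).
Proof.
  intros Hu Ha HL HR Hx HD.
  assert (Hr : L <= sqrt (x ^ 2 + z ^ 2)).
  { rewrite <- (sqrt_pow2 L) by lra. apply sqrt_le_1_alt. rewrite <- (pow2_abs z).
    pose proof (Rabs_pos z). destruct HD; nra. }
  destruct (ext_decay G HAB R0 C x z Hu Ha Hx) as ((B1 & B2) & (B3 & B4) & (B5 & B6)); [ lra |].
  set (r := sqrt (x ^ 2 + z ^ 2)) in *.
  pose proof (Rabs_pos C) as HC.
  assert (K1 : C / r <= Rabs C / L).
  { apply Rle_trans with (Rabs C / r).
    - apply Rmult_le_compat_r; [ left; apply Rinv_0_lt_compat; lra | apply Rle_abs ].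
    - apply Rmult_le_compat_l; auto. apply Rinv_le_contravar; lra. }
  assert (K2 : C / r ^ 2 <= Rabs C / L ^ 2).
  { apply Rle_trans with (Rabs C / r ^ 2).
    - apply Rmult_le_compat_r; [ left; apply Rinv_0_lt_compat, pow_lt; lra | apply Rle_abs ].
    - apply Rmult_le_compat_l; auto. apply Rinv_le_contravar; [ apply pow_lt; lra | apply pow_incr; lra ]. }
  assert (N1 : 0 <= Rabs C / L) by (apply Rdiv_le_0_compat; lra).
  replace (3 * Rabs C / L) with (Rabs C / L + 2 * (Rabs C / L)) by (field; lra).
  replace (3 * Rabs C / L ^ 2) with (Rabs C / L ^ 2 + 2 * (Rabs C / L ^ 2)) by (field; lra).
  destruct (D_ext_w G x z) as [-> ->]. unfold ext_w.
  assert (K : forall a b e, Rabs a <= e -> Rabs b <= e -> Rabs (a + -2 * b) <= e + 2 * e).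
  { intros a b e H1 H2. apply Rabs_plus_le; auto. apply Rabs_mult_le; auto. rewrite Rabs_left; lra. }
  replace (D1 (ext_al G) x z - 2 * D1 (ext_u G) x z) with (D1 (ext_al G) x z + -2 * D1 (ext_u G) x z) by ring.
  replace (D2 (ext_al G) x z - 2 * D2 (ext_u G) x z) with (D2 (ext_al G) x z + -2 * D2 (ext_u G) x z) by ring.
  repeat split; [ lra | apply K; lra .. ].
Qed.

(** The first term bounds the energy of u, the bracket the weighted energy of w. The gradient of w
    on the outer edges is at most beta = 3 |C| / L^2, whereas the length entering [log_energy_bound]
    is at most 4 L; thus the outer flux contributes 4 beta 4 L = 48 |C| / L, which still tends to
    0. *)
Lemma small_energy_of_small_mass G (HAB : forall rho z, 0 < rho -> ax_A G rho z = 0 /\ ax_B G rho z = 0)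
    R0 C rho0 L m la :
  decays R0 C (ax_u G) -> decays R0 C (ax_al G) -> nonneg_scalar_curvature G ->
  (forall z, D1 (ext_w G) rho0 z <= 0) -> is_adm_mass (ax_g G) m ->
  0 < rho0 -> rho0 <= L -> R0 <= L -> 0 < la ->
  small_energy (ext_u G) (ext_w G) rho0 L (- L) L
    (8 * m / rho0 + (4 / rho0 * (la * (8 * m / rho0) + 2 * L ^ 2 / la) + 48 * Rabs C / L)).
Proof.
  intros Hu Ha Hs Hw Hm Hr HL HR Hla c.
  set (u := ext_u G) in *. set (w := ext_w G) in *.
  assert (Cu : Ck 2 u) by apply ext_u_Ck. assert (Cw : Ck 2 w) by apply ext_w_Ck.
  assert (HD : iint (fun x y => D1 u x y ^ 2 + D2 u x y ^ 2) rho0 L (- L) L <= 8 * m / rho0).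
  { apply (dirichlet_energy_bound u (ext_al G)); auto.
    - apply ext_al_Ck.
    - intros; apply ext_al_axis; auto.
    - apply axial_source_ge; auto.
    - apply (mass_function_le G HAB R0 C); auto; lra. }
  assert (HLog := log_energy_bound u w rho0 L (- L) L (3 * Rabs C / L ^ 2) (8 * m / rho0) la c
    (Ck_pred _ _ Cu) Cw Hr HL ltac:(lra) Hla).
  destruct (Ck2_cont2 u Cu) as (_ & U1 & U2 & _).
  destruct (Ck2_cont2 w Cw) as (W0 & W1 & W2 & _).
  change (energy_density u w c) with (fun x y => (D1 u x y ^ 2 + D2 u x y ^ 2) +
    (D1 w x y ^ 2 + D2 w x y ^ 2) / (1 + (w x y - c) ^ 2)).
  rewrite (iint_plus (fun x y => D1 u x y ^ 2 + D2 u x y ^ 2)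
             (fun x y => (D1 w x y ^ 2 + D2 w x y ^ 2) / (1 + (w x y - c) ^ 2))).
  2: cont.
  2: { cont. apply Rgt_not_eq, one_plus_sq_pos. }
  apply Rplus_le_compat; auto.
  pose proof (Rabs_pos C).
  assert (HiL : 0 < / L) by (apply Rinv_0_lt_compat; lra).
  eapply Rle_trans; [ apply HLog; clear HLog |].
  - intros x y Hx; apply ext_w_supersolution; auto; lra.
  - intros y _; apply Hw.
  - intros y _. apply (edge_decay G HAB R0 C L L y); auto; try lra.
  - intros x Hx; split; apply (edge_decay G HAB R0 C L x); auto; try lra; right;
      [ rewrite Rabs_left; lra | rewrite Rabs_pos_eq; lra ].
  - exact HD.
  - apply Rplus_le_compat.
    + apply Rmult_le_compat_l; [ apply Rdiv_le_0_compat; lra |].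
      apply Rplus_le_compat_l. apply Rmult_le_compat_r; [ left; apply Rinv_0_lt_compat; auto |]. nra.
    + apply Rle_trans with (4 * (3 * Rabs C / L ^ 2) * (4 * L)).
      * apply Rmult_le_compat_l; [| lra ].
        apply Rmult_le_pos; [ lra |]. apply Rdiv_le_0_compat; [ lra | apply pow_lt; lra ].
      * apply Req_le; field; lra.
Qed.

Lemma edist_cyl_pt p q p' q' phi :
  edist (cyl_pt p q phi) (cyl_pt p' q' phi) = sqrt ((p' - p) ^ 2 + (q' - q) ^ 2).
Proof.
  unfold edist, sum3, cyl_pt; cbn [coord fst snd]. f_equal.
  pose proof (sin2_cos2 phi) as Y; unfold Rsqr in Y.
  transitivity ((p' - p) ^ 2 * (sin phi * sin phi + cos phi * cos phi) + (q' - q) ^ 2); [ ring | rewrite Y; ring ].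
Qed.

Theorem theorem1p7 (M : axisym_metric -> Prop) (R0 rho0 : R)
  (hscal : forall G, M G -> nonneg_scalar_curvature G)
  (hAF : uniformly_AF M R0)
  (hrho0 : 0 < rho0)
  (hmono : radially_monotone M rho0)
  (hAB : forall G, M G -> forall rho z, 0 < rho ->
           ax_A G rho z = 0 /\ ax_B G rho z = 0)
  (eps sigma rho1 : R)
  (heps : 0 < eps) (hsigma : 0 < sigma) (hrho1 : Rmax rho0 R0 < rho1) :
  exists delta : R, 0 < delta /\
    forall G, M G ->
    forall m : R, is_adm_mass (ax_g G) m -> m <= delta ->
    forall (x y : pt) (phi0 : R),
      (forall t, 0 <= t <= 1 ->
         exists rho z, Omega rho0 rho1 sigma rho z /\
                       segment x y t = cyl_pt rho z phi0) ->
      Rbar_le (riem_dist (ax_g G) x y) (Finite (edist x y + eps)).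
Proof.
  destruct hAF as [C HC].
  assert (H01 : rho0 < rho1) by (pose proof (Rmax_l rho0 R0); lra).
  assert (HR1 : R0 < rho1) by (pose proof (Rmax_r rho0 R0); lra).
  pose proof (Rabs_pos C) as HCp.
  (* Both coordinates vary by at most rho1 within the region, so 2 rho1 exceeds its diameter; sigma
     is the distance kept from the inner edge rho = rho0. *)
  destruct (short_path (2 * rho1) eps sigma ltac:(lra) heps hsigma) as (kappa & Hk & HS).
  (* The margin 2 sigma is what [short_path] asks for at the outer edges, and the last summand
     brings u and w below kappa there. *)
  set (L := rho1 + 2 * sigma + 3 * Rabs C / kappa).
  assert (0 <= 3 * Rabs C / kappa) by (apply Rdiv_le_0_compat; lra).
  assert (HL : rho1 + 2 * sigma <= L) by (unfold L; lra).
  assert (HLk : 3 * Rabs C / L <= kappa).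
  { apply Rmult_le_reg_r with L; [ lra |]. unfold Rdiv at 1. rewrite Rmult_assoc, Rinv_l, Rmult_1_r by lra.
    apply Rle_trans with (kappa * (3 * Rabs C / kappa)).
    - apply Req_le; field; lra.
    - apply Rmult_le_compat_l; unfold L; lra. }
  destruct (HS (2 * L) ltac:(lra)) as (E & HE & HP). clear HS.
  (* The admissible energy E depends on L, and the outer flux at L need not be below it. The energy
     is therefore estimated on a larger rectangle, where that flux is at most E / 4, and then
     restricted. *)
  set (L' := L + 192 * Rabs C / E).
  assert (0 <= 192 * Rabs C / E) by (apply Rdiv_le_0_compat; lra).
  assert (HL' : L <= L') by (unfold L'; lra).
  assert (HLE : 48 * Rabs C / L' <= E / 4).
  { apply Rmult_le_reg_r with L'; [ lra |]. unfold Rdiv at 1. rewrite Rmult_assoc, Rinv_l, Rmult_1_r by lra.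
    apply Rle_trans with (E / 4 * (192 * Rabs C / E)).
    - apply Req_le; field; lra.
    - apply Rmult_le_compat_l; unfold L'; lra. }
  (* Chosen so that the constant term left by Young's inequality equals E / 4. *)
  set (la := 32 * L' ^ 2 / (rho0 * E)).
  assert (Hla : 0 < la).
  { apply Rdiv_lt_0_compat; [| apply Rmult_lt_0_compat; lra ].
    apply Rmult_lt_0_compat; [ lra | apply pow_lt; lra ]. }
  assert (HlaE : 4 / rho0 * (2 * L' ^ 2 / la) = E / 4) by (unfold la; field; repeat split; lra).
  (* The two entries make the energy of u, and its multiple by 4 la / rho0, at most E / 4 each; the
     four contributions then add up to at most E. *)
  set (delta := Rmin (rho0 * E / 32) (rho0 ^ 2 * E / (128 * la))).
  assert (Hdelta : 0 < delta).
  { apply Rmin_pos.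
    - apply Rdiv_lt_0_compat; [ apply Rmult_lt_0_compat; lra | lra ].
    - apply Rdiv_lt_0_compat; [| lra ]. apply Rmult_lt_0_compat; [ apply pow_lt; lra | lra ]. }
  exists delta; split; auto.
  intros G HG m Hm Hmd x y phi0 Hseg.
  specialize (HC G HG). destruct HC as (Du & Da & _ & _).
  assert (HAB := hAB G HG). assert (Hs := hscal G HG).
  assert (Hw : forall z, D1 (ext_w G) rho0 z <= 0).
  { intros z; apply ext_w_monotone; auto; apply (hmono G HG). }
  assert (HEn : small_energy (ext_u G) (ext_w G) rho0 L (- L) L E).
  { intros c.
    assert (S := small_energy_of_small_mass G HAB R0 C rho0 L' m la Du Da Hs Hw Hm hrho0
      ltac:(lra) ltac:(lra) Hla c).
    assert (A1 : 8 * m / rho0 <= E / 4).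
    { apply Rmult_le_reg_r with rho0; auto. unfold Rdiv at 1. rewrite Rmult_assoc, Rinv_l, Rmult_1_r by lra.
      assert (delta <= rho0 * E / 32) by apply Rmin_l. lra. }
    assert (A2 : 4 / rho0 * (la * (8 * m / rho0)) <= E / 4).
    { apply Rle_trans with (4 / rho0 * (la * (8 * (rho0 ^ 2 * E / (128 * la)) / rho0))).
      - apply Rmult_le_compat_l; [ apply Rdiv_le_0_compat; lra |]. apply Rmult_le_compat_l; [ lra |].
        apply Rmult_le_compat_r; [ left; apply Rinv_0_lt_compat; auto |].
        assert (delta <= rho0 ^ 2 * E / (128 * la)) by apply Rmin_r. lra.
      - apply Req_le; field; lra. }
    rewrite Rmult_plus_distr_l, HlaE in S.
    apply Rle_trans with (iint (energy_density (ext_u G) (ext_w G) c) rho0 L' (- L') L'); [| lra ].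
    apply iint_widen; try lra.
    - apply cont2_energy_density; [ apply ext_u_Ck | apply ext_w_Ck ].
    - intros; apply energy_density_nonneg. }
  destruct (Hseg 0 ltac:(lra)) as (p & q & [Hp Hq] & Ex).
  destruct (Hseg 1 ltac:(lra)) as (p' & q' & [Hp' Hq'] & Ey).
  replace (segment x y 0) with x in Ex
    by (destruct x as [[? ?] ?]; unfold segment; cbn [coord fst snd]; repeat f_equal; ring).
  replace (segment x y 1) with y in Ey
    by (destruct y as [[? ?] ?]; unfold segment; cbn [coord fst snd]; repeat f_equal; ring).
  subst x y. rewrite edist_cyl_pt.
  apply Rabs_le_between in Hq. apply Rabs_le_between in Hq'.
  assert (HD : sqrt ((p' - p) ^ 2 + (q' - q) ^ 2) <= 2 * rho1).
  { rewrite <- (sqrt_pow2 (2 * rho1)) by lra. apply sqrt_le_1_alt. nra. }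
  assert (Hreach : meridian_reach G phi0 p q p' q' (sqrt ((p' - p) ^ 2 + (q' - q) ^ 2) + eps)).
  { apply (HP rho0 L (- L) L (ext_u G) (ext_w G)); auto; try lra.
    - apply ext_u_Ck.
    - apply ext_w_Ck.
    - apply meridian_conformal_reach; auto.
    - intros z _. destruct (edge_decay G HAB R0 C L L z Du Da) as [[B1 B2] _]; lra.
    - intros z Hz. destruct (edge_decay G HAB R0 C L z L Du Da) as [[B1 B2] _]; try lra.
      right; rewrite Rabs_pos_eq; lra. }
  destruct Hreach as [(l & Hl & Hle) _].
  apply Rbar_le_trans with (Finite l); [| exact Hle ].
  apply (proj1 (Glb_Rbar_correct (path_length (ax_g G) (cyl_pt p q phi0) (cyl_pt p' q' phi0)))); auto.
Qed.
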